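(* Let $H$ be a fixed tree, let $c>0$ be a fixed constant, and let $m=m(n)$ satisfy $cn\le m(n)\le(1+o(1))n$. Then there exists $\lambda=\lambda(H,c)>0$ such that, writing $t(n)=\lceil \lambda\,\mathrm{add}(n,m)/n\rceil$, $$\mathbf{P}\big[P_{n,m}\text{ has fewer than } t(n) \text{ components with an order-preserving isomorphism to } H\big]<e^{-t(n)}$$ for all large $n$.
   Context: $\mathcal{P}(n,m)$ is the set of simple labelled planar graphs on vertex set $\{1,\ldots,n\}$ with exactly $m$ edges; $P_{n,m}$ is chosen uniformly at random from $\mathcal{P}(n,m)$. For a planar graph $G$, a non-edge $e$ of $G$ is addable if $G+e$ is planar; $\mathrm{add}(n,m)$ is the minimum, over all $G\in\mathcal{P}(n,m)$, of the number of addable non-edges of $G$. $H$ has vertex set $\{1,\ldots,h\}$, and a component $C$ has an order-preserving isomorphism to $H$ if $|C|=h$ and the increasing bijection from $\{1,\ldots,h\}$ to $V(C)$ is an isomorphism between $H$ and $C$. *)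

(* Defs.v *)
From HB Require Import structures.
From mathcomp Require Import all_boot all_order all_algebra.
From mathcomp Require Import all_classical all_reals all_analysis.
Set Implicit Arguments.
Unset Strict Implicit.
Unset Printing Implicit Defensive.
Import Order.TTheory GRing.Theory Num.Theory.
Import numFieldNormedType.Exports.
Local Open Scope classical_set_scope.
Local Open Scope ring_scope.

(* The vertex set {1, ..., n} is 'I_n, i.e. {0, ..., n-1} with the same order;
   a simple graph is identified with its set of edges, which are 2-subsets. *)
Definition graph (n : nat) := {set {set 'I_n}}.

Definition simple_graph n (G : graph n) : bool :=
  [forall e in G, #|e| == 2%N].

Definition adj n (G : graph n) : rel 'I_n :=
  fun x y => [set x; y]%SET \in G.

Definition connected_graph n (G : graph n) : bool :=
  (0 < n)%N && [forall x, forall y, connect (adj G) x y].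

Definition acyclic n (G : graph n) : Prop :=
  forall s : seq 'I_n, (2 < size s)%N -> ~ ucycle (adj G) s.

Definition is_tree n (G : graph n) : Prop :=
  [/\ simple_graph G, connected_graph G & acyclic G].

(* The points p place the vertices in the plane; gam e is the arc drawing e.
   The last two clauses say that an open arc meets no vertex and no other open
   arc, so distinct arcs can only meet at a common end-vertex. *)
Definition planar (R : realType) n (G : graph n) : Prop :=
  exists (p : 'I_n -> R * R) (gam : {set 'I_n} -> R -> R * R),
  [/\ injective p,
      forall e, e \in G ->
        [/\ {within `[0, 1], continuous (gam e)},
            {in `[0, 1] &, injective (gam e)} &
            exists x y, [/\ e = [set x; y]%SET, gam e 0 = p x & gam e 1 = p y]],
      forall e v (t : R), e \in G -> t \in `]0, 1[ -> gam e t <> p v &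
      forall e e' (t t' : R), e \in G -> e' \in G -> e <> e' ->
        t \in `]0, 1[ -> t' \in `]0, 1[ -> gam e t <> gam e' t'].

Definition planar_graphs (R : realType) (n m : nat) : {set graph n} :=
  [set G : graph n | [&& simple_graph G, `[< planar R G >] & #|G| == m]]%SET.

Definition addable (R : realType) n (G : graph n) : {set {set 'I_n}} :=
  [set e : {set 'I_n} |
    [&& #|e| == 2%N, e \notin G & `[< planar R (e |: G)%SET >]]]%SET.

(* A graph on n vertices has at most 'C(n, 2) non-edges, so the default value
   matters only when planar_graphs R n m is empty. *)
Definition add (R : realType) (n m : nat) : nat :=
  \big[minn/'C(n, 2)]_(G in planar_graphs R n m) #|addable R G|.

Definition components n (G : graph n) : {set {set 'I_n}} :=
  equivalence_partition (connect (adj G)) [set: 'I_n]%SET.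

Definition op_isomorphic h (H : graph h) n (G : graph n) (C : {set 'I_n}) : bool :=
  (#|C| == h) &&
  [exists f : {ffun 'I_h -> 'I_n},
    [&& [forall i : 'I_h, forall j : 'I_h, (i < j)%N ==> (f i < f j)%N],
        (f @: [set: 'I_h])%SET == C &
        [forall i : 'I_h, forall j : 'I_h, adj H i j == adj G (f i) (f j)]]].

Definition num_op_components h (H : graph h) n (G : graph n) : nat :=
  #|[set C in components G | op_isomorphic H G C]%SET|.

Definition prob_planar (R : realType) (n m : nat) (A : pred (graph n)) : R :=
  #|[set G in planar_graphs R n m | A G]%SET|%:R / #|planar_graphs R n m|%:R.

(* The ceiling is of a nonnegative real, so absz is just the cast to nat. *)
Definition threshold (R : realType) (lambda : R) (n m : nat) : nat :=
  `|Num.ceil (lambda * (add R n m)%:R / n%:R)|%N.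

(* Main.v *)
(** Let [G] be a planar graph with [m] edges and fewer than [t] components of type [H].
    Since [m <= (1 + o(1)) n], linearly many vertices of [G] are isolated or have degree
    one or two.  Detach [h] such vertices one by one (a vertex of degree two is
    suppressed, an isolated one is paid for by deleting an edge), put a copy of [H] on
    them, and insert one addable edge.  This gives a planar graph with [m] edges; there
    are about [n^h * add(n,m)] ways to do so, and a result arises in at most
    [O(n^h * n * t)] ways, the factor [t] coming from the choice of the copy of [H].
    Iterating [t] times bounds the proportion of such [G] by [(O(n t / add(n,m)))^t].

    For this to be small when [t = 1] one needs [add(n,m) >= K n] with [K] large.
    Delete leaves and suppress vertices of degree two as long as possible.  As [G] has
    only [o(n)] more edges than vertices, what remains has few vertices and edges, so the
    vertices of [G] are absorbed into few of them, and two vertices absorbed into the same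
    vertex or edge can be joined without destroying planarity.

    Both parts only use moves near a single vertex or edge of a drawing: hanging an edge
    or a triangle at a vertex, subdividing, suppressing, and attaching a triangle to an
    end of an edge.  They are carried out after straightening the drawing inside a small
    ball around a vertex. *)

Require Import Defs.
From HB Require Import structures.
From mathcomp Require Import all_boot all_order all_algebra.
From mathcomp Require Import all_classical all_reals all_analysis.
From mathcomp Require Import perm zify ring lra.
Set Implicit Arguments.
Unset Strict Implicit.
Unset Printing Implicit Defensive.
Import Order.TTheory GRing.Theory Num.Theory.
Import numFieldNormedType.Exports.
Local Open Scope classical_set_scope.
Local Open Scope ring_scope.

(** * Arcs in the plane *)

(** A vertex of degree two whose neighbours are adjacent disturbs both halves of the argument,
    because suppressing it would double an edge. In the switching it is deleted, which loses two
    edges, and one addable edge is put back: the extra choice of an edge forwards balances the extra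
    unknown edge backwards. In the reduction such a vertex stays, and if its neighbours have degree
    two as well, the triangle is a component and is discarded whole; otherwise it has a neighbour of
    larger degree, which keeps such vertices few. The detached vertices are carried as a list beside
    the graph. Each substep then compares two finite sets whose sizes differ by a bounded factor,
    and the head of the list tells which vertex to put back. The number of copies of [H] tolerated
    grows by a constant in each round, at most by the number of vertices the round touches; over [t]
    rounds it remains of order [t]. The combinatorial part sees planarity only through the closure
    properties in [planar_class]. At the end every round gains a factor 5, and [5 > e] makes the
    final inequality strict. *)

Definition arc (R : realType) (A : set (R * R)) (a b : R * R) : Prop :=
  exists g : R -> R * R,
    [/\ continuous g, {in `[0, 1] &, injective g}, g 0 = a, g 1 = b &
        A = [set g t | t in `[0, 1]]].

Definition segment (R : realType) (a b : R * R) : set (R * R) :=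
  [set a + t *: (b - a) | t in `[0, 1]].

(** The retraction of the line onto the unit interval, written with norms so that its continuity
    comes from that of the norm. *)
Definition clamp01 (R : realType) (t : R) : R := (`|t| - `|t - 1| + 1) / 2.

Section Arcs.
Variable R : realType.
Implicit Types (a b c q : R * R) (A B : set (R * R)) (s t : R).

Lemma clamp01_id t : t \in `[0, 1] -> clamp01 t = t.
Proof.
rewrite in_itv/= => /andP[t0 t1]; rewrite /clamp01 ger0_norm// ler0_norm ?subr_le0//.
by field.
Qed.

Lemma clamp01_le0 t : t <= 0 -> clamp01 t = 0.
Proof.
by move=> t0; rewrite /clamp01 !ler0_norm//; [field | lra].
Qed.

Lemma clamp01_ge1 t : 1 <= t -> clamp01 t = 1.
Proof.
by move=> t1; rewrite /clamp01 !ger0_norm//; [field | lra | lra].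
Qed.

Lemma clamp01_in t : clamp01 t \in `[0, 1].
Proof.
have [t0|t0] := leP t 0; first by rewrite clamp01_le0// in_itv/= lexx ler01.
have [t1|t1] := leP 1 t; first by rewrite clamp01_ge1// in_itv/= lexx ler01.
have tin : t \in `[0, 1] by rewrite in_itv/= !ltW.
by rewrite clamp01_id.
Qed.

Lemma continuous_fcomp (T : topologicalType) (f : R -> R) (g : R -> T) :
  continuous f -> continuous g -> continuous (g \o f).
Proof. by move=> cf cg x; exact: (continuous_comp (cf x) (cg (f x))). Qed.

Lemma continuous_affine (u v : R) : continuous (fun t : R => u * t + v).
Proof.
move=> x; apply: continuousD; last exact: cst_continuous.
by apply: continuousM; [exact: cst_continuous | exact: cvg_id].
Qed.

Lemma continuous_clamp01 : continuous (@clamp01 R).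
Proof.
move=> x; change {for x, continuous (fun t : R => (`|t| - `|t - 1| + 1) * 2^-1)}.
apply: continuousM; last exact: cst_continuous.
apply: continuousD; last exact: cst_continuous.
apply: continuousB; first exact: norm_continuous.
apply: (continuous_comp (f := fun t : R => t - 1) (g := Num.norm)); last exact: norm_continuous.
by apply: continuousB; [exact: cvg_id | exact: cst_continuous].
Qed.

(** Precomposing with [clamp01] makes the path continuous on the whole line, as [arc] demands,
    without changing its image. Under that convention paths are reparametrised by plain
    composition. *)
Lemma arc_within (g : R -> R * R) :
  {within `[0, 1], continuous g} -> {in `[0, 1] &, injective g} ->
  arc [set g t | t in `[0, 1]] (g 0) (g 1).
Proof.
move=> cg ig; exists (g \o @clamp01 R); split => //.
- move=> x; apply: (@cvg_comp _ _ _ (@clamp01 R) g _ (within `[0, 1] (nbhs (clamp01 x)))); last first.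
    exact: (proj1 (subspace_continuousP _ _) cg _ (clamp01_in x)).
  move=> P; rewrite /within/= => H.
  have H' : nbhs x (fun y => clamp01 y \in `[0, 1] -> P (clamp01 y)) := continuous_clamp01 H.
  by apply: (@filterS _ (nbhs x) _ _ _ _ H') => y; apply; exact: clamp01_in.
- by move=> s t s01 t01; rewrite /= !clamp01_id//; exact: ig.
- by rewrite /= clamp01_id// in_itv/= lexx ler01.
- by rewrite /= clamp01_id// in_itv/= lexx ler01.
- apply/seteqP; split => q [t t01 <-]; exists t => //=; by rewrite clamp01_id.
Qed.

Lemma arc_ends A a b : arc A a b -> A a /\ A b.
Proof.
move=> [g [_ _ <- <- ->]]; split; first by exists 0 => //=; rewrite in_itv/= lexx ler01.
by exists 1 => //=; rewrite in_itv/= lexx ler01.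
Qed.

Lemma arc_neq A a b : arc A a b -> a <> b.
Proof.
move=> [g [_ ig <- <- _]] /ig; rewrite !in_itv/= !lexx ler01 => /(_ isT isT)/eqP.
by rewrite eq_sym oner_eq0.
Qed.

Lemma arc_sym A a b : arc A a b -> arc A b a.
Proof.
move=> [g [cg ig g0 g1 ->]]; exists (fun t => g ((-1) * t + 1)); split.
- exact: (continuous_fcomp (@continuous_affine (-1) 1) cg).
- by move=> s t; rewrite !in_itv/= => s01 t01 /ig; rewrite !in_itv/=; lra.
- by rewrite mulr0 add0r.
- by rewrite mulr1 addNr.
- by apply/seteqP; split => q [t /=]; rewrite in_itv/= => t01 <-;
    exists (-1 * t + 1) => /=; rewrite ?in_itv/=; try (congr g; ring); lra.
Qed.

Lemma arc_closed A a b : arc A a b -> closed A.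
Proof.
move=> [g [cg _ _ _ ->]]; apply: compact_closed; first exact: norm_hausdorff.
apply: continuous_compact; last exact: segment_compact.
exact: continuous_subspaceT.
Qed.

Lemma arc_reparam (g : R -> R * R) s t : s < t -> continuous g ->
  {in `[s, t] &, injective g} -> arc [set g u | u in `[s, t]] (g s) (g t).
Proof.
move=> st cg ig; exists (fun u => g ((t - s) * u + s)).
have H u : u \in `[0, 1] -> (t - s) * u + s \in `[s, t].
  by rewrite !in_itv/= => u01; nra.
split.
- exact: (continuous_fcomp (@continuous_affine (t - s) s) cg).
- move=> u v u01 v01 /(ig _ _ (H _ u01) (H _ v01)) /addIr /mulfI; apply.
  by rewrite subr_eq0 gt_eqF.
- by rewrite mulr0 add0r.
- by rewrite mulr1 subrK.
- apply/seteqP; split => q [u u01 <-]; last by exists ((t - s) * u + s) => //; exact: H.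
  move: u01; rewrite /= in_itv/= => u01.
  have ts : t - s != 0 by rewrite subr_eq0 gt_eqF.
  exists ((u - s) / (t - s)); last by congr g; field.
  by rewrite /= in_itv/= divr_ge0 ?ler_pdivrMr ?mul1r; lra.
Qed.

Lemma arc_split A a b q : arc A a b -> A q -> q <> a -> q <> b ->
  exists A1 A2, [/\ arc A1 a q, arc A2 q b, A = A1 `|` A2 &
    forall x, A1 x -> A2 x -> x = q].
Proof.
move=> [g [cg ig g0 g1 ->]] [s /=]; rewrite in_itv/= => s01 gs qa qb.
have s0 : 0 < s.
  by rewrite lt0r andbC; case/andP: s01 => -> _ /=; apply/eqP => s0; apply: qa; rewrite -gs -g0 s0.
have s1 : s < 1.
  by rewrite lt_neqAle; case/andP: s01 => _ -> /=; rewrite andbT; apply/eqP => s1; apply: qb; rewrite -gs -g1 s1.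
exists [set g u | u in `[0, s]], [set g u | u in `[s, 1]]; split.
- rewrite -g0 -gs; apply: arc_reparam => // u v; rewrite !in_itv/= => u0 v0.
  by apply: ig; rewrite in_itv/=; lra.
- rewrite -g1 -gs; apply: arc_reparam => // u v; rewrite !in_itv/= => u0 v0.
  by apply: ig; rewrite in_itv/=; lra.
- apply/seteqP; split => x.
    move=> [u /=]; rewrite in_itv/= => u01 <-; have [us|us] := leP u s.
      by left; exists u => //=; rewrite in_itv/=; lra.
    by right; exists u => //=; rewrite in_itv/=; lra.
  by move=> [] [u /=]; rewrite in_itv/= => u01 <-; exists u => //=; rewrite in_itv/=; lra.
- move=> x [u /=]; rewrite in_itv/= => u01 <- [v /=]; rewrite in_itv/= => v01 /ig.
  rewrite !in_itv/= -gs => E; congr g; have : v = u by apply: E; lra.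
  lra.
Qed.

(* The path that runs through [A] while [clamp01 (2t)] moves and then through [B]
   while [clamp01 (2t-1)] moves; adding the two and subtracting the common point
   avoids pasting continuous functions. *)
Lemma arc_concat A B a b c : arc A a b -> arc B b c ->
  (forall x, A x -> B x -> x = b) -> arc (A `|` B) a c.
Proof.
move=> [f [cf injf f0 f1 AE]] [g [cg ig g0 g1 BE]] AB.
pose h t := f (clamp01 (2 * t + 0)) + g (clamp01 (2 * t - 1)) - b.
have h1 t : t <= 1/2 -> h t = f (clamp01 (2 * t)).
  move=> t2; rewrite /h addr0 [clamp01 (_ - 1)]clamp01_le0 ?g0 ?addrK//; lra.
have h2 t : 1/2 <= t -> h t = g (clamp01 (2 * t - 1)).
  move=> t2; rewrite /h addr0 [clamp01 (2 * t)]clamp01_ge1 ?f1; last lra.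
  by rewrite addrC addrA addNr add0r.
have i0 : 0 \in `[(0:R), 1] by rewrite in_itv/= lexx ler01.
have i1 : 1 \in `[(0:R), 1] by rewrite in_itv/= lexx ler01.
exists h; split.
- have cf' := continuous_fcomp (continuous_fcomp (@continuous_affine 2 0) continuous_clamp01) cf.
  have cg' := continuous_fcomp (continuous_fcomp (@continuous_affine 2 (-1)) continuous_clamp01) cg.
  by move=> x; exact: (continuousB (continuousD (cf' x) (cg' x)) (@cst_continuous _ _ b x)).
- have cross s t : s \in `[0, 1] -> t \in `[0, 1] -> s <= 1/2 -> 1/2 < t -> h s <> h t.
    rewrite !in_itv/= => s01 t01 s2 t2; rewrite h1// h2 ?(ltW t2)//.
    have -> : clamp01 (2 * s) = 2 * s by rewrite clamp01_id ?in_itv//=; lra.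
    have -> : clamp01 (2 * t - 1) = 2 * t - 1 by rewrite clamp01_id ?in_itv//=; lra.
    move=> E; have fb : f (2 * s) = b.
      apply: AB; first by rewrite AE; exists (2 * s) => //=; rewrite in_itv/=; lra.
      by rewrite E BE; exists (2 * t - 1) => //=; rewrite in_itv/=; lra.
    have : 2 * t - 1 = 0 by apply: ig; rewrite ?in_itv/= ?g0 -?E//; lra.
    lra.
  move=> s t s01 t01; have [s2|s2] := leP s (1/2); have [t2|t2] := leP t (1/2).
  + move: s01 t01; rewrite !in_itv/= => s01 t01.
    rewrite !h1//.
    have -> : clamp01 (2 * s) = 2 * s by rewrite clamp01_id ?in_itv//=; lra.
    have -> : clamp01 (2 * t) = 2 * t by rewrite clamp01_id ?in_itv//=; lra.
    move=> /injf; rewrite !in_itv/= => E; have : 2 * s = 2 * t by apply: E; lra.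
    by move=> /mulfI; apply; rewrite pnatr_eq0.
  + by move=> /cross; case.
  + by move=> /esym /cross; case.
  + move: s01 t01; rewrite !in_itv/= => s01 t01.
    rewrite !h2 ?(ltW s2) ?(ltW t2)//.
    have -> : clamp01 (2 * s - 1) = 2 * s - 1 by rewrite clamp01_id ?in_itv//=; lra.
    have -> : clamp01 (2 * t - 1) = 2 * t - 1 by rewrite clamp01_id ?in_itv//=; lra.
    move=> /ig; rewrite !in_itv/= => E; have : 2 * s - 1 = 2 * t - 1 by apply: E; lra.
    by move=> /addIr /mulfI; apply; rewrite pnatr_eq0.
- by rewrite h1 ?mulr0 ?clamp01_id//; lra.
- by rewrite h2 ?mulr1; [rewrite clamp01_ge1; [|lra] | lra].
- apply/seteqP; split => x.
    case; rewrite ?AE ?BE => -[t /=]; rewrite in_itv/= => t01 <-.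
      exists (t / 2); first by rewrite /= in_itv/=; lra.
      rewrite h1; last lra.
      congr f; have -> : 2 * (t / 2) = t by field.
      by rewrite clamp01_id ?in_itv.
    exists ((t + 1) / 2); first by rewrite /= in_itv/=; lra.
    rewrite h2; last lra.
    congr g; have -> : 2 * ((t + 1) / 2) - 1 = t by field.
    by rewrite clamp01_id ?in_itv.
  move=> [t /=]; rewrite in_itv/= => t01 <-; have [t2|t2] := leP t (1/2).
    by left; rewrite AE h1//; exists (clamp01 (2 * t)) => //; exact: clamp01_in.
  by right; rewrite BE h2 ?(ltW t2)//; exists (clamp01 (2 * t - 1)) => //; exact: clamp01_in.
Qed.

Lemma arc_segment a b : a <> b -> arc (segment a b) a b.
Proof.
move=> ab; exists (fun t => a + t *: (b - a)); split => //.
- move=> x; exact: (continuousD (@cst_continuous _ _ a x) (@scalel_continuous _ _ (b - a) x)).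
- move=> s t _ _ /addrI /eqP; rewrite -subr_eq0 -scalerBl scaler_eq0 subr_eq0 subr_eq0.
  by case/orP => /eqP // E; case: ab.
- by rewrite scale0r addr0.
- by rewrite scale1r addrC subrK.
Qed.

(** Cut at the last parameter whose point lies in the closed ball: everything later is outside by
    maximality, and the point itself is on the sphere by continuity. The piece [B] is what survives
    when the beginning of an arc is replaced by a straight segment. *)
Lemma arc_last_exit A a b (r : R) : 0 <= r -> arc A a b -> r < `|b - a| ->
  exists q B, [/\ `|q - a| = r, arc B q b, B `<=` A &
    forall x, B x -> `|x - a| <= r -> x = q].
Proof.
move=> r0 [g [cg ig g0 g1 ->]] rb.
have cn : continuous (fun t => `|g t - a|).
  move=> x; apply: (continuous_comp (f := fun t => g t - a) (g := Num.norm)); last exact: norm_continuous.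
  exact: (continuousB (cg x) (@cst_continuous _ _ a x)).
have i0 : (0:R) \in `[(0:R), 1] by rewrite in_itv/= lexx ler01.
pose T := [set t : R | t \in `[0, 1]] `&` [set t | `|g t - a| <= r].
have cT : compact T.
  apply: compact_closedI; first exact: segment_compact.
  have := @preimage_closed _ _ (fun t => `|g t - a|) [set x | x <= r].
  by apply; [move=> x _; exact: cn | exact: closed_le].
have T0 : T 0 by split => //=; rewrite g0 subrr normr0.
have cid : {within T, continuous (fun x : R => x)}.
  by apply: continuous_subspaceT => x; exact: cvg_id.
have [s] := compact_EVT_max (ex_intro _ _ T0) cT cid.
rewrite inE => -[/= s01 sr] smax.
have smax' t : t \in `[0, 1] -> s < t -> r < `|g t - a|.
  move=> t01 st; rewrite ltNge; apply/negP => tr.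
  have /(_ _)/= : t \in T -> t <= s by exact: smax.
  by rewrite inE leNgt st => /(_ (conj t01 tr)).
have s1 : s < 1.
  rewrite lt_neqAle; move: (s01); rewrite in_itv/= => /andP[_ ->]; rewrite andbT.
  by apply/eqP => s1; move: sr rb; rewrite s1 g1 leNgt => /negP.
have sE : `|g s - a| = r.
  apply/eqP; rewrite eq_le sr leNgt; apply/negP => lsr.
  have : \forall t \near s, `|g t - a| < r by exact: (cvgr_lt (`|g s - a|) (cn s)).
  move=> /nbhs_ballP[d /= d0]; rewrite -ball_normE => dP.
  pose t := Num.min 1 (s + d / 2).
  have ts : s < t by rewrite /t lt_min s1/=; lra.
  have t01 : t \in `[0, 1].
    by move: s01; rewrite !in_itv/= => /andP[s0 _]; rewrite (le_trans s0 (ltW ts)) /t ge_min lexx.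
  have := smax' t t01 ts; rewrite ltNge => /negP; apply; apply/ltW/dP => /=.
  rewrite ler0_norm; last lra.
  suff : t <= s + d / 2 by lra.
  by rewrite /t ge_min lexx orbT.
exists (g s), [set g u | u in `[s, 1]]; split => //.
- rewrite -g1; apply: arc_reparam => // u v; move: s01; rewrite !in_itv/= => s01 u0 v0.
  by apply: ig; rewrite in_itv/=; lra.
- move=> x [u /=]; move: s01; rewrite !in_itv/= => s01 u0 <-; exists u => //=.
  by rewrite in_itv/=; lra.
- move=> x [u /=]; rewrite in_itv/= => /andP[u0 u1] <- ur; congr g.
  apply/eqP; rewrite eq_le u0 andbT leNgt; apply/negP => su.
  suff : r < `|g u - a| by rewrite ltNge ur.
  by apply: smax' => //; move: s01; rewrite !in_itv/=; lra.
Qed.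

End Arcs.

(** * Drawings and local moves *)

(** Arcs are kept as point sets, which can be cut and glued without parametrisations. [V] may be a
    proper subset of the vertices: a move takes an isolated vertex out of the drawing and puts it
    back at the point it needs. *)
Definition drawing (R : realType) (n : nat) (V : {set 'I_n}) (G : graph n)
    (p : 'I_n -> R * R) (A : {set 'I_n} -> set (R * R)) : Prop :=
  [/\ {in V &, injective p},
      forall e, e \in G -> exists x y,
        [/\ e = [set x; y]%SET, x \in V, y \in V & arc (A e) (p x) (p y)],
      forall e v, e \in G -> v \in V -> A e (p v) -> v \in e &
      forall e e' q, e \in G -> e' \in G -> e <> e' -> A e q -> A e' q ->
        exists2 v, v \in V & q = p v].

Definition drawable (R : realType) (n : nat) (V : {set 'I_n}) (G : graph n) : Prop :=
  exists (p : 'I_n -> R * R) A, drawing V G p A.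

Lemma set2_inj (T : finType) (a x y : T) : [set a; x]%SET = [set a; y]%SET -> x = y.
Proof.
move=> E; have : x \in [set a; y]%SET by rewrite -E !inE eqxx orbT.
rewrite !inE => /orP[/eqP xa|/eqP //]; have : y \in [set a; x]%SET by rewrite E !inE eqxx orbT.
by rewrite !inE xa orbb => /eqP ->.
Qed.

Lemma set2_eq (T : finType) (a b x y : T) : [set a; b]%SET = [set x; y]%SET ->
  (a = x /\ b = y) \/ (a = y /\ b = x).
Proof.
move=> E; have : a \in [set x; y]%SET by rewrite -E !inE eqxx.
rewrite !inE => /orP[] /eqP Ea; rewrite Ea in E *.
  by left; split => //; exact: set2_inj E.
by right; split => //; apply: (@set2_inj _ y); rewrite E finset.setUC.
Qed.

Section Drawings.
Variables (R : realType) (n : nat).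
Implicit Types (V : {set 'I_n}) (G : graph n) (p : 'I_n -> R * R)
  (A : {set 'I_n} -> set (R * R)).

Lemma drawing_arc V G p A x y : drawing V G p A -> [set x; y]%SET \in G ->
  [/\ x \in V, y \in V, x <> y & arc (A [set x; y]%SET) (p x) (p y)].
Proof.
move=> [ip eG _ _] /eG[a [b [E aV bV Aab]]].
have ab : a <> b by move=> E'; apply: (arc_neq Aab); rewrite E'.
rewrite E in Aab.
case: (set2_eq E) => [[-> ->]|[-> ->]]; first by split.
rewrite finset.setUC.
by split => //; [move=> /esym | exact: arc_sym].
Qed.

Lemma drawing_edge_sub V G p A e : drawing V G p A -> e \in G -> (e \subset V)%SET.
Proof.
move=> [_ eG _ _] /eG[x [y [-> xV yV _]]].
by apply/fintype.subsetP => v; rewrite !inE => /orP[] /eqP ->.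
Qed.

Lemma drawing_sub V G V' G' p A : (V' \subset V)%SET -> (G' \subset G)%SET ->
  {in G', forall e : {set 'I_n}, (e \subset V')%SET} -> drawing V G p A -> drawing V' G' p A.
Proof.
move=> /fintype.subsetP VV /fintype.subsetP GG GV dr; have [ip eG vG iG] := dr; split.
- by move=> x y /VV xV /VV yV; exact: ip.
- move=> e eG'; have [x [y [E xV yV Axy]]] := eG e (GG _ eG').
  have /fintype.subsetP eV := GV _ eG'.
  by exists x, y; split => //; apply: eV; rewrite E !inE eqxx ?orbT.
- by move=> e v /GG eG' /VV; exact: vG.
- move=> e e' q eG' e'G' ee' Aq A'q; have [v vV qv] := iG e e' q (GG _ eG') (GG _ e'G') ee' Aq A'q.
  exists v => //; have /fintype.subsetP eV := GV _ eG'; apply: eV.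
  by apply: vG => //; [exact: GG | rewrite -qv].
Qed.

Lemma drawing_add_vertex V G p A z (q : R * R) : drawing V G p A -> z \notin V ->
  (forall v, v \in V -> q <> p v) -> (forall e, e \in G -> ~ A e q) ->
  drawing (z |: V)%SET G (fun v => if v == z then q else p v) A.
Proof.
move=> [ip eG vG iG] zV qV qG.
have nz v : v \in V -> (v == z) = false.
  by move=> vV; apply/negbTE; apply: contraNneq zV => <-.
split.
- move=> x y; rewrite !inE; case: eqP => [->|_] /=; case: eqP => [->|_]//=.
  + by move=> _ yV /qV; case.
  + by move=> xV _ /esym/qV; case.
  + exact: ip.
- move=> e /eG[x [y [E xV yV Axy]]]; exists x, y.
  by rewrite !inE xV yV !orbT !nz.
- move=> e v eG'; rewrite !inE; case: eqP => [-> _ /qG|_ /=]; [by case | exact: vG].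
- move=> e e' x eG' e'G' ee' Ax A'x; have [v vV xv] := iG e e' x eG' e'G' ee' Ax A'x.
  by exists v; rewrite ?inE ?vV ?orbT// nz.
Qed.

Lemma drawing_add_edge V G p A x y (S : set (R * R)) : drawing V G p A ->
  x \in V -> y \in V -> [set x; y]%SET \notin G -> arc S (p x) (p y) ->
  (forall v, v \in V -> S (p v) -> v \in [set x; y]%SET) ->
  (forall e q, e \in G -> S q -> A e q -> exists2 v, v \in V & q = p v) ->
  drawing V ([set x; y] |: G)%SET p (fun e => if e == [set x; y]%SET then S else A e).
Proof.
move=> [ip eG vG iG] xV yV nG Sxy SV SG; split => //.
- move=> e; rewrite in_setU1; case: eqP => [->|_ /= /eG//]; by exists x, y.
- move=> e v; rewrite in_setU1; case: eqP => [-> _|_ /=]; [exact: SV | exact: vG].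
- move=> e e' q; rewrite !in_setU1; case: eqP => [->|_] /=; case: eqP => [->|_]//=.
  + by move=> _ e'G _; exact: SG.
  + by move=> e'G _ _ Aq Sq; exact: SG Sq Aq.
  + exact: iG.
Qed.

(** An injective parametrisation reaches the end-vertices at 0 and 1 only, so the conditions of
    [drawing] on closed arcs and those of [planar] on open arcs translate into each other. *)
Lemma planar_drawable (G : graph n) : planar R G <-> drawable R [set: 'I_n]%SET G.
Proof.
have i0 : (0:R) \in `[(0:R), 1] by rewrite in_itv/= lexx ler01.
have i1 : (1:R) \in `[(0:R), 1] by rewrite in_itv/= lexx ler01.
split => [[p [gam [ip eG vG iG]]]|[p [A dr]]].
- have itv01 (t : R) : t \in `[0, 1] -> [\/ t = 0, t = 1 | t \in `]0, 1[].
    rewrite !in_itv/= => /andP[t0 t1].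
    have [->|tn0] := eqVneq t 0; first by constructor 1.
    have [->|tn1] := eqVneq t 1; first by constructor 2.
    by constructor 3; rewrite !lt_neqAle t0 t1 tn1 eq_sym tn0.
  exists p, (fun e => [set gam e t | t in `[0, 1]]); split.
  + by move=> x y _ _; exact: ip.
  + move=> e /eG[cg ig [x [y [E g0 g1]]]]; exists x, y; rewrite !inE; split => //.
    by rewrite -g0 -g1; exact: arc_within.
  + move=> e v eG' _ [t t01]; have [_ _ [x [y [E g0 g1]]]] := eG e eG'.
    case: (itv01 t t01) => [->|->|t01'].
    * by rewrite g0 => /ip <-; rewrite E !inE eqxx.
    * by rewrite g1 => /ip <-; rewrite E !inE eqxx orbT.
    * by move=> /(vG e v t eG' t01').
  + move=> e e' q eG' e'G' ee' [t t01 <-] [t' t01'].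
    have [_ _ [x [y [_ g0 g1]]]] := eG e eG'; have [_ _ [x' [y' [_ g0' g1']]]] := eG e' e'G'.
    case: (itv01 t t01) => [->|->|t02] E; [by exists x|by exists y|].
    case: (itv01 t' t01') => [t0|t1|t02']; [exists x' => //|exists y' => //|].
    * by rewrite -E t0 g0'.
    * by rewrite -E t1 g1'.
    * by case: (iG e e' t t' eG' e'G' ee' t02 t02').
- have [ip eG vG iG] := dr.
  have /choice[gam gamP] : forall e : {set 'I_n}, exists g : R -> R * R, e \in G ->
      exists x y, [/\ e = [set x; y]%SET, continuous g, {in `[0, 1] &, injective g},
      g 0 = p x & g 1 = p y] /\ A e = [set g t | t in `[0, 1]].
    move=> e; case: (boolP (e \in G)) => [eG'|_]; last by exists (fun=> 0).
    have [x [y [E _ _ [g [cg ig g0 g1 AE]]]]] := eG e eG'.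
    by exists g => _; exists x, y.
  have opn e v (t : R) : e \in G -> t \in `]0, 1[ -> gam e t <> p v.
    move=> eG' t01 E; have [x [y [[Exy cg ig g0 g1] AE]]] := gamP e eG'.
    have t01' : t \in `[0, 1] by move: t01; rewrite !in_itv/= => /andP[? ?]; rewrite !ltW.
    have : v \in e by apply: vG; rewrite ?inE// AE; exists t.
    have /andP[t0 t1] : 0 < t < 1 by move: t01; rewrite in_itv.
    rewrite Exy !inE => /orP[] /eqP vE; move: E; rewrite vE.
      by rewrite -g0 => /ig tE; move: t0; rewrite tE// ltxx.
    by rewrite -g1 => /ig tE; move: t1; rewrite tE// ltxx.
  exists p, gam; split => //.
  + by move=> x y; apply: ip; rewrite inE.
  + move=> e /gamP[x [y [[E cg ig g0 g1] AE]]]; split => //; last by exists x, y.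
    exact: continuous_subspaceT.
  + move=> e e' t t' eG' e'G' ee' t01 t01' E.
    have sub (s : R) : s \in `]0, 1[ -> s \in `[0, 1].
      by rewrite !in_itv/= => /andP[? ?]; rewrite !ltW.
    have [_ [_ [_ AE]]] := gamP e eG'; have [_ [_ [_ AE']]] := gamP e' e'G'.
    have [||v _] := iG e e' (gam e t) eG' e'G' ee'.
    * by rewrite AE; exists t => //; exact: sub.
    * by rewrite AE' E; exists t' => //; exact: sub.
    * exact: opn.
Qed.

Lemma fin_radius (T : finType) (P : T -> R -> Prop) :
  (forall t r r', r' <= r -> P t r -> P t r') ->
  (forall t, exists2 r, 0 < r & P t r) -> exists2 r, 0 < r & forall t, P t r.
Proof.
move=> mono /fin_all_exists2[f f0 fP]; exists (\big[Num.min/1]_t f t).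
  by elim/big_ind: _ => // x y; rewrite lt_min => ->.
by move=> t; apply: mono (fP t); exact: bigmin_le_cond.
Qed.

End Drawings.

(** * Straightening a drawing around a vertex *)

Section Star.
Variables (R : realType) (n : nat).
Implicit Types (V : {set 'I_n}) (G : graph n) (p : 'I_n -> R * R)
  (A : {set 'I_n} -> set (R * R)) (e : {set 'I_n}).

(* Inside the sup-norm ball of radius [r] around [p w], the drawing consists of the
   straight spokes from [p w] to [p w + d x], one for each neighbour [x] of [w]. *)
Definition starred V G p A (w : 'I_n) (r : R) (d : 'I_n -> R * R) : Prop :=
  [/\ drawing V G p A, 0 < r,
      forall v, v \in V -> v <> w -> r < `|p v - p w|,
      forall e q, e \in G -> w \notin e -> A e q -> r < `|q - p w| &
      forall x, [set w; x]%SET \in G -> `|d x| = r /\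
        exists B, [/\ A [set w; x]%SET = segment (p w) (p w + d x) `|` B,
          arc B (p w + d x) (p x) &
          forall q, B q -> `|q - p w| <= r -> q = p w + d x]].

Lemma segment_spokeE (a d q : R * R) : segment a (a + d) q ->
  exists2 s, 0 <= s <= 1 & q = a + s *: d.
Proof.
by move=> [s s01 <-]; exists s; [move: s01; rewrite /= in_itv | rewrite addrAC subrr add0r].
Qed.

(** Take [r] below the distances from [p w] to the other vertices and to the arcs avoiding [w]. Each
    arc at [w] keeps its tail after the last exit from the ball of radius [r], and a segment joins
    [p w] to the start of that tail. *)
Lemma drawable_starred V G w : w \in V -> drawable R V G ->
  exists p A r d, starred V G p A w r d.
Proof.
move=> wV [p [A dr]]; have [ip eG vG iG] := dr.
have [r1 r10 r1P] : exists2 r : R, 0 < r & forall v, v \in V -> v <> w -> r < `|p v - p w|.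
  apply: fin_radius => [v r r' r'r H vV vw|v]; first exact: le_lt_trans r'r (H vV vw).
  have [->|vw] := eqVneq v w; first by exists 1.
  case: (boolP (v \in V)) => [vV|_]; last by exists 1.
  have pos : 0 < `|p v - p w|.
    by rewrite normr_gt0 subr_eq0; apply: contraNneq vw => /ip ->.
  by exists (`|p v - p w| / 2) => [|_ _]; lra.
have [r2 r20 r2P] : exists2 r : R, 0 < r & forall e, forall q, e \in G -> w \notin e -> A e q -> r < `|q - p w|.
  apply: (@fin_radius _ _ (fun e r => forall q, e \in G -> w \notin e -> A e q -> r < `|q - p w|)).
    by move=> e r r' r'r H q eG' we Aq; exact: le_lt_trans r'r (H q eG' we Aq).
  move=> e; case: (boolP (e \in G)) => [eG'|_]; last by exists 1.
  case: (boolP (w \in e)) => [_|we]; first by exists 1.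
  have [x [y [_ _ _ Axy]]] := eG e eG'.
  have nA : (~` A e) (p w) by move=> /(vG e w eG' wV); exact/negP.
  have : nbhs (p w) (~` A e).
    by apply: open_nbhs_nbhs; split => //; exact: closed_openC (arc_closed Axy).
  move=> /nbhs_ballP[d /= d0 dP]; exists (d / 2); first by rewrite divr_gt0.
  move=> q _ _ Aq; rewrite ltNge; apply/negP => qd.
  apply: (dP q) => //; rewrite -ball_normE /ball_/= distrC; lra.
pose r := Num.min r1 r2.
have r0 : 0 < r by rewrite lt_min r10.
have rV v : v \in V -> v <> w -> r < `|p v - p w|.
  by move=> vV vw; apply: le_lt_trans (r1P v vV vw); rewrite ge_min lexx.
have rG e q : e \in G -> w \notin e -> A e q -> r < `|q - p w|.
  by move=> eG' we Aq; apply: le_lt_trans (r2P e q eG' we Aq); rewrite ge_min lexx orbT.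
have /choice[qB qBP] : forall x, exists qB : (R * R) * set (R * R), [set w; x]%SET \in G ->
    [/\ `|qB.1 - p w| = r, arc qB.2 qB.1 (p x), qB.2 `<=` A [set w; x]%SET &
      forall q, qB.2 q -> `|q - p w| <= r -> q = qB.1].
  move=> x; case: (boolP ([set w; x]%SET \in G)) => [xG|_]; last by exists (0, set0).
  have [_ xV wx Awx] := drawing_arc dr xG.
  have [|q [B [? ? ? ?]]] := arc_last_exit (ltW r0) Awx (r := r).
    by apply: rV => // /esym.
  by exists (q, B).
pose d x := (qB x).1 - p w.
pose A' e := if [pick x | e == [set w; x]%SET] is Some x
  then segment (p w) (p w + d x) `|` (qB x).2 else A e.
have A'w x : A' [set w; x]%SET = segment (p w) (p w + d x) `|` (qB x).2.
  rewrite /A'; case: pickP => [y /eqP/set2_inj <- //|/(_ x)].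
  by rewrite eqxx.
have A'nw e : w \notin e -> A' e = A e.
  move=> we; rewrite /A'; case: pickP => // x /eqP E.
  by move: we; rewrite E !inE eqxx.
have ends e : e \in G -> w \in e -> exists x, e = [set w; x]%SET.
  move=> /eG[x [y [-> _ _ _]]]; rewrite !inE => /orP[] /eqP ->; first by exists y.
  by exists x; rewrite finset.setUC.
have dE x : p w + d x = (qB x).1 by rewrite /d addrC subrK.
have spoke x q : [set w; x]%SET \in G -> segment (p w) (p w + d x) q ->
    exists2 s, 0 <= s <= 1 & q = p w + s *: d x /\ `|q - p w| = s * r.
  move=> xG /segment_spokeE[s s01 ->]; exists s => //; split => //.
  rewrite addrAC subrr add0r normrZ ger0_norm; last by case/andP: s01.
  by have [-> _ _ _] := qBP x xG.
have spoke_le x q : [set w; x]%SET \in G -> segment (p w) (p w + d x) q -> `|q - p w| <= r.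
  move=> xG /(spoke x q xG)[s s01 [_ ->]]; nra.
have tip x : [set w; x]%SET \in G -> A [set w; x]%SET (p w + d x).
  by move=> xG; have [_ Bx BA _] := qBP x xG; rewrite dE; apply: BA; exact: (arc_ends Bx).1.
exists p, A', r, d; split => //; last first.
- move=> x xG; have [q1 B1 BA Br] := qBP x xG; split => //.
  by exists (qB x).2; rewrite A'w dE.
- by move=> e q eG' we; rewrite A'nw//; exact: rG.
split => //.
- move=> e eG'; case: (boolP (w \in e)) => [/(ends e eG')[x Ex]|we]; last by rewrite A'nw//; exact: eG.
  rewrite Ex in eG' *; have [_ xV wx Awx] := drawing_arc dr eG'; exists w, x; split => //.
  have [qr Bx BA Br] := qBP x eG'; rewrite A'w; apply: (@arc_concat _ _ _ _ (p w + d x)).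
  + apply: arc_segment => /eqP; rewrite -subr_eq0 opprD addrA subrr add0r oppr_eq0.
    by rewrite -normr_eq0 qr gt_eqF.
  + by rewrite dE.
  + by move=> q /(spoke_le x q eG') qr' Bq; rewrite dE; exact: Br.
- move=> e v eG' vV; case: (boolP (w \in e)) => [we|we]; last by rewrite A'nw//; exact: vG.
  have [<- //|/eqP vw] := eqVneq w v; have [x Ex] := ends e eG' we; rewrite Ex in eG' *.
  rewrite A'w => -[/(spoke_le x _ eG')|Bv]; first by rewrite leNgt rV//; exact/nesym.
  by have [_ _ BA _] := qBP x eG'; apply: vG => //; exact: BA.
- have mixed e e' q : e \in G -> e' \in G -> e <> e' -> w \in e -> w \notin e' ->
      A' e q -> A' e' q -> exists2 v, v \in V & q = p v.
    move=> eG' e'G' ee' we we'; rewrite [A' e']A'nw//; have [x Ex] := ends e eG' we.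
    rewrite Ex in eG' ee' *; rewrite A'w => -[/(spoke_le x q eG') qr A'q|Bq A'q].
      by have := rG _ _ e'G' we' A'q; rewrite ltNge qr.
    by have [_ _ BA _] := qBP x eG'; exact: iG ee' (BA _ Bq) A'q.
  move=> e e' q eG' e'G' ee'; case: (boolP (w \in e)) => we; case: (boolP (w \in e')) => we'.
  + have [x Ex] := ends e eG' we; have [x' Ex'] := ends e' e'G' we'.
    rewrite Ex Ex' in eG' e'G' ee' *; rewrite !A'w.
    have [_ _ BA Br] := qBP x eG'; have [_ _ BA' Br'] := qBP x' e'G'.
    have segB y y' : [set w; y]%SET \in G -> [set w; y']%SET \in G -> [set w; y]%SET <> [set w; y']%SET ->
        segment (p w) (p w + d y) q -> (qB y').2 q -> exists2 v, v \in V & q = p v.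
      move=> yG y'G yy' /[dup] /(spoke_le y q yG) qr /(spoke y q yG)[s s01 [qE qs]] By'.
      have [qr' _ BAy' Bry'] := qBP y' y'G.
      have qE' := Bry' _ By' qr; rewrite -qE' in qr'.
      have s1 : s = 1 by apply: (mulIf (lt0r_neq0 r0)); rewrite mul1r -qs qr'.
      apply: (iG _ _ _ yG y'G yy'); last exact: BAy'.
      by rewrite qE s1 scale1r; exact: tip.
    case=> [sq|Bq] [s'q|B'q].
    (* Both parameters equal the distance from [p w] divided by [r]. Away from [p w] the spokes
       therefore share their tip, which lies on two arcs of the original drawing and would be a
       vertex at distance [r]. *)
    * have [s s01 [qE qs]] := spoke x q eG' sq; have [s' s01' [qE' qs']] := spoke x' q e'G' s'q.
      have ss : s = s' by apply: (mulIf (lt0r_neq0 r0)); rewrite -qs -qs'.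
      have [s0|s0] := eqVneq s 0; first by exists w => //; rewrite qE s0 scale0r addr0.
      have dd : d x = d x'.
        by apply: (scalerI s0); apply: (addrI (p w)); rewrite -qE ss -qE'.
      have [v vV vE] : exists2 v, v \in V & p w + d x = p v.
        by apply: (iG _ _ _ eG' e'G' ee'); [exact: tip | rewrite dd; exact: tip].
      have [qr _ _ _] := qBP x eG'.
      have vr : `|p v - p w| = r by rewrite -vE dE.
      have [vw|/eqP vw] := eqVneq v w; last by have := rV v vV vw; rewrite vr ltxx.
      by move: r0; rewrite -vr vw subrr normr0 ltxx.
    * exact: segB ee' sq B'q.
    * by apply: segB s'q Bq => //; exact/nesym.
    * by apply: iG ee' _ _ => //; [exact: BA | exact: BA'].
  + exact: mixed.
  + by move=> Aq A'q; apply: (mixed e' e) => //; exact/nesym.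
  + by rewrite !A'nw//; exact: iG.
Qed.

End Star.

(** * Empty sectors at a vertex and the edges drawn in them *)

Section Fan.
Variables (R : realType) (n : nat).
Implicit Types (V : {set 'I_n}) (G : graph n) (p : 'I_n -> R * R)
  (A : {set 'I_n} -> set (R * R)) (e : {set 'I_n}) (k theta eta : R).

(* Polar-like coordinates at [a]: distance [k] along the direction obtained by
   tilting [d] with slope [theta]. *)
Definition fan (a d : R * R) k theta : R * R :=
  (a.1 + k * (d.1 - theta * d.2), a.2 + k * (d.2 + theta * d.1)).

Lemma fan0 (a d : R * R) k : fan a d k 0 = a + k *: d.
Proof. by rewrite /fan !mul0r subr0 addr0. Qed.

Lemma fan00 (a d : R * R) theta : fan a d 0 theta = a.
Proof. by rewrite /fan !mul0r !addr0; case: a. Qed.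

Lemma sqr_norm_gt0 (d : R * R) : d != 0 -> 0 < d.1 ^+ 2 + d.2 ^+ 2.
Proof.
case: d => x y /= d0; rewrite lt0r addr_ge0 ?sqr_ge0// andbT; apply: contraNneq d0 => H.
have : x ^+ 2 = 0 /\ y ^+ 2 = 0 by have := sqr_ge0 x; have := sqr_ge0 y; lra.
by move=> [/eqP + /eqP]; rewrite !sqrf_eq0 => /eqP -> /eqP ->.
Qed.

(** At [k = 0] every slope gives the point [a], so only the product of [k] and the slope can be
    recovered. Projecting on [d] yields [k]; projecting on [d] turned by a right angle yields the
    product. *)
Lemma fan_inj (a d : R * R) k theta k' theta' : d != 0 ->
  fan a d k theta = fan a d k' theta' -> k = k' /\ k * theta = k' * theta'.
Proof.
move=> /sqr_norm_gt0 d0 []; move: d0; case: d => x y /= d0 /addrI E1 /addrI E2.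
have N0 : x ^+ 2 + y ^+ 2 != 0 by rewrite gt_eqF.
split; apply: (mulIf N0).
  have -> : k * (x ^+ 2 + y ^+ 2) = k * (x - theta * y) * x + k * (y + theta * x) * y by ring.
  by rewrite E1 E2; ring.
have -> : k * theta * (x ^+ 2 + y ^+ 2) = k * (y + theta * x) * x - k * (x - theta * y) * y by ring.
by rewrite E1 E2; ring.
Qed.

(** Tilting with slope at most one at most doubles the sup norm of [d]; the bound 1/2 on [k] makes
    up for it. *)
Lemma fan_norm (a d : R * R) k theta : 0 <= k <= 1 / 2 -> 0 <= theta <= 1 ->
  `|fan a d k theta - a| <= `|d|.
Proof.
move=> k01 t01; rewrite !prod_normE /=.
rewrite [a.1 + _]addrC [a.2 + _]addrC !addrK !normrM !(ger0_norm (_ : 0 <= k)); try lra.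
set M := Num.max `|d.1| `|d.2|.
have M1 : `|d.1| <= M by rewrite le_max lexx.
have M2 : `|d.2| <= M by rewrite le_max lexx orbT.
have bnd (u v : R) : `|u| <= M -> `|v| <= M -> k * `|u + theta * v| <= M.
  move=> uM vM; have : `|u + theta * v| <= M + M.
    apply: le_trans (ler_normD _ _) _; apply: lerD => //.
    by rewrite normrM ger0_norm; [have := normr_ge0 v; nra | lra].
  by have := normr_ge0 (u + theta * v); nra.
rewrite ge_max bnd// andbT -mulrN; apply: bnd => //.
by rewrite normrN.
Qed.

Lemma segment_fan_ray (a d q : R * R) k theta : 0 <= k ->
  segment a (fan a d k theta) q -> exists2 k', 0 <= k' <= k & q = fan a d k' theta.
Proof.
move=> k0 [s /=]; rewrite in_itv/= => s01 <-; exists (s * k); first by nra.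
by rewrite /fan; case: a => a1 a2 /=; congr pair; rewrite /= /GRing.scale/=; ring.
Qed.

Lemma segment_fan_cross (a d q : R * R) k theta theta' : theta <= theta' ->
  segment (fan a d k theta) (fan a d k theta') q ->
  exists2 theta0, theta <= theta0 <= theta' & q = fan a d k theta0.
Proof.
move=> tt [s /=]; rewrite in_itv/= => s01 <-; exists (theta + s * (theta' - theta)); first by nra.
by rewrite /fan; case: a => a1 a2 /=; congr pair; rewrite /= /GRing.scale/=; ring.
Qed.

Lemma small_avoid (s : seq R) : exists2 eta, 0 < eta <= 1 &
  forall y theta, y \in s -> 0 < theta <= eta -> y <> theta.
Proof.
elim: s => [|y s [eta eta01 IH]]; first by exists 1; rewrite ?ltr01 ?lexx.
have [y0|y0] := leP y 0.
  by exists eta => // z theta; rewrite inE => /orP[/eqP ->|zs t0]; [lra | exact: IH].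
exists (Num.min eta (y / 2)).
  by rewrite lt_min ge_min; apply/andP; split; [lra | case/andP: eta01 => _ ->].
move=> z theta; rewrite inE le_min => /orP[/eqP ->|zs t0]; first by lra.
by apply: IH => //; case/and3P: t0 => -> ->.
Qed.

(** [slope] is the tangent of the angle from [d] to [d']; a line through [a] meets the fan only at
    its own slope, and finitely many slopes leave a gap above zero. For [d'] orthogonal to [d] the
    quotient is a division by zero, but such a line contains no fan point with [k > 0]. *)
Lemma fan_avoid (s : seq (R * R)) (d : R * R) : d != 0 -> exists2 eta, 0 < eta <= 1 &
  forall a d' k k' theta, d' \in s -> 0 < k -> 0 < theta <= eta ->
    fan a d k theta <> a + k' *: d'.
Proof.
move=> /sqr_norm_gt0 d0.
pose slope (d' : R * R) := (d'.2 * d.1 - d'.1 * d.2) / (d'.1 * d.1 + d'.2 * d.2).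
have [eta eta01 etaP] := small_avoid (map slope s); exists eta => //.
move=> [a1 a2] [x y] k k' theta ds k0 t0 [/= /addrI E1 /addrI E2].
apply: (etaP (slope (x, y)) theta) => //; first exact: map_f.
have N : k' * (x * d.1 + y * d.2) = k * (d.1 ^+ 2 + d.2 ^+ 2).
  transitivity ((k' * x) * d.1 + (k' * y) * d.2); first ring.
  by rewrite -[k' * x]E1 -[k' * y]E2; ring.
have N2 : k' * (y * d.1 - x * d.2) = k * theta * (d.1 ^+ 2 + d.2 ^+ 2).
  transitivity ((k' * y) * d.1 - (k' * x) * d.2); first ring.
  by rewrite -[k' * x]E1 -[k' * y]E2; ring.
have pos : 0 < k * (d.1 ^+ 2 + d.2 ^+ 2) by rewrite mulr_gt0.
have k'0 : k' != 0 by apply: contraTneq pos => k'0; rewrite -N k'0 mul0r ltxx.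
have D0 : x * d.1 + y * d.2 != 0 by apply: contraTneq pos => D0; rewrite -N D0 mulr0 ltxx.
rewrite /slope /=; apply: (mulIf D0); rewrite divfK//; apply: (mulfI k'0).
by rewrite N2 mulrCA N; ring.
Qed.

(** Inside the ball only spokes are left, and a tail touches the ball at the tip of its spoke, so
    [fan_avoid] applies to the finitely many directions. Slope zero is excluded, which allows [d0]
    to be the direction of a spoke. *)
Lemma starred_fan V G p A w r d (d0 : R * R) : starred V G p A w r d -> `|d0| = r ->
  exists2 eta, 0 < eta <= 1 & forall k theta, 0 < k <= 1 / 2 -> 0 < theta <= eta ->
    (forall v, v \in V -> fan (p w) d0 k theta <> p v) /\
    (forall e, e \in G -> ~ A e (fan (p w) d0 k theta)).
Proof.
move=> [dr r0 rV rG st] d0r.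
have d00 : d0 != 0 by rewrite -normr_eq0 d0r gt_eqF.
have [eta eta01 etaP] := fan_avoid [seq d x | x <- enum 'I_n] d00.
exists eta => // k theta k0 t0.
have fr : `|fan (p w) d0 k theta - p w| <= r by rewrite -d0r; apply: fan_norm; lra.
split => [v vV E|e eG' Ae].
  have [vw|/eqP vw] := eqVneq v w; last by have := rV v vV vw; rewrite -E ltNge fr.
  move: E; rewrite vw -{2}(fan00 (p w) d0 0) => /(fan_inj d00)[kE _].
  by move: k0; rewrite kE ltxx.
case: (boolP (w \in e)) => [we|we]; last by have := rG _ _ eG' we Ae; rewrite ltNge fr.
have [x Ex] : exists x, e = [set w; x]%SET.
  have [_ eG _ _] := dr; have [x [y [E _ _ _]]] := eG e eG'; move: we; rewrite E !inE.
  by move=> /orP[] /eqP ->; [exists y | exists x; rewrite finset.setUC].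
rewrite Ex in eG' Ae; have [dx [B [AE _ Br]]] := st x eG'.
have [k' E] : exists k', fan (p w) d0 k theta = p w + k' *: d x.
  move: Ae; rewrite AE => -[/segment_spokeE[s _ ->]|/Br/(_ fr) ->]; first by exists s.
  by exists 1; rewrite scale1r.
apply: (etaP (p w) (d x) k k' theta _ _ _ E) => //; last by case/andP: k0.
by apply: map_f; rewrite mem_enum.
Qed.

Lemma drawable_pendant V G w z : w \in V -> z \notin V -> drawable R V G ->
  drawable R (z |: V)%SET ([set w; z]%SET |: G).
Proof.
move=> wV zV /(drawable_starred wV)[p [A [r [d st]]]]; have [dr r0 _ _ _] := st.
(* Any vector of norm [r] serves, since the sector beside it is free whether or not it is a
   spoke. *)
have d0r : `|(r, 0 : R)| = r by rewrite prod_normE/= normr0 ger0_norm ?ltW// max_l ?ltW.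
have d00 : (r, 0 : R) != 0 by rewrite -normr_eq0 d0r gt_eqF.
have [eta /andP[eta0 eta1] fanP] := starred_fan st d0r.
have half : ((0 : R) < 1 / 2) && ((1 / 2 : R) <= 1 / 2) by rewrite lexx andbT divr_gt0.
have half0 : (0 : R) <= 1 / 2 by rewrite divr_ge0.
have etaI : 0 < eta <= eta by rewrite eta0 lexx.
set a := fan (p w) (r, 0) (1 / 2) eta.
have [aV aG] := fanP _ _ half etaI.
have dr1 := drawing_add_vertex dr zV aV aG.
have wz : (w == z) = false by apply/negbTE; apply: contraNneq zV => <-.
have ray q : segment (p w) a q -> q = p w \/ exists2 k, 0 < k <= 1 / 2 & q = fan (p w) (r, 0) k eta.
  move=> /(segment_fan_ray half0)[k k01 ->].
  have [->|k0] := eqVneq k 0; first by left; rewrite fan00.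
  by right; exists k => //; rewrite lt0r k0.
do 2!eexists; apply: (drawing_add_edge (S := segment (p w) a) dr1).
- by rewrite !inE wV orbT.
- by rewrite !inE eqxx.
- apply: contra zV => /(drawing_edge_sub dr) /fintype.subsetP; apply.
  by rewrite !inE eqxx orbT.
- rewrite wz eqxx; apply: arc_segment; rewrite -{1}(fan00 (p w) (r, 0) 0) => /(fan_inj d00)[E _].
  by move: half; rewrite -E ltxx.
- move=> v; rewrite !inE; case: eqP => [_|vz /= vV]; first by rewrite orbT.
  case/ray => [E|[k k0 E]]; last by have [/(_ v vV)] := fanP k eta k0 etaI; rewrite E.
  by have [ip _ _ _] := dr; rewrite (ip v w vV wV E) eqxx.
- move=> e q eG' /ray[-> _|[k k0 ->]]; first by exists w; rewrite ?inE ?wV ?orbT// wz.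
  by have [_ /(_ e eG')] := fanP k eta k0 etaI.
Qed.

(** The chord [ab] has constant [k = 1/2], so the triangle stays in the sector. The range of slopes
    is closed so that [t1 = 0] can run along an erased spoke; positions and arcs are returned
    because [drawable_edge_triangle] draws one more edge from [a]. *)
Lemma drawing_fan_triangle V G p A w a b (d : R * R) t1 t2 :
    drawing V G p A -> w \in V -> a \notin V -> b \notin V -> a != b -> d != 0 -> t1 < t2 ->
    (forall k theta, 0 < k <= 1 / 2 -> t1 <= theta <= t2 ->
      (forall v, v \in V -> fan (p w) d k theta <> p v) /\
      (forall e, e \in G -> ~ A e (fan (p w) d k theta))) ->
  exists p' A', [/\ drawing (b |: (a |: V))%SET
      ([set a; b] |: ([set w; b] |: ([set w; a] |: G)))%SET p' A',
    p' a = fan (p w) d (1 / 2) t1, p' b = fan (p w) d (1 / 2) t2,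
    {in V, p' =1 p} /\ {in G, A' =1 A} &
    [/\ A' [set w; a]%SET = segment (p w) (fan (p w) d (1 / 2) t1),
       A' [set w; b]%SET = segment (p w) (fan (p w) d (1 / 2) t2) &
       A' [set a; b]%SET = segment (fan (p w) d (1 / 2) t1) (fan (p w) d (1 / 2) t2)]].
Proof.
move=> dr wV aV bV ab d0 t12 fanP.
have half : ((0 : R) < 1 / 2) && ((1 / 2 : R) <= 1 / 2) by rewrite lexx andbT divr_gt0.
have half0 : (0 : R) <= 1 / 2 by rewrite divr_ge0.
have I1 : t1 <= t1 <= t2 by lra.
have I2 : t1 <= t2 <= t2 by lra.
set qa := fan (p w) d (1 / 2) t1; set qb := fan (p w) d (1 / 2) t2.
have [qaV qaG] := fanP _ _ half I1; have [qbV qbG] := fanP _ _ half I2.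
have wa : (w == a) = false by apply/negbTE; apply: contraNneq aV => <-.
have wb : (w == b) = false by apply/negbTE; apply: contraNneq bV => <-.
have ba : (b == a) = false by rewrite eq_sym; exact: negbTE.
have qab : qa <> qb by move=> /(fan_inj d0)[_]; lra.
have qwa : p w <> qa by rewrite -{1}(fan00 (p w) d 0) => /(fan_inj d0)[E _]; move: half; rewrite -E ltxx.
have qwb : p w <> qb by rewrite -{1}(fan00 (p w) d 0) => /(fan_inj d0)[E _]; move: half; rewrite -E ltxx.
have ray t q : segment (p w) (fan (p w) d (1 / 2) t) q ->
    q = p w \/ exists2 k, 0 < k <= 1 / 2 & q = fan (p w) d k t.
  move=> /(segment_fan_ray half0)[k k01 ->].
  have [->|k0] := eqVneq k 0; first by left; rewrite fan00.
  by right; exists k => //; rewrite lt0r k0.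
have dr1 := drawing_add_vertex dr aV qaV qaG.
have bV1 : b \notin (a |: V)%SET by rewrite !inE ba (negbTE bV).
have dr2 : drawing _ G _ A := drawing_add_vertex (q := qb) dr1 bV1 _ qbG.
have {}dr2 := dr2 _.
pose p2 v := if v == b then qb else if v == a then qa else p v.
have {}dr2 : drawing (b |: (a |: V))%SET G p2 A.
  apply: dr2 => v; rewrite !inE; case: eqP => [_ _ /esym //|_ /= vV]; exact: qbV.
have p2w : p2 w = p w by rewrite /p2 wb wa.
have p2b : p2 b = qb by rewrite /p2 eqxx.
have p2a : p2 a = qa by rewrite /p2 eqxx (negbTE ab).
have p2V v : v \in V -> p2 v = p v.
  move=> vV; rewrite /p2; case: eqP => [vb|_]; first by move: bV; rewrite -vb vV.
  by case: eqP => // va; move: aV; rewrite -va vV.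
have wV2 : w \in (b |: (a |: V))%SET by rewrite !inE wV !orbT.
have aV2 : a \in (b |: (a |: V))%SET by rewrite !inE eqxx orbT.
have bV2 : b \in (b |: (a |: V))%SET by rewrite !inE eqxx.
have inV2 v : v \in (b |: (a |: V))%SET -> [\/ v = b, v = a | v \in V].
  by rewrite !inE => /or3P[/eqP|/eqP|]; [constructor 1|constructor 2|constructor 3].
have nG e x : x \in e -> x \notin V -> e \notin G.
  by move=> xe; apply: contra => /(drawing_edge_sub dr) /fintype.subsetP; exact.
have ip v : v \in V -> p v = p w -> v = w by have [ip _ _ _] := dr => vV; exact: ip.
have inset2 (x y : 'I_n) : x \in [set x; y]%SET /\ y \in [set x; y]%SET.
  by rewrite !inE !eqxx orbT.
have dr3 := drawing_add_edge (S := segment (p w) qa) dr2 wV2 aV2 (nG _ a (inset2 _ _).2 aV).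
have {}dr3 : drawing (b |: (a |: V))%SET ([set w; a]%SET |: G) p2
    (fun e => if e == [set w; a]%SET then segment (p w) qa else A e).
  apply: dr3.
  - by rewrite p2w p2a; exact: arc_segment.
  - move=> v /inV2[->|->|vV]; rewrite ?p2b ?p2a ?(p2V _ vV).
    + case/ray => [E|[k k0 /(fan_inj d0)[<-]]]; first by case: qwb.
      by lra.
    + by rewrite (inset2 w a).2.
    + case/ray => [/(ip v vV) ->|[k k0 E]]; first by rewrite (inset2 w a).1.
      by have [/(_ v vV)] := fanP k t1 k0 I1; rewrite E.
  - move=> e q eG' /ray[-> _|[k k0 ->]]; first by exists w.
    by have [_ /(_ e eG')] := fanP k t1 k0 I1.
have wab : [set w; a]%SET <> [set w; b]%SET by move=> /set2_inj E; rewrite E eqxx in ab.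
have nwb : [set w; b]%SET \notin ([set w; a]%SET |: G).
  rewrite in_setU1 negb_or (nG _ b (inset2 _ _).2 bV) andbT; apply/eqP; exact/nesym.
have dr4 : drawing (b |: (a |: V))%SET ([set w; b] |: ([set w; a] |: G))%SET p2
    (fun e => if e == [set w; b]%SET then segment (p w) qb
              else if e == [set w; a]%SET then segment (p w) qa else A e).
  apply: (drawing_add_edge dr3 wV2 bV2 nwb).
  - by rewrite p2w p2b; exact: arc_segment.
  - move=> v /inV2[->|->|vV]; rewrite ?p2b ?p2a ?(p2V _ vV).
    + by rewrite (inset2 w b).2.
    + case/ray => [E|[k k0 /(fan_inj d0)[<-]]]; first by case: qwa.
      by lra.
    + case/ray => [/(ip v vV) ->|[k k0 E]]; first by rewrite (inset2 w b).1.
      by have [/(_ v vV)] := fanP k t2 k0 I2; rewrite E.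
  - move=> e q; rewrite in_setU1 => /orP[/eqP ->|eG'] /ray[-> _|[k k0 ->]].
    + by exists w.
    + rewrite eqxx => /ray[E|[k' k'0 /(fan_inj d0)[<-]]]; first by exists w; rewrite ?p2w.
      by move=> E; nra.
    + by exists w.
    + case: eqP => [Ewa|_]; last by have [_ /(_ e eG')] := fanP k t2 k0 I2.
      by move: eG'; rewrite Ewa (negbTE (nG _ a (inset2 _ _).2 aV)).
have nab : [set a; b]%SET \notin ([set w; b] |: ([set w; a] |: G))%SET.
  rewrite !in_setU1 !negb_or (nG _ b (inset2 _ _).2 bV) andbT; apply/andP; split; apply/eqP.
    rewrite finset.setUC [RHS]finset.setUC => /set2_inj E; by rewrite E eqxx in wa.
  by rewrite [RHS]finset.setUC => /set2_inj E; rewrite E eqxx in wb.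
have dr5 : drawing (b |: (a |: V))%SET ([set a; b] |: ([set w; b] |: ([set w; a] |: G)))%SET p2
    (fun e => if e == [set a; b]%SET then segment qa qb
              else if e == [set w; b]%SET then segment (p w) qb
              else if e == [set w; a]%SET then segment (p w) qa else A e).
  apply: (drawing_add_edge dr4 aV2 bV2 nab).
  - by rewrite p2a p2b; exact: arc_segment.
  - move=> v /inV2[->|->|vV]; rewrite ?(inset2 a b).1 ?(inset2 a b).2//.
    rewrite (p2V _ vV) => /(segment_fan_cross (ltW t12))[t tI E].
    by have [/(_ v vV)] := fanP _ t half tI; rewrite E.
  - move=> e q; rewrite !in_setU1 => /or3P[/eqP ->|/eqP ->|eG'] /(segment_fan_cross (ltW t12))[t tI ->].
    + rewrite eqxx => /ray[/esym|[k k0 E]].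
        by rewrite -{1}(fan00 (p w) d 0) => /(fan_inj d0)[E _]; move: half; rewrite -E ltxx.
      have [<- _] := fan_inj d0 E; exists b => //; rewrite p2b.
      have [_ tE] := fan_inj d0 E; have -> // : t = t2.
      by apply: (mulfI (_ : (1 / 2 : R) != 0)); [rewrite gt_eqF//; case/andP: half | rewrite tE -(fan_inj d0 E).1].
    + case: eqP => [//|_]; rewrite eqxx => /ray[/esym|[k k0 E]].
        by rewrite -{1}(fan00 (p w) d 0) => /(fan_inj d0)[E _]; move: half; rewrite -E ltxx.
      exists a => //; rewrite p2a.
      have [kE tE] := fan_inj d0 E; have -> // : t = t1.
      by apply: (mulfI (_ : (1 / 2 : R) != 0)); [rewrite gt_eqF//; case/andP: half | rewrite tE -kE].
    + have [_ /(_ e eG')] := fanP _ t half tI.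
      case: eqP => [Ewb|_]; first by move: eG'; rewrite Ewb (negbTE (nG _ b (inset2 _ _).2 bV)).
      by case: eqP => [Ewa|//]; move: eG'; rewrite Ewa (negbTE (nG _ a (inset2 _ _).2 aV)).
exists p2; eexists; split; [exact: dr5 | by [] | by [] | split | split] => //=.
- move=> e eG'; case: eqP => [Eab|_]; first by move: eG'; rewrite Eab (negbTE (nG _ b (inset2 _ _).2 bV)).
  case: eqP => [Ewb|_]; first by move: eG'; rewrite Ewb (negbTE (nG _ b (inset2 _ _).2 bV)).
  by case: eqP => [Ewa|//]; move: eG'; rewrite Ewa (negbTE (nG _ a (inset2 _ _).2 aV)).
- case: eqP => [E|_]; first by move: nab; rewrite -E !in_setU1 eqxx orbT.
  by case: eqP => [//|_]; rewrite eqxx.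
- case: eqP => [E|_]; first by move: nab; rewrite -E !in_setU1 eqxx.
  by rewrite eqxx.
- by rewrite eqxx.
Qed.

Lemma drawable_pendant_triangle V G w a b : w \in V -> a \notin V -> b \notin V -> a != b ->
  drawable R V G ->
  drawable R (b |: (a |: V))%SET ([set a; b] |: ([set w; b] |: ([set w; a] |: G)))%SET.
Proof.
move=> wV aV bV ab /(drawable_starred wV)[p [A [r [d st]]]]; have [dr r0 _ _ _] := st.
have d0r : `|(r, 0 : R)| = r by rewrite prod_normE/= normr0 ger0_norm ?ltW// max_l ?ltW.
have d00 : (r, 0 : R) != 0 by rewrite -normr_eq0 d0r gt_eqF.
have [eta /andP[eta0 eta1] fanP] := starred_fan st d0r.
have [|k theta k0 t0|p' [A' [dr' _ _ _ _]]] :=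
    drawing_fan_triangle (t1 := eta / 2) (t2 := eta) dr wV aV bV ab d00; last by exists p', A'.
- lra.
- by apply: fanP => //; lra.
Qed.

End Fan.

(** * Moves on the edges of a drawing *)

Section LocalMoves.
Variables (R : realType) (n : nat).
Implicit Types (V : {set 'I_n}) (G : graph n) (p : 'I_n -> R * R)
  (A : {set 'I_n} -> set (R * R)) (e : {set 'I_n}) (k theta eta : R).

(* The edge [wx] is subdivided by [a] halfway along its spoke at [w], and [b] is
   put next to [a] in an empty sector at [w]. *)
Lemma drawable_edge_triangle V G w x a b : [set w; x]%SET \in G -> a \notin V -> b \notin V ->
  a != b -> drawable R V G ->
  drawable R (b |: (a |: V))%SET
    ([set a; x] |: ([set a; b] |: ([set w; b] |: ([set w; a] |: (G :\ [set w; x])))))%SET.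
Proof.
move=> xG aV bV ab dG; have [wV xV] : w \in V /\ x \in V.
  by have [p [A dr]] := dG; have [] := drawing_arc dr xG.
have [p [A [r [d st]]]] := drawable_starred wV dG; have [dr r0 rV _ spoke] := st.
have [_ _ wx _] := drawing_arc dr xG.
have [dxr [B [AE arcB Br]]] := spoke x xG.
have d00 : d x != 0 by rewrite -normr_eq0 dxr gt_eqF.
have [eta /andP[eta0 eta1] fanP] := starred_fan st dxr.
have [_ _ vG iG] := dr.
have half : ((0 : R) < 1 / 2) && ((1 / 2 : R) <= 1 / 2) by rewrite lexx andbT divr_gt0.
pose G1 := G :\ [set w; x]%SET.
have G1G e : e \in G1 -> e \in G by rewrite in_setD1 => /andP[].
have dr1 : drawing V G1 p A.
  apply: (drawing_sub _ _ _ dr) => //; first exact: subD1set.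
  by move=> e /G1G; exact: (drawing_edge_sub dr).
have onray k : 0 <= k <= 1 -> A [set w; x]%SET (fan (p w) (d x) k 0).
  move=> k01; rewrite AE; left; exists k; first by rewrite /= in_itv.
  by rewrite fan0 addrAC subrr add0r.
have norm0 k : 0 <= k -> `|fan (p w) (d x) k 0 - p w| = k * r.
  by move=> k0; rewrite fan0 addrAC subrr add0r normrZ dxr ger0_norm.
have rayV k v : 0 < k <= 1 / 2 -> v \in V -> fan (p w) (d x) k 0 <> p v.
  move=> k0 vV E; have [vw|/eqP vw] := eqVneq v w.
    have kr : 0 < k * r by nra.
    by have := norm0 k; rewrite E vw subrr normr0; lra.
  by have := rV v vV vw; rewrite -E norm0; nra.
have [|k theta k0 t0|p' [A' [dr' p'a p'b [p'V A'G] [A'wa A'wb A'ab]]]] :=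
    drawing_fan_triangle (t1 := 0) (t2 := eta) dr1 wV aV bV ab d00; first by [].
- have [->|th0] := eqVneq theta 0.
    split => [v vV|e eG1 Ae]; first exact: rayV.
    have [||v vV E] := iG e _ _ (G1G _ eG1) xG _ Ae (onray k _); last exact: rayV E.
      by move=> E; move: eG1; rewrite E in_setD1 eqxx.
    by lra.
  have t0' : 0 < theta <= eta by rewrite lt0r th0; lra.
  have [H1 H2] := fanP k theta k0 t0'; split => // e /G1G; exact: H2.
have qwa : fan (p w) (d x) (1 / 2) 0 = p w + (1 / 2) *: d x by exact: fan0.
have wa : (w == a) = false by apply/negbTE; apply: contraNneq aV => <-.
have wb : (w == b) = false by apply/negbTE; apply: contraNneq bV => <-.
have xa : (x == a) = false by apply/negbTE; apply: contraNneq aV => <-.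
have xb : (x == b) = false by apply/negbTE; apply: contraNneq bV => <-.
have tipE : p w + d x = fan (p w) (d x) 1 0 by rewrite fan0 scale1r.
set qa := fan (p w) (d x) (1 / 2) 0 in p'a A'wa A'ab.
pose S := segment qa (p w + d x) `|` B.
have outer q : segment qa (p w + d x) q -> exists2 k, 1 / 2 <= k <= 1 & q = fan (p w) (d x) k 0.
  rewrite tipE => -[s /=]; rewrite in_itv/= => s01 <-; exists (1 / 2 + s / 2); first by lra.
  by rewrite /qa !fan0 scale1r opprD addrACA subrr add0r -addrA -{2}[d x]scale1r -scalerBl scalerA -scalerDl;
    congr (_ + _ *: _); field.
have outB q : S q -> B q \/ exists2 k, 1 / 2 <= k <= 1 & q = fan (p w) (d x) k 0.
  by move=> [/outer|]; [right | left].
have SA q : S q -> A [set w; x]%SET q.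
  move=> /outB[Bq|[k k1 ->]]; first by rewrite AE; right.
  by apply: onray; lra.
(* The rest of the old edge follows slope zero with [k] at least 1/2 and then leaves the ball,
   whereas the triangle has [k] at most 1/2: they can touch at [qa] only. *)
have Sfan q k theta : 0 <= k <= 1 / 2 -> 0 <= theta <= eta -> q = fan (p w) (d x) k theta ->
    S q -> q = qa.
  move=> k0 t0 qE Sq; have [k' k'1 qE'] : exists2 k', 1 / 2 <= k' <= 1 & q = fan (p w) (d x) k' 0.
    case/outB: Sq => // Bq; exists 1; first by lra.
    rewrite -tipE; apply: Br => //; rewrite qE -dxr; apply: fan_norm => //; lra.
  have [kk kt] : k = k' /\ k * theta = k' * 0 by apply: (fan_inj (a := p w) d00); rewrite -qE.
  by rewrite qE' /qa; congr (fan _ _ _ _); lra.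
have arcS : arc S qa (p x).
  apply: arc_concat arcB _; last first.
    move=> q /outer[k k1 qE] Bq; apply: Br => //.
    rewrite qE norm0; nra.
  by apply: arc_segment; rewrite tipE => /(fan_inj d00)[]; lra.
have axG : [set a; x]%SET \notin ([set a; b] |: ([set w; b] |: ([set w; a] |: G1)))%SET.
  rewrite !in_setU1 !negb_or; apply/and4P; split; last 1 first.
  - apply: contra aV => /(drawing_edge_sub dr1)/fintype.subsetP; apply.
    by rewrite !inE eqxx.
  - by apply/eqP => /set2_inj E; rewrite E eqxx in xb.
  - by apply/eqP => /set2_eq[[E _]|[E _]]; [rewrite E eqxx in wa | rewrite E eqxx in ab].
  - by apply/eqP; rewrite finset.setUC => /set2_eq[[E _]|[_ E]]; [case: wx | rewrite E eqxx in wa].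
have V2 v : v \in V -> v \in (b |: (a |: V))%SET by move=> vV; rewrite !inE vV !orbT.
have aV2 : a \in (b |: (a |: V))%SET by rewrite !inE eqxx orbT.
have half0 : (0 : R) <= 1 / 2 by rewrite divr_ge0.
have p'x : p' x = p x by exact: p'V.
do 2!eexists; apply: (drawing_add_edge (S := S) dr' aV2 (V2 x xV) axG).
- by rewrite p'a p'x.
- move=> v; rewrite !inE => /or3P[/eqP ->|/eqP ->|vV]; last 1 first.
  + rewrite (p'V v vV) => Sv; have := vG _ v xG vV (SA _ Sv); rewrite !inE => /orP[/eqP vw|-> //]; last by rewrite orbT.
    have : p v = qa by apply: (Sfan _ 0 0) => //; rewrite ?lexx ?(ltW eta0)// vw fan00.
    by rewrite vw -{1}(fan00 (p w) (d x) 0) => /(fan_inj d00)[]; lra.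
  + rewrite p'b => Sb; have : fan (p w) (d x) (1 / 2) eta = qa.
      by apply: (Sfan _ (1 / 2) eta) => //; rewrite ?lexx ?(ltW eta0)// half0.
    by move=> /(fan_inj d00)[_]; lra.
  + by rewrite eqxx.
- move=> e q; rewrite !in_setU1 => /or4P[/eqP ->|/eqP ->|/eqP ->|eG1] Sq.
  + rewrite A'ab => /(segment_fan_cross (ltW eta0))[t tI qE]; exists a => //.
    by rewrite p'a; apply: (Sfan _ (1 / 2) t) => //; rewrite ?lexx// half0.
  + rewrite A'wb => /(segment_fan_ray half0)[k kI qE]; exists a => //.
    by rewrite p'a; apply: (Sfan _ k eta) => //; rewrite ?lexx// ltW.
  + rewrite A'wa => /(segment_fan_ray half0)[k kI qE]; exists a => //.
    by rewrite p'a; apply: (Sfan _ k 0) => //; rewrite ?lexx// ltW.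
  + rewrite (A'G e eG1) => Aq.
    have [|v vV qE] := iG e _ q (G1G e eG1) xG _ Aq (SA q Sq).
      by move=> E; move: eG1; rewrite E in_setD1 eqxx.
    by exists v; [exact: V2 | rewrite p'V].
Qed.

Lemma drawable_sub V G G' : (G' \subset G)%SET -> drawable R V G -> drawable R V G'.
Proof.
move=> G'G [p [A dr]]; exists p, A; apply: (drawing_sub _ _ _ dr) => //.
by move=> e /(fintype.subsetP G'G); exact: (drawing_edge_sub dr).
Qed.

Lemma drawable_remove_vertices V G (U : {set 'I_n}) :
  {in G, forall e, (e \subset ~: U)%SET} -> drawable R V G -> drawable R (V :\: U)%SET G.
Proof.
move=> GU [p [A dr]]; exists p, A; apply: (drawing_sub _ _ _ dr) => //; first exact: subsetDl.
move=> e eG'; rewrite finset.setDE; apply/fintype.subsetP => v ve.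
by rewrite inE (fintype.subsetP (drawing_edge_sub dr eG')) ?(fintype.subsetP (GU e eG')).
Qed.

Lemma drawable_add_isolated V G z : drawable R V G -> drawable R (z |: V)%SET G.
Proof.
move=> dG; case: (boolP (z \in V)) => [zV|zV].
  by rewrite (finset.setUidPr _)// finset.sub1set.
have [V0|[w wV]] := set_0Vmem V.
  have [p [A dr]] := dG; do 2!eexists; apply: (drawing_add_vertex (q := 0) dr zV).
    by move=> v; rewrite V0 inE.
  move=> e eG' _; have := drawing_edge_sub dr eG'; rewrite V0 finset.subset0 => /eqP e0.
  have [_ eG _ _] := dr; have [x [y [_ xV _ _]]] := eG e eG'.
  by move: xV; rewrite V0 inE.
by apply: drawable_sub (drawable_pendant wV zV dG); exact: finset.subsetUr.
Qed.

Lemma drawable_subdivide V G x y z : [set x; y]%SET \in G -> z \notin V -> drawable R V G ->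
  drawable R (z |: V)%SET ([set x; z] |: ([set z; y] |: (G :\ [set x; y])))%SET.
Proof.
move=> xyG zV [p [A dr]]; have [xV yV xy Axy] := drawing_arc dr xyG.
have [ip eG vG iG] := dr.
pose G1 := G :\ [set x; y]%SET.
have G1G e : e \in G1 -> e \in G by rewrite in_setD1 => /andP[].
have dr1 : drawing V G1 p A.
  apply: (drawing_sub _ _ _ dr) => //; first exact: subD1set.
  by move=> e /G1G; exact: (drawing_edge_sub dr).
have [q Aq [qx qy]] : exists2 q, A [set x; y]%SET q & q <> p x /\ q <> p y.
  have [g [_ ig <- <- ->]] := Axy; exists (g (1 / 2)).
    by exists (1 / 2) => //=; rewrite in_itv/=; lra.
  by split => /ig; rewrite !in_itv/=; lra.
have qV v : v \in V -> q <> p v.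
  move=> vV qv; have : v \in [set x; y]%SET by apply: vG; rewrite -?qv.
  by rewrite !inE => /orP[] /eqP vE; [apply: qx | apply: qy]; rewrite qv vE.
have AG1 e q' : e \in G1 -> A [set x; y]%SET q' -> A e q' -> exists2 v, v \in V & q' = p v.
  move=> eG1 Aq' Ae; apply: (iG e _ _ (G1G e eG1) xyG) => // E.
  by move: eG1; rewrite E in_setD1 eqxx.
have [A1 [A2 [arc1 arc2 A12 meet]]] := arc_split Axy Aq qx qy.
have sub1 : A1 `<=` A [set x; y]%SET by rewrite A12; exact: subsetUl.
have sub2 : A2 `<=` A [set x; y]%SET by rewrite A12; exact: subsetUr.
have dr2 := drawing_add_vertex dr1 zV qV (_ : forall e, e \in G1 -> ~ A e q).
have {}dr2 := dr2 _; set p2 := (fun v => if v == z then q else p v) in dr2.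
have {}dr2 : drawing (z |: V)%SET G1 p2 A.
  by apply: dr2 => e eG1 /(AG1 e q eG1 Aq)[v vV]; exact: qV.
have p2V v : v \in V -> p2 v = p v.
  by move=> vV; rewrite /p2; case: eqP => // vz; move: zV; rewrite -vz vV.
have p2z : p2 z = q by rewrite /p2 eqxx.
have zV2 : z \in (z |: V)%SET by rewrite !inE eqxx.
have V2 v : v \in V -> v \in (z |: V)%SET by move=> vV; rewrite !inE vV !orbT.
have nzG : [set z; y]%SET \notin G1.
  by apply: contra zV => /(drawing_edge_sub dr1)/fintype.subsetP; apply; rewrite !inE eqxx.
have onA (B : set (R * R)) v : B `<=` A [set x; y]%SET -> v \in V -> B (p v) -> v = x \/ v = y.
  move=> BA vV /BA /(vG _ v xyG vV); rewrite !inE => /orP[] /eqP ->; by [left | right].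
have dr3 : drawing (z |: V)%SET ([set z; y] |: G1)%SET p2 (fun e => if e == [set z; y]%SET then A2 else A e).
  apply: (drawing_add_edge dr2 zV2 (V2 y yV) nzG); first by rewrite p2z p2V.
    move=> v; rewrite !inE => /orP[/eqP -> //|vV]; first by rewrite eqxx.
    rewrite (p2V v vV) => A2v; case: (onA A2 v sub2 vV A2v) => vE; last by rewrite vE eqxx orbT.
    case: (qV x xV); apply/esym; apply: meet; last by rewrite -vE.
    exact: (arc_ends arc1).1.
  move=> e q' eG1 /sub2 A2q /(AG1 e q' eG1 A2q)[v vV ->].
  by exists v; [exact: V2 | rewrite p2V].
have nxz : [set x; z]%SET \notin ([set z; y] |: G1)%SET.
  rewrite in_setU1 negb_or; apply/andP; split.
    by apply/eqP; rewrite finset.setUC => /set2_inj.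
  by apply: contra zV => /(drawing_edge_sub dr1)/fintype.subsetP; apply; rewrite !inE eqxx orbT.
exists p2; eexists; apply: (drawing_add_edge (S := A1) dr3 (V2 x xV) zV2 nxz); first by rewrite p2z p2V.
  move=> v; rewrite !inE => /orP[/eqP -> //|vV]; first by rewrite eqxx orbT.
  rewrite (p2V v vV) => A1v; case: (onA A1 v sub1 vV A1v) => vE; first by rewrite vE eqxx.
  case: (qV y yV); apply/esym; apply: meet; first by rewrite -vE.
  exact: (arc_ends arc2).2.
move=> e q'; rewrite in_setU1; case: eqP => [_ _ A1q A2q|_ /= eG1 /sub1 A1q /(AG1 e q' eG1 A1q)[v vV ->]].
  by exists z; rewrite // p2z; exact: meet.
by exists v; [exact: V2 | rewrite p2V].
Qed.

Lemma drawable_suppress V G x y z : [set x; z]%SET \in G -> [set z; y]%SET \in G ->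
  x != y -> [set x; y]%SET \notin G ->
  {in G, forall e, z \in e -> e = [set x; z]%SET \/ e = [set z; y]%SET} ->
  drawable R V G ->
  drawable R (V :\ z)%SET ([set x; y] |: (G :\ [set x; z] :\ [set z; y]))%SET.
Proof.
move=> xzG zyG xy nxy zG [p [A dr]].
have [xV zV xz Axz] := drawing_arc dr xzG; have [_ yV zy Azy] := drawing_arc dr zyG.
have [ip eG vG iG] := dr.
pose G1 := (G :\ [set x; z] :\ [set z; y])%SET.
have G1P e : e \in G1 -> [/\ e \in G, e <> [set x; z]%SET & e <> [set z; y]%SET].
  by rewrite !in_setD1 => /and3P[/eqP ? /eqP ?].
have xzzy : [set x; z]%SET <> [set z; y]%SET.
  by rewrite finset.setUC => /set2_inj /eqP; exact/negP.
have dr1 : drawing (V :\ z)%SET G1 p A.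
  apply: (drawing_sub _ _ _ dr); first exact: subD1set.
    by apply/fintype.subsetP => e /G1P[].
  move=> e /G1P[eG' exz ezy]; apply/fintype.subsetP => v ve; rewrite in_setD1.
  rewrite (fintype.subsetP (drawing_edge_sub dr eG') v ve) andbT.
  by apply/eqP => vz; case: (zG e eG') => //; rewrite -vz.
have meet q : A [set x; z]%SET q -> A [set z; y]%SET q -> q = p z.
  move=> A1 A2; have [v vV qv] := iG _ _ _ xzG zyG xzzy A1 A2; rewrite qv; congr p.
  have := vG _ v xzG vV; have := vG _ v zyG vV; rewrite -qv !inE => /(_ A2) + /(_ A1).
  by move=> /orP[/eqP //|/eqP ->] /orP[/eqP yx|/eqP //]; rewrite yx eqxx in xy.
have neqz v : v \in V -> v <> z -> v \in (V :\ z)%SET by move=> vV /eqP vz; rewrite in_setD1 vz.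
exists p; eexists; apply: (drawing_add_edge (S := A [set x; z]%SET `|` A [set z; y]%SET) dr1).
- exact: neqz.
- by apply: neqz => // /esym.
- by apply: contra nxy => /G1P[].
- exact: arc_concat Azy meet.
- move=> v; rewrite in_setD1 => /andP[/negbTE vz vV] [] Av.
    by have := vG _ v xzG vV Av; rewrite !inE vz orbF => ->.
  by have := vG _ v zyG vV Av; rewrite !inE vz /= => ->; rewrite orbT.
- move=> e q /[dup] eG1 /G1P[eG' exz ezy] A12 Ae.
  have [v vV qv] : exists2 v, v \in V & q = p v.
    case: A12 => Aq; first by apply: (iG e [set x; z]%SET).
    by apply: (iG e [set z; y]%SET).
  exists v => //; apply: neqz => // vz.
  case: (zG e eG') => //; rewrite -vz; apply: vG => //; by rewrite -qv.
Qed.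

End LocalMoves.

(** * Planarity-preserving operations *)

Definition isolated n (G : graph n) (z : 'I_n) : bool := [forall e in G, z \notin e].

Lemma isolatedP n (G : graph n) (z : 'I_n) :
  reflect (forall e, e \in G -> z \notin e) (isolated G z).
Proof. exact: (iffP forall_inP). Qed.

Definition relabel n (u z : 'I_n) (G : graph n) : graph n :=
  [set [set tperm u z x | x in e]%SET | e : {set 'I_n} in G]%SET.

(** The interface between topology and counting. All graphs live on the same vertices, so a new
    vertex is an isolated one put to use. [pc_relabel] serves the one insertion,
    [suppress_lift_pendant], that the other moves produce with two vertices exchanged. *)
Record planar_class n (P : graph n -> Prop) : Prop := PlanarClass {
  pc_sub : forall G G' : graph n, (G \subset G')%SET -> P G' -> P G;
  pc_pendant : forall (G : graph n) w z, w != z -> isolated G z -> P G ->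
    P ([set w; z] |: G)%SET;
  pc_pendant_triangle : forall (G : graph n) w a b, w != a -> w != b -> a != b ->
    isolated G a -> isolated G b -> P G ->
    P ([set a; b] |: ([set w; b] |: ([set w; a] |: G)))%SET;
  pc_subdivide : forall (G : graph n) x y z, [set x; y]%SET \in G -> isolated G z -> P G ->
    P ([set x; z] |: ([set z; y] |: (G :\ [set x; y])))%SET;
  pc_edge_triangle : forall (G : graph n) w x a b, [set w; x]%SET \in G -> a != b ->
    isolated G a -> isolated G b -> P G ->
    P ([set a; x] |: ([set a; b] |: ([set w; b] |: ([set w; a] |: (G :\ [set w; x])))))%SET;
  pc_suppress : forall (G : graph n) x y z, [set x; z]%SET \in G -> [set z; y]%SET \in G ->
    x != y -> {in G, forall e : {set 'I_n}, z \in e -> e = [set x; z]%SET \/ e = [set z; y]%SET} ->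
    P G -> P ([set x; y] |: (G :\ [set x; z] :\ [set z; y]))%SET;
  pc_relabel : forall (G : graph n) u z, P G -> P (relabel u z G) }.

Lemma drawable_relabel (R : realType) n (G : graph n) (u z : 'I_n) :
  drawable R [set: 'I_n]%SET G -> drawable R [set: 'I_n]%SET (relabel u z G).
Proof.
move=> [p [A [ip eG vG iG]]].
pose s := tperm u z; pose S (e : {set 'I_n}) := [set s x | x in e]%SET.
have sK : involutive s by exact: tpermK.
have SK : involutive S.
  by move=> e; rewrite /S -imset_comp -[RHS]imset_id; apply: eq_imset => x; exact: sK.
exists (p \o s), (A \o S); split.
- by move=> x y _ _ /ip; rewrite !inE => /(_ isT isT)/perm_inj.
- move=> e /imsetP[e0 e0G ->]; have [x [y [E _ _ Axy]]] := eG e0 e0G.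
  exists (s x), (s y); rewrite !inE /= !sK; split => //; first by rewrite E imsetU !imset_set1.
  by rewrite -/(S e0) SK.
- move=> e v /imsetP[e0 e0G ->] _ /=; rewrite -/(S e0) SK => /(vG e0 (s v) e0G) vE.
  by rewrite -[v]sK /S imset_f// vE.
- move=> e e' q /imsetP[e0 e0G ->] /imsetP[e1 e1G ->] ee' /=.
  rewrite -/(S e0) -/(S e1) !SK => A0 A1.
  have [|v _ ->] := iG e0 e1 q e0G e1G _ A0 A1; first by move=> E; apply: ee'; rewrite E.
  by exists (s v); rewrite ?inE//= sK.
Qed.

(** An isolated vertex may sit anywhere in the given drawing, so it is first erased and then redrawn
    by the local move. *)
Lemma planar_planar_class (R : realType) n : planar_class (@planar R n).
Proof.
have drop (G : graph n) (U : {set 'I_n}) : (forall z, z \in U -> isolated G z) ->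
    planar R G -> drawable R (~: U)%SET G.
  move=> GU /planar_drawable dG; rewrite -finset.setTD; apply: drawable_remove_vertices dG.
  move=> e eG; apply/fintype.subsetP => v ve; rewrite inE; apply/negP => /GU/isolatedP/(_ e eG).
  by rewrite ve.
have drop1 (G : graph n) z : isolated G z -> planar R G -> drawable R (~: [set z])%SET G.
  by move=> Gz; apply: drop => x /set1P ->.
have fill1 (z : 'I_n) : (z |: ~: [set z])%SET = [set: 'I_n]%SET by rewrite finset.setUCr.
have fill2 (a b : 'I_n) : (b |: (a |: ~: [set a; b]))%SET = [set: 'I_n]%SET.
  by apply/setP => x; rewrite !inE; case: eqP; case: eqP.
split.
- by move=> G G' GG /planar_drawable dG; apply/planar_drawable/(drawable_sub GG dG).
- move=> G w z wz Gz /(drop1 _ _ Gz) dG; apply/planar_drawable; rewrite -(fill1 z).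
  by apply: drawable_pendant => //; rewrite !inE ?eqxx.
- move=> G w a b wa wb ab Ga Gb /(drop G [set a; b]%SET) dG; apply/planar_drawable.
  rewrite -(fill2 a b); apply: drawable_pendant_triangle => //; rewrite ?inE ?eqxx ?orbT ?negb_or ?wa//.
  by apply: dG => z /set2P[] ->.
- move=> G x y z xyG Gz /(drop1 _ _ Gz) dG; apply/planar_drawable; rewrite -(fill1 z).
  by apply: drawable_subdivide => //; rewrite !inE ?eqxx.
- move=> G w x a b wxG ab Ga Gb /(drop G [set a; b]%SET) dG; apply/planar_drawable.
  rewrite -(fill2 a b); apply: drawable_edge_triangle => //; rewrite ?inE ?eqxx ?orbT//.
  by apply: dG => z /set2P[] ->.
(* If [xy] is already an edge, the result is a subgraph of [G]. Otherwise the two arcs at [z] are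
   glued and [z] is redrawn as an isolated vertex. *)
- move=> G x y z xzG zyG xy zG PG; have [xyG|xyG] := boolP ([set x; y]%SET \in G).
    move/planar_drawable: PG => dG; apply/planar_drawable; apply: drawable_sub dG.
    apply/fintype.subsetP => e; rewrite in_setU1 => /orP[/eqP -> //|].
    by rewrite !in_setD1 => /and3P[].
  move/planar_drawable: PG => dG; apply/planar_drawable.
  have -> : [set: 'I_n]%SET = (z |: ([set: 'I_n] :\ z))%SET by rewrite finset.setD1K ?inE.
  by apply: drawable_add_isolated; exact: drawable_suppress.
- by move=> G u z /planar_drawable dG; apply/planar_drawable; exact: drawable_relabel.
Qed.

Lemma set2C (T : finType) (x y : T) : [set x; y]%SET = [set y; x]%SET.
Proof. exact: finset.setUC. Qed.

Lemma setU11C (T : finType) (x y : T) (G : {set {set T}}) : [set y; x]%SET \in ([set x; y] |: G)%SET.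
Proof. by rewrite set2C finset.setU11. Qed.

Lemma in_setD1_neq (T : finType) (e f : T) (G : {set T}) : e <> f -> e \in G -> e \in (G :\ f)%SET.
Proof. by move=> /eqP ef eG; rewrite in_setD1 ef. Qed.

Ltac in_edges := first
  [ assumption | exact: finset.setU11 | exact: setU11C | (apply: finset.setU1r; in_edges) ].

Lemma set2_neq (T : finType) (x : T) (e f : {set T}) : x \in e -> x \notin f -> e <> f.
Proof. by move=> xe xf E; rewrite -E xe in xf. Qed.

Lemma isolatedU1 n (G : graph n) (x y z : 'I_n) :
  z != x -> z != y -> isolated G z -> isolated ([set x; y] |: G)%SET z.
Proof.
move=> zx zy /isolatedP Gz; apply/isolatedP => e; rewrite in_setU1 => /orP[/eqP ->|/Gz //].
by rewrite !inE negb_or zx.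
Qed.

Lemma isolated_sub n (G G' : graph n) (z : 'I_n) : (G \subset G')%SET -> isolated G' z -> isolated G z.
Proof. by move=> /fintype.subsetP GG /isolatedP Gz; apply/isolatedP => e /GG /Gz. Qed.

Lemma isolatedD1 n (G : graph n) (z : 'I_n) e : isolated G z -> isolated (G :\ e)%SET z.
Proof. by apply: isolated_sub; exact: finset.subD1set. Qed.

(* [G] with two further vertices [u], [v] joined to each other, each hung at an
   object of [G]: on a vertex [w] (object [set w]) as a pendant vertex, unless it is
   [w] itself, and on an edge as a vertex subdividing it. *)
Definition insert2 n (G : graph n) (u : 'I_n) (B : {set 'I_n}) (v : 'I_n) (C : {set 'I_n}) : graph n :=
  ([set u; v] |: ([set [set x; u] | x in B :\ u] :|: [set [set x; v] | x in C :\ v]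
    :|: (G :\ B :\ C)))%SET.

Section Insertion.
Variable n : nat.
Implicit Types (G : graph n) (u v w x y z : 'I_n) (B C e : {set 'I_n}).

Lemma insert2P G u B v C e : reflect
  [\/ e = [set u; v]%SET, exists x, [/\ x \in B, x <> u & e = [set x; u]%SET],
      exists x, [/\ x \in C, x <> v & e = [set x; v]%SET] |
      [/\ e \in G, e <> B & e <> C]]
  (e \in insert2 G u B v C).
Proof.
rewrite /insert2 !inE; apply: (iffP idP).
  move=> /orP[/eqP ->|/orP[/orP[]|]]; first by constructor 1.
  - by move=> /imsetP[x + ->]; rewrite in_setD1 => /andP[/eqP xu xB]; constructor 2; exists x.
  - by move=> /imsetP[x + ->]; rewrite in_setD1 => /andP[/eqP xu xB]; constructor 3; exists x.
  - by move=> /and3P[/eqP eC /eqP eB eG]; constructor 4.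
case=> [->|[x [xB /eqP xu ->]]|[x [xC /eqP xv ->]]|[eG /eqP eB /eqP eC]]; first by rewrite eqxx.
- by apply/orP; right; apply/orP; left; apply/orP; left; apply: imset_f; rewrite in_setD1 xu.
- by apply/orP; right; apply/orP; left; apply/orP; right; apply: imset_f; rewrite in_setD1 xv.
- by rewrite eG eB eC !orbT.
Qed.

Lemma insert2C G u B v C : insert2 G u B v C = insert2 G v C u B.
Proof.
by apply/setP => e; apply/insert2P/insert2P => -[->|H|H|[? ? ?]];
  rewrite 1?set2C; by [constructor 1 | constructor 2 | constructor 3 | constructor 4].
Qed.

Lemma insert2_isolated G u B v C z : z <> u -> z <> v -> z \notin B -> z \notin C ->
  isolated G z -> isolated (insert2 G u B v C) z.
Proof.
move=> /eqP zu /eqP zv zB zC /isolatedP Gz; apply/isolatedP => e.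
case/insert2P => [->|[x [xB _ ->]]|[x [xC _ ->]]|[/Gz //]]; rewrite !inE negb_or ?zu ?zv ?andbT//.
- by apply: contraNneq zB => ->.
- by apply: contraNneq zC => ->.
Qed.

Variables (P : graph n -> Prop) (hP : planar_class P).

(** * Insertions across the deletion of a leaf *)

Section Leaf.
Variables (G : graph n) (V : {set 'I_n}) (w z : 'I_n).
Hypotheses (wV : w \in V) (zV : z \in V) (wz : w <> z) (wzG : [set w; z]%SET \in G)
  (G2 : {in G, forall e, #|e| = 2%N /\ (e \subset V)%SET})
  (Gz : {in G, forall e, z \in e -> e = [set w; z]%SET}).
Let G' := (G :\ [set w; z])%SET.

Let leaf_isolated : isolated G' z.
Proof.
by apply/isolatedP => e; rewrite in_setD1 => /andP[/eqP ewz eG]; apply/negP => /(Gz eG).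
Qed.

Let outside e u : e \in G -> u \notin V -> u \notin e.
Proof. by move=> /G2[_ /fintype.subsetP eV]; apply: contra => /eV. Qed.

Let GE e : e \in G -> e = [set w; z]%SET \/ e \in G'.
Proof. by move=> eG; case: (eqVneq e [set w; z]%SET); [left | right; rewrite in_setD1; apply/andP]. Qed.

(** The insertion leaves [z] isolated, so the leaf can be hung back on [w] afterwards. *)
Lemma leaf_lift_other u B v C : u <> z -> v <> z -> z \notin B -> z \notin C ->
  P (insert2 G' u B v C) -> P (insert2 G u B v C).
Proof.
move=> uz vz zB zC X.
have iz : isolated (insert2 G' u B v C) z by apply: insert2_isolated => //; exact/nesym.
have wz' : w != z by exact/eqP.
apply: (pc_sub hP) (pc_pendant hP wz' iz X).
apply/fintype.subsetP => e /insert2P[->|H|H|[eG eB eC]].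
- by apply: finset.setU1r; apply/insert2P; constructor 1.
- by apply: finset.setU1r; apply/insert2P; constructor 2.
- by apply: finset.setU1r; apply/insert2P; constructor 3.
- case: (GE eG) => [->|eG']; first exact: finset.setU11.
  by apply: finset.setU1r; apply/insert2P; constructor 4.
Qed.

(** Hanging [z] on [w] recreates the leaf edge itself. *)
Lemma leaf_lift_self v C : z \notin C -> P (insert2 G' z [set w]%SET v C) -> P (insert2 G z [set z]%SET v C).
Proof.
move=> zC; apply: (pc_sub hP); apply/fintype.subsetP => e /insert2P[->|[x []]|H|[eG eB eC]].
- by apply/insert2P; constructor 1.
- by move=> /set1P ->.
- by apply/insert2P; constructor 3.
- case: (GE eG) => [->|eG']; apply/insert2P; first by constructor 2; exists w; split; rewrite ?inE.
  constructor 4; split => // E; have [] := G2 eG; by rewrite E cards1.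
Qed.

(** The path [w], [z], [u] arises by subdividing the pendant edge [wu] with [z]; [v <> w] keeps the
    inserted edge [uv] apart from the one that is subdivided. *)
Lemma leaf_lift_pendant u v C : u \notin V -> u <> v -> v <> w -> v <> z -> z \notin C ->
  P (insert2 G' u [set w]%SET v C) -> P (insert2 G u [set z]%SET v C).
Proof.
move=> uV uv vw vz zC X.
have uz : u <> z by move=> E; rewrite E zV in uV.
have uw : w <> u by move=> E; rewrite -E wV in uV.
have iz : isolated (insert2 G' u [set w]%SET v C) z.
  by apply: insert2_isolated => //; first [exact/nesym | rewrite inE eq_sym; apply/eqP].
have wu : [set w; u]%SET \in insert2 G' u [set w]%SET v C.
  by apply/insert2P; constructor 2; exists w; rewrite inE.
apply: (pc_sub hP) (pc_subdivide hP wu iz X).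
apply/fintype.subsetP => e /insert2P[->|[x []]|[x [xC xv ->]]|[eG eB eC]].
- do 2!apply: finset.setU1r; apply: in_setD1_neq; last by apply/insert2P; constructor 1.
  by rewrite set2C => /set2_eq[[]|[]] => [/vw|/esym/uv].
- move=> /set1P -> _ ->; in_edges.
- do 2!apply: finset.setU1r; apply: in_setD1_neq; last by apply/insert2P; constructor 3; exists x.
  by move=> /set2_eq[[_ /esym]|[_]].
- case: (GE eG) => [->|eG']; first by in_edges.
  do 2!apply: finset.setU1r; apply: in_setD1_neq.
    by apply/nesym/(set2_neq (x := u)); [rewrite !inE eqxx orbT | exact: outside].
  by apply/insert2P; constructor 4; split => // E; have [] := G2 eG; rewrite E cards1.
Qed.

(** A vertex [u] in the middle of [wz] is a pendant vertex at [w] that carries the leaf [z]. *)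
Lemma leaf_lift_edge u v C : u \notin V -> u <> v -> v <> z -> z \notin C ->
  P (insert2 G' u [set w]%SET v C) -> P (insert2 G u [set w; z]%SET v C).
Proof.
move=> uV uv vz zC X.
have uz : u <> z by move=> E; rewrite E zV in uV.
have iz : isolated (insert2 G' u [set w]%SET v C) z.
  by apply: insert2_isolated => //; first [exact/nesym | rewrite inE eq_sym; apply/eqP].
have uz' : u != z by exact/eqP.
apply: (pc_sub hP) (pc_pendant hP uz' iz X).
apply/fintype.subsetP => e /insert2P[->|[x []]|H|[eG eB eC]].
- by apply: finset.setU1r; apply/insert2P; constructor 1.
- move=> /set2P[] -> xu ->; last by in_edges.
  by apply: finset.setU1r; apply/insert2P; constructor 2; exists w; rewrite inE.
- by apply: finset.setU1r; apply/insert2P; constructor 3.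
- case: (GE eG) => [//|eG'].
  apply: finset.setU1r; apply/insert2P; constructor 4; split => // E.
  by have [] := G2 eG; rewrite E cards1.
Qed.

Hypothesis PG : P G.
Let PG' : P G'.
Proof. by apply: (pc_sub hP) PG; exact: finset.subD1set. Qed.

Let iso' u : u \notin V -> isolated G' u.
Proof. by move=> uV; apply/isolatedP => e; rewrite in_setD1 => /andP[_ eG]; exact: outside. Qed.

(** The edges [wu], [uv], [vz], [zw] form a pendant triangle with one side subdivided. It shrinks to
    a triangle, or to the edge [wz], when [u] is [w] or [v] is [z]. *)
Lemma leaf_merge_ends u v : u \notin V \/ u = w -> v \notin V \/ v = z -> u <> v ->
  P (insert2 G u [set w]%SET v [set z]%SET).
Proof.
move=> uV vV uv.
have wz' : w != z by exact/eqP.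
have nV t s : t \in V -> s \notin V -> t != s by move=> tV; apply: contraNneq => <-.
have fromG' (H : graph n) : (forall e, e \in G' -> e \in H) -> [set w; z]%SET \in H -> [set u; v]%SET \in H ->
    (w <> u -> [set w; u]%SET \in H) -> (z <> v -> [set z; v]%SET \in H) -> P H ->
    P (insert2 G u [set w]%SET v [set z]%SET).
  move=> G'H wzH uvH wuH zvH; apply: (pc_sub hP); apply/fintype.subsetP => e.
  case/insert2P => [->//|[x []]|[x []]|[/GE[->//|/G'H//]]]; move=> /set1P -> ? -> //.
    exact: wuH.
  exact: zvH.
case: uV vV => [uV|uw] [vV|vz].
- have P1 := pc_pendant_triangle hP wz' (nV w u wV uV) (nV z u zV uV) leaf_isolated (iso' uV) PG'.
  have vu : v != u by apply/eqP/nesym.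
  have iv : isolated ([set z; u] |: ([set w; u] |: ([set w; z] |: G')))%SET v.
    by rewrite !isolatedU1 ?iso'// eq_sym ?nV// eq_sym.
  have P2 := pc_subdivide hP (finset.setU11 _ _) iv P1.
  apply: fromG' P2; try in_edges.
  + move=> e eG'; do 2!apply: finset.setU1r; apply: in_setD1_neq; last by do 3!apply: finset.setU1r.
    by apply/nesym/(set2_neq (x := z)); [rewrite !inE eqxx | exact: (elimT (isolatedP _ _) leaf_isolated _ eG')].
  + do 2!apply: finset.setU1r; apply: in_setD1_neq; last by in_edges.
    by apply/nesym/(set2_neq (x := u)); rewrite !inE ?eqxx ?orbT// negb_or !(eq_sym u) !nV.
  + move=> _; do 2!apply: finset.setU1r; apply: in_setD1_neq; last by in_edges.
    by apply: (set2_neq (x := w)); rewrite !inE ?eqxx ?orbT// negb_or wz' nV.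
  + by move=> _; in_edges.
- subst v; have P1 := pc_pendant_triangle hP wz' (nV w u wV uV) (nV z u zV uV) leaf_isolated (iso' uV) PG'.
  apply: fromG' P1; first [in_edges | move=> *; in_edges | by case].
- subst u; have P1 := pc_pendant_triangle hP wz' (nV w v wV vV) (nV z v zV vV) leaf_isolated (iso' vV) PG'.
  apply: fromG' P1; first [in_edges | move=> *; in_edges | by case].
- by apply: fromG' PG => //; rewrite ?uw ?vz// => e; rewrite in_setD1 => /andP[].
Qed.

(** A pendant triangle [w], [u], [v] with [z] hung on [v]; for [u = w] it is a pendant path. *)
Lemma leaf_merge_edge_root u v : u \notin V \/ u = w -> v \notin V -> u <> v ->
  P (insert2 G u [set w]%SET v [set w; z]%SET).
Proof.
move=> uV vV uv.
have nV t s : t \in V -> s \notin V -> t != s by move=> tV; apply: contraNneq => <-.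
have zw : z != w by rewrite eq_sym; exact/eqP.
have fromG' (H : graph n) : (forall e, e \in G' -> e \in H) -> [set u; v]%SET \in H ->
    (w <> u -> [set w; u]%SET \in H) -> [set w; v]%SET \in H -> [set z; v]%SET \in H -> P H ->
    P (insert2 G u [set w]%SET v [set w; z]%SET).
  move=> G'H uvH wuH wvH zvH; apply: (pc_sub hP); apply/fintype.subsetP => e.
  case/insert2P => [->//|[x []]|[x []]|[/GE[->//|/G'H//]]].
    by move=> /set1P -> ? ->; exact: wuH.
  by move=> /set2P[] -> _ ->.
case: uV => [uV|uw].
- have P1 := pc_pendant_triangle hP (nV w u wV uV) (nV w v wV vV) (introN eqP uv) (iso' uV) (iso' vV) PG'.
  have iz : isolated ([set u; v] |: ([set w; v] |: ([set w; u] |: G')))%SET z.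
    by rewrite !isolatedU1 ?zw ?(nV z v zV vV) ?(nV z u zV uV) ?leaf_isolated.
  have vz : v != z by rewrite eq_sym nV.
  apply: fromG' (pc_pendant hP vz iz P1); first [in_edges | move=> *; in_edges | by case].
- subst u; have P1 := pc_pendant hP (nV w v wV vV) (iso' vV) PG'.
  have iz : isolated ([set w; v] |: G')%SET z.
    by rewrite !isolatedU1 ?zw ?(nV z v zV vV) ?leaf_isolated.
  have vz : v != z by rewrite eq_sym nV.
  apply: fromG' (pc_pendant hP vz iz P1); first [in_edges | move=> *; in_edges | by case].
Qed.

(** Here the triangle is [v], [z], [u], attached to [w] by the edge [wv]. *)
Lemma leaf_merge_edge_tip u v : u \notin V \/ u = z -> v \notin V -> u <> v ->
  P (insert2 G u [set z]%SET v [set w; z]%SET).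
Proof.
move=> uV vV uv.
have nV t s : t \in V -> s \notin V -> t != s by move=> tV; apply: contraNneq => <-.
have zw : z != w by rewrite eq_sym; exact/eqP.
have fromG' (H : graph n) : (forall e, e \in G' -> e \in H) -> [set u; v]%SET \in H ->
    (z <> u -> [set z; u]%SET \in H) -> [set w; v]%SET \in H -> [set z; v]%SET \in H -> P H ->
    P (insert2 G u [set z]%SET v [set w; z]%SET).
  move=> G'H uvH wuH wvH zvH; apply: (pc_sub hP); apply/fintype.subsetP => e.
  case/insert2P => [->//|[x []]|[x []]|[/GE[->//|/G'H//]]].
    by move=> /set1P -> ? ->; exact: wuH.
  by move=> /set2P[] -> _ ->.
have P1 := pc_pendant hP (nV w v wV vV) (iso' vV) PG'.
have iz : isolated ([set w; v] |: G')%SET z.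
  by rewrite !isolatedU1 ?zw ?(nV z v zV vV) ?leaf_isolated.
have vz : v != z by rewrite eq_sym nV.
case: uV => [uV|uz].
- have iu : isolated ([set w; v] |: G')%SET u.
    by rewrite !isolatedU1 ?iso'//; [rewrite eq_sym nV | exact/eqP].
  have vu : v != u by apply/eqP/nesym.
  apply: fromG' (pc_pendant_triangle hP vz vu (nV z u zV uV) iz iu P1);
    first [in_edges | move=> *; in_edges | by case].
- by subst u; apply: fromG' (pc_pendant hP vz iz P1);
    first [in_edges | move=> *; in_edges | by case].
Qed.

End Leaf.
End Insertion.

(** * Insertions across a suppression *)

Section Suppression.
Variables (n : nat) (P : graph n -> Prop) (hP : planar_class P).
Implicit Types (u v w x y z : 'I_n) (B C e : {set 'I_n}).

Section Suppress.
Variables (G : graph n) (V : {set 'I_n}) (x y z : 'I_n).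
Hypotheses (xV : x \in V) (yV : y \in V) (zV : z \in V) (xz : x <> z) (yz : y <> z)
  (xy : x <> y) (xzG : [set x; z]%SET \in G) (zyG : [set z; y]%SET \in G)
  (xyG : [set x; y]%SET \notin G)
  (G2 : {in G, forall e, #|e| = 2%N /\ (e \subset V)%SET})
  (Gz : {in G, forall e, z \in e -> e = [set x; z]%SET \/ e = [set z; y]%SET}).
Let G' := ([set x; y] |: (G :\ [set x; z] :\ [set z; y]))%SET.

Let outside e u : e \in G -> u \notin V -> u \notin e.
Proof. by move=> /G2[_ /fintype.subsetP eV]; apply: contra => /eV. Qed.

Let xy' : x != y. Proof. exact/eqP. Qed.

Let nV t s : t \in V -> s \notin V -> t <> s.
Proof. by move=> tV sV E; rewrite -E tV in sV. Qed.

Let size1 e w : e \in G -> e <> [set w]%SET.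
Proof. by move=> /G2[e2 _] E; rewrite E cards1 in e2. Qed.

Let GE e : e \in G -> [\/ e = [set x; z]%SET, e = [set z; y]%SET |
  [/\ e \in G', e <> [set x; y]%SET & z \notin e]].
Proof.
move=> eG; case: (eqVneq e [set x; z]%SET) => [|exz]; first by constructor 1.
case: (eqVneq e [set z; y]%SET) => [|ezy]; first by constructor 2.
constructor 3; split; first by rewrite !inE eG exz ezy orbT.
  by move=> E; move: xyG; rewrite -E eG.
by apply/negP => /(Gz eG)[] E; rewrite E eqxx in exz ezy.
Qed.

Let isoz : isolated G' z.
Proof.
rewrite isolatedU1//; first by rewrite eq_sym; exact/eqP.
  by rewrite eq_sym; exact/eqP.
apply/isolatedP => e; rewrite !in_setD1 => /and3P[/eqP ezy /eqP exz eG].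
by apply/negP => /(Gz eG)[].
Qed.

Let isou u : u \notin V -> isolated G' u.
Proof.
move=> uV; rewrite isolatedU1//; try by apply/eqP/nesym/nV.
by apply/isolatedP => e; rewrite !in_setD1 => /and3P[_ _ eG]; exact: outside.
Qed.

Let xyG' : [set x; y]%SET \in G'. Proof. exact: finset.setU11. Qed.
Let yxG' : [set y; x]%SET \in G'. Proof. exact: setU11C. Qed.

Lemma suppress_planar : P G -> P G'.
Proof. exact: (pc_suppress hP). Qed.

(** Subdividing [xy] by [z] consumes that edge, so no edge made by the insertion may coincide with
    it. This is why [suppress_step] adds [xy] to the exceptions. *)
Lemma suppress_lift_other u B v C : u <> z -> v <> z -> z \notin B -> z \notin C ->
  [set u; v]%SET <> [set x; y]%SET -> B <> [set x; y]%SET -> C <> [set x; y]%SET ->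
  (u \in V -> B = [set u]%SET) -> (v \in V -> C = [set v]%SET) ->
  P (insert2 G' u B v C) -> P (insert2 G u B v C).
Proof.
move=> uz vz zB zC uvxy Bxy Cxy uB vC X.
have iz : isolated (insert2 G' u B v C) z by apply: insert2_isolated => //; exact/nesym.
have xyX : [set x; y]%SET \in insert2 G' u B v C.
  by apply/insert2P; constructor 4; split => //; exact/nesym.
have hang t w (D : {set 'I_n}) : t \in D -> t <> w -> (w \in V -> D = [set w]%SET) -> [set t; w]%SET <> [set x; y]%SET.
  move=> tD tw wD E; have wV : w \in V.
    have : w \in [set x; y]%SET by rewrite -E !inE eqxx orbT.
    by move=> /set2P[] ->.
  by move: tD; rewrite (wD wV) => /set1P.
apply: (pc_sub hP) (pc_subdivide hP xyX iz X).
apply/fintype.subsetP => e /insert2P[->|[t [tB tu ->]]|[t [tC tv ->]]|[eG eB eC]].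
- by do 2!apply: finset.setU1r; apply: in_setD1_neq => //; apply/insert2P; constructor 1.
- do 2!apply: finset.setU1r; apply: in_setD1_neq; first exact: hang tB tu uB.
  by apply/insert2P; constructor 2; exists t.
- do 2!apply: finset.setU1r; apply: in_setD1_neq; first exact: hang tC tv vC.
  by apply/insert2P; constructor 3; exists t.
- case: (GE eG) => [->|->|[eG' exy _]]; [by in_edges | by in_edges |].
  by do 2!apply: finset.setU1r; apply: in_setD1_neq => //; apply/insert2P; constructor 4.
Qed.

(** Putting [z] on the edge [xy] recreates the two edges at [z]. *)
Lemma suppress_lift_self v C : z \notin C -> v <> z ->
  P (insert2 G' z [set x; y]%SET v C) -> P (insert2 G z [set z]%SET v C).
Proof.
move=> zC vz; apply: (pc_sub hP); apply/fintype.subsetP => e.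
case/insert2P => [->|[t [/set1P -> //]]|H|[eG eB eC]]; apply/insert2P.
- by constructor 1.
- by constructor 3.
- case: (GE eG) => [->|->|[eG' exy _]]; last by constructor 4.
    by constructor 2; exists x; split => //; rewrite !inE eqxx.
  by constructor 2; exists y; split => //; [rewrite !inE eqxx orbT | exact: set2C].
Qed.

(** In the smaller graph [u] sits on [xy]. Subdividing [uv] by [z] gives the wanted graph with [u]
    and [z] exchanged, and a transposition repairs this. If [v] is [x] or [y], then [uv] is one of
    the halves of [xy] and cannot be spared; a triangle attached to an end of [xy] does it
    instead. *)
Lemma suppress_lift_pendant u v C : u \notin V -> u <> v -> v <> z -> z \notin C -> u \notin C ->
  (v \in V -> C = [set v]%SET) -> P G' ->
  P (insert2 G' u [set x; y]%SET v C) -> P (insert2 G u [set z]%SET v C).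
Proof.
move=> uV uv vz zC uC vC PG' X.
have uz : u <> z by exact/nesym/nV.
have zu' : z != u by apply/eqP/nesym.
have fromG' (H : graph n) : v \in V -> (forall e, e \in G' -> e <> [set x; y]%SET -> e \in H) ->
    [set x; z]%SET \in H -> [set z; y]%SET \in H -> [set u; v]%SET \in H -> [set z; u]%SET \in H ->
    P H -> P (insert2 G u [set z]%SET v C).
  move=> vV G'H xzH zyH uvH zuH; rewrite (vC vV); apply: (pc_sub hP); apply/fintype.subsetP => e.
  case/insert2P => [->//|[t [/set1P -> _ ->//]]|[t [/set1P -> //]]|[eG eB eC]].
  by case: (GE eG) => [->//|->//|[eG' exy _]]; exact: G'H.
case: (eqVneq v x) => [vx|/eqP vx].
  have H := pc_edge_triangle hP xyG' zu' isoz (isou uV) PG'.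
  apply: fromG' H; rewrite ?vx//; try in_edges.
  by move=> e eG' exy; do 4!apply: finset.setU1r; exact: in_setD1_neq.
case: (eqVneq v y) => [vy|/eqP vy].
  have H := pc_edge_triangle hP yxG' zu' isoz (isou uV) PG'.
  apply: fromG' H; rewrite ?vy//; try in_edges.
  by move=> e eG' exy; do 4!apply: finset.setU1r; apply: in_setD1_neq; rewrite // set2C.
have iz : isolated (insert2 G' u [set x; y]%SET v C) z.
  apply: insert2_isolated => //; [exact/nesym | exact/nesym |].
  by rewrite !inE negb_or; apply/andP; split; apply/eqP/nesym.
have uvX : [set u; v]%SET \in insert2 G' u [set x; y]%SET v C by apply/insert2P; constructor 1.
have := pc_relabel hP u z (pc_subdivide hP uvX iz X).
set X1 := (_ |: _)%SET => PX1.
have img a b : [set a; b]%SET \in X1 -> [set tperm u z a; tperm u z b]%SET \in relabel u z X1.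
  by move=> /(imset_f (fun e => [set tperm u z t | t in e]%SET)); rewrite imsetU !imset_set1.
have fixed e : e \in X1 -> z \notin e -> u \notin e -> e \in relabel u z X1.
  move=> eX1 ze ue; apply/imsetP; exists e => //; rewrite -[LHS]imset_id.
  apply: eq_in_imset => t te /=; rewrite tpermD//.
    by apply: contraNneq ue => ->.
  by apply: contraNneq ze => ->.
have tpz : tperm u z z = u by exact: tpermR.
have tpu : tperm u z u = z by exact: tpermL.
have tpo t : t <> u -> t <> z -> tperm u z t = t.
  by move=> tu tz; rewrite tpermD//; apply/eqP/nesym.
apply: (pc_sub hP) PX1; apply/fintype.subsetP => e.
case/insert2P => [->|[t [/set1P -> _ ->]]|[t [tC tv ->]]|[eG eB eC]].
- have := img z v; rewrite tpz (tpo v (nesym uv) vz); apply; rewrite /X1; in_edges.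
- have := img u z; rewrite tpz tpu; apply; rewrite /X1; in_edges.
- have tu : t <> u by move=> E; rewrite -E tC in uC.
  have tz : t <> z by move=> E; rewrite -E tC in zC.
  apply: fixed; last 2 first.
  + by rewrite !inE negb_or; apply/andP; split; apply/eqP/nesym.
  + by rewrite !inE negb_or; apply/andP; split; apply/eqP; [exact/nesym|].
  do 2!apply: finset.setU1r; apply: in_setD1_neq; last by apply/insert2P; constructor 3; exists t.
  by apply/nesym/(set2_neq (x := u)); rewrite !inE ?eqxx// negb_or; apply/andP; split; apply/eqP => //; exact/nesym.
- case: (GE eG) => [->|->|[eG' exy ze]].
  + have := img x u; rewrite tpu (tpo x (nV xV uV) xz); apply.
    do 2!apply: finset.setU1r; apply: in_setD1_neq.
      by rewrite set2C => /set2_inj /esym.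
    by apply/insert2P; constructor 2; exists x; split; rewrite ?inE ?eqxx//; exact: nV.
  + have := img u y; rewrite tpu (tpo y (nV yV uV) yz); apply.
    do 2!apply: finset.setU1r; apply: in_setD1_neq; first by move=> /set2_inj /esym.
    by rewrite set2C; apply/insert2P; constructor 2; exists y; split; rewrite ?inE ?eqxx ?orbT//; exact: nV.
  + have ue := outside eG uV; apply: fixed => //.
    do 2!apply: finset.setU1r; apply: in_setD1_neq.
      by apply/nesym/(set2_neq (x := u)); rewrite ?inE ?eqxx.
    by apply/insert2P; constructor 4.
Qed.

(** Subdividing [uy] by [z] turns the place of [u] on [xy] into one on [xz]. For [v = y] the edge
    [uy] has to stay as well, and a triangle on [u] and [z] is attached at the end [y] of [yx]. *)
Lemma suppress_lift_edge u v C : u \notin V -> u <> v -> v <> z -> z \notin C -> u \notin C ->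
  (v \in V -> C = [set v]%SET) -> P G' ->
  P (insert2 G' u [set x; y]%SET v C) -> P (insert2 G u [set x; z]%SET v C).
Proof.
move=> uV uv vz zC uC vC PG' X.
have uz : u <> z by exact/nesym/nV.
have uz' : u != z by exact/eqP.
case: (eqVneq v y) => [vy|/eqP vy].
  have H := pc_edge_triangle hP yxG' uz' (isou uV) isoz PG'.
  have CE : C = [set y]%SET by rewrite -vy vC// vy.
  rewrite CE vy; apply: (pc_sub hP) H; apply/fintype.subsetP => e.
  case/insert2P => [->|[t [/set2P[] -> _ ->]]|[t [/set1P -> //]]|[eG eB eC]]; try in_edges.
  case: (GE eG) => [//|->|[eG' exy _]]; first by in_edges.
  by do 4!apply: finset.setU1r; apply: in_setD1_neq; rewrite // set2C.
have iz : isolated (insert2 G' u [set x; y]%SET v C) z.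
  apply: insert2_isolated => //; [exact/nesym | exact/nesym |].
  by rewrite !inE negb_or; apply/andP; split; apply/eqP/nesym.
have uyX : [set u; y]%SET \in insert2 G' u [set x; y]%SET v C.
  by rewrite set2C; apply/insert2P; constructor 2; exists y; split; rewrite ?inE ?eqxx ?orbT//; exact: nV.
apply: (pc_sub hP) (pc_subdivide hP uyX iz X); apply/fintype.subsetP => e.
case/insert2P => [->|[t [/set2P[] -> _ ->]]|[t [tC tv ->]]|[eG eB eC]].
- do 2!apply: finset.setU1r; apply: in_setD1_neq; first by move=> /set2_inj.
  by apply/insert2P; constructor 1.
- do 2!apply: finset.setU1r; apply: in_setD1_neq; first by rewrite set2C => /set2_inj.
  by apply/insert2P; constructor 2; exists x; split; rewrite ?inE ?eqxx//; exact: nV.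
- by in_edges.
- do 2!apply: finset.setU1r; apply: in_setD1_neq; last by apply/insert2P; constructor 3; exists t.
  have tu : t <> u by move=> E; rewrite -E tC in uC.
  by apply/nesym/(set2_neq (x := u)); rewrite !inE ?eqxx// negb_or; apply/andP; split; apply/eqP => //; exact/nesym.
- case: (GE eG) => [//|->|[eG' exy ze]]; first by in_edges.
  do 2!apply: finset.setU1r; apply: in_setD1_neq.
    by apply/nesym/(set2_neq (x := u)); rewrite ?inE ?eqxx//; exact: outside.
  by apply/insert2P; constructor 4.
Qed.

(** The vertices [z], [v], [u] form a triangle attached to the end [z] of [zx]; for [u = z] a
    subdivision is enough. *)
Lemma suppress_merge_edge u v : u \notin V \/ u = z -> v \notin V -> u <> v -> P G ->
  P (insert2 G u [set z]%SET v [set x; z]%SET).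
Proof.
move=> uV vV uv PG.
have iso t : t \notin V -> isolated G t by move=> tV; apply/isolatedP => e eG; exact: outside.
case: uV => [uV|uz].
  have zxG : [set z; x]%SET \in G by rewrite set2C.
  have vu' : v != u by apply/eqP/nesym.
  apply: (pc_sub hP) (pc_edge_triangle hP zxG vu' (iso v vV) (iso u uV) PG).
  apply/fintype.subsetP => e.
  case/insert2P => [->|[t [/set1P -> _ ->]]|[t [/set2P[] -> _ ->]]|[eG eB eC]]; try in_edges.
  by do 4!apply: finset.setU1r; apply: in_setD1_neq; rewrite // set2C.
subst u; apply: (pc_sub hP) (pc_subdivide hP xzG (iso v vV) PG); apply/fintype.subsetP => e.
case/insert2P => [->|[t [/set1P -> //]]|[t [/set2P[] -> _ ->]]|[eG eB eC]]; try in_edges.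
by do 2!apply: finset.setU1r; exact: in_setD1_neq.
Qed.

(** Subdivide [xy] by [v], then attach a triangle on [u] and [z] to the end [v] of [vx]: the path
    runs [x], [u], [z], [v], [y], with chord [uv]. *)
Lemma suppress_merge_edges u v : u \notin V -> v \notin V -> u <> v -> P G' ->
  P (insert2 G u [set x; z]%SET v [set z; y]%SET).
Proof.
move=> uV vV uv PG'.
have uz' : u != z by apply/eqP/nesym/nV.
have zv' : z != v by apply/eqP/nV.
have P1 := pc_subdivide hP xyG' (isou vV) PG'.
set H1 := (_ |: _)%SET in P1.
have iso1 t : t <> x -> t <> y -> t <> v -> isolated G' t -> isolated H1 t.
  move=> /eqP tx /eqP ty /eqP tv it; rewrite /H1 !isolatedU1//.
  exact: isolatedD1.
have vxH1 : [set v; x]%SET \in H1 by rewrite /H1; in_edges.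
have iu1 : isolated H1 u by apply: iso1 => //; [exact/nesym/nV | exact/nesym/nV | exact: isou].
have iz1 : isolated H1 z by apply: iso1 => //; [exact/nesym | exact/nesym | exact: nV].
apply: (pc_sub hP) (pc_edge_triangle hP vxH1 uz' iu1 iz1 P1); apply/fintype.subsetP => e.
case/insert2P => [->|[t [/set2P[] -> _ ->]]|[t [/set2P[] -> _ ->]]|[eG eB eC]]; try in_edges.
- do 4!apply: finset.setU1r; apply: in_setD1_neq.
    by rewrite set2C => /set2_inj /esym.
  by rewrite /H1; in_edges.
- case: (GE eG) => [//|//|[eG' exy ze]].
  do 4!apply: finset.setU1r; apply: in_setD1_neq.
    by apply/nesym/(set2_neq (x := v)); rewrite ?inE ?eqxx//; exact: outside.
  by do 2!apply: finset.setU1r; exact: in_setD1_neq.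
Qed.

End Suppress.

(** * Triangle components *)

Section TriangleComponent.
Variables (G : graph n) (V : {set 'I_n}) (x y z : 'I_n).
Hypotheses (xy : x <> y) (xz : x <> z) (yz : y <> z)
  (Gt : {in G, forall e, x \in e \/ y \in e \/ z \in e ->
    [\/ e = [set x; y]%SET, e = [set x; z]%SET | e = [set y; z]%SET]}).
Let G' := (G :\ [set x; y] :\ [set x; z] :\ [set y; z])%SET.

Let GE e : e \in G -> [\/ e = [set x; y]%SET, e = [set x; z]%SET, e = [set y; z]%SET | e \in G'].
Proof.
move=> eG; case: (eqVneq e [set x; y]%SET) => [|exy]; first by constructor 1.
case: (eqVneq e [set x; z]%SET) => [|exz]; first by constructor 2.
case: (eqVneq e [set y; z]%SET) => [|eyz]; first by constructor 3.
by constructor 4; rewrite !in_setD1 eG exy exz eyz.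
Qed.

Let iso t : t \in [:: x; y; z] -> isolated G' t.
Proof.
move=> tE; apply/isolatedP => e; rewrite !in_setD1 => /and4P[/eqP eyz /eqP exz /eqP exy eG].
apply/negP => te; have := @Gt e eG; move: tE te; rewrite !inE => /or3P[] /eqP -> te [] //; by tauto.
Qed.

(** Once its edges are gone [x] is isolated, and the component returns as a pendant triangle at
    [x]. *)
Lemma triangle_lift u B v C : u \notin [:: x; y; z] -> v \notin [:: x; y; z] ->
  {in B, forall t, t \notin [:: x; y; z]} -> {in C, forall t, t \notin [:: x; y; z]} ->
  P (insert2 G' u B v C) -> P (insert2 G u B v C).
Proof.
move=> uT vT BT CT X.
have isoX t : t \in [:: x; y; z] -> isolated (insert2 G' u B v C) t.
  move=> tT; apply: insert2_isolated; last exact: iso.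
  - by move=> E; rewrite -E tT in uT.
  - by move=> E; rewrite -E tT in vT.
  - by apply/negP => /BT; rewrite tT.
  - by apply/negP => /CT; rewrite tT.
have iy : isolated (insert2 G' u B v C) y by apply: isoX; rewrite !inE eqxx orbT.
have iz : isolated (insert2 G' u B v C) z by apply: isoX; rewrite !inE eqxx !orbT.
apply: (pc_sub hP) (pc_pendant_triangle hP (introN eqP xy) (introN eqP xz) (introN eqP yz) iy iz X).
apply/fintype.subsetP => e /insert2P[->|H|H|[eG eB eC]].
- by do 3!apply: finset.setU1r; apply/insert2P; constructor 1.
- by do 3!apply: finset.setU1r; apply/insert2P; constructor 2.
- by do 3!apply: finset.setU1r; apply/insert2P; constructor 3.
- case: (GE eG) => [->|->|->|eG']; try in_edges.
  by do 3!apply: finset.setU1r; apply/insert2P; constructor 4.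
Qed.

Lemma triangle_root v : v \notin [:: x; y; z] -> P G' ->
  P (insert2 G x [set x]%SET v [set v]%SET).
Proof.
move=> vT PG'; move: (vT); rewrite !inE !negb_or => /and3P[vx vy vz].
have P1 := pc_pendant hP vx (iso (mem_head _ _)) PG'.
have [xy' xz' yz'] : [/\ x != y, x != z & y != z] by split; exact/eqP.
have iy : isolated ([set v; x] |: G')%SET y.
  by rewrite isolatedU1 ?iso// ?inE ?eqxx ?orbT// eq_sym.
have iz : isolated ([set v; x] |: G')%SET z.
  by rewrite isolatedU1 ?iso// ?inE ?eqxx ?orbT// eq_sym.
apply: (pc_sub hP) (pc_pendant_triangle hP xy' xz' yz' iy iz P1).
apply/fintype.subsetP => e.
case/insert2P => [->|[t [/set1P -> //]]|[t [/set1P -> //]]|[eG eB eC]]; first by in_edges.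
case: (GE eG) => [->|->|->|eG']; try in_edges.
Qed.

End TriangleComponent.
End Suppression.

(** * A lower bound on the number of addable edges *)

Section Reduction.
Variables (n : nat) (P : graph n -> Prop) (hP : planar_class P) (G0 : graph n).
Implicit Types (V D : {set 'I_n}) (G E : graph n) (b : 'I_n -> {set 'I_n}).
Implicit Types (u v w x y z : 'I_n) (B C e : {set 'I_n}).

(* [E] collects the edges met during the reduction; pairs in [E] are not claimed to
   be addable. *)
Definition good E u v : bool :=
  [|| u == v, [set u; v]%SET \in E | `[< P ([set u; v] |: G0)%SET >]].

Lemma good_sym E u v : good E u v = good E v u.
Proof. by rewrite /good eq_sym set2C. Qed.

(* [G] on the vertices [V] arises from [G0] by deleting leaves and suppressing vertices
   of degree two; [b u] is the vertex or edge of [G] into which [u] has been absorbed.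
   Vertices outside [D] have been discarded. *)
Record reduction V G b D E : Prop := Reduction {
  rd_VD : (V \subset D)%SET;
  rd_edges : {in G, forall e, #|e| = 2%N /\ (e \subset V)%SET};
  rd_vertex : {in V, forall v, b v = [set v]%SET};
  rd_object : {in D, forall u, (exists2 v, v \in V & b u = [set v]%SET) \/ b u \in G};
  rd_exc : (G \subset E)%SET;
  rd_planar : P G;
  rd_lift : forall u v, u \in D -> v \in D -> u <> v -> b u <> b v ->
    [set u; v]%SET \notin E -> P (insert2 G u (b u) v (b v)) -> P ([set u; v] |: G0)%SET;
  rd_same : forall u v, u \in D -> v \in D -> b u = b v -> good E u v }.

Lemma rd_single V G b D E u v : reduction V G b D E -> u \in D -> b u = [set v]%SET -> u \notin V \/ u = v.
Proof.
move=> rd uD bu; case: (boolP (u \in V)) => [uV|]; [right | by left].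
by apply: finset.set1_inj; rewrite -(rd_vertex rd uV).
Qed.

Lemma rd_edge V G b D E u : reduction V G b D E -> b u \in G -> u \notin V.
Proof.
move=> rd buG; apply/negP => uV; have [] := rd_edges rd buG.
by rewrite (rd_vertex rd uV) cards1.
Qed.

Lemma rd_bag_sub V G b D E u : reduction V G b D E -> u \in D -> (b u \subset V)%SET.
Proof.
move=> rd uD; case: (rd_object rd uD) => [[v vV ->]|/(rd_edges rd)[] //].
by rewrite finset.sub1set.
Qed.

Lemma good_lift V G b D E u v : reduction V G b D E -> u \in D -> v \in D -> b u <> b v ->
  P (insert2 G u (b u) v (b v)) -> good E u v.
Proof.
move=> rd uD vD buv PI; rewrite /good; case: eqP => //= uv.
case: (boolP (_ \in E)) => //= uvE; apply/asboolP; exact: (rd_lift rd).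
Qed.

Section LeafStep.
Variables (V : {set 'I_n}) (G : graph n) (b : 'I_n -> {set 'I_n}) (D : {set 'I_n}) (E : graph n).
Variables (w z : 'I_n).
Hypotheses (rd : reduction V G b D E) (zV : z \in V) (wzG : [set w; z]%SET \in G)
  (Gz : {in G, forall e, z \in e -> e = [set w; z]%SET}).
Let merged := ([set [set z]; [set w; z]])%SET.

(** Whatever was absorbed into [z] or into [wz] moves to [w]. Two vertices with different new bags
    cannot both have moved, so one lifting lemma undoes the step; pairs whose bags become equal are
    handled by the three merge lemmas. *)
Lemma leaf_step : reduction (V :\ z)%SET (G :\ [set w; z])%SET
  (fun u => if b u \in merged then [set w]%SET else b u) D E.
Proof.
have G2 := rd_edges rd.
have wz : w <> z by move=> wz; have [] := G2 _ wzG; rewrite wz finset.setUid cards1.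
have wV : w \in V.
  by have [_ /fintype.subsetP] := G2 _ wzG; apply; rewrite !inE eqxx.
have zD : z \in D := fintype.subsetP (rd_VD rd) z zV.
have bz := rd_vertex rd zV; have bw := rd_vertex rd wV.
have mergedP B : reflect (B = [set z]%SET \/ B = [set w; z]%SET) (B \in merged) by exact: set2P.
have wm : [set w]%SET \notin merged.
  apply/mergedP => -[/finset.set1_inj //|E1].
  by have := G2 _ wzG; rewrite -E1 cards1 => -[].
have nz u : u \in D -> b u \notin merged -> z \notin b u.
  move=> uD; apply: contraNN => zu; apply/mergedP.
  case: (rd_object rd uD) => [[t tV bu]|/Gz/(_ zu)]; last by right.
  by move: zu; rewrite bu => /set1P ->; left.
have zm u : b u \notin merged -> u <> z.
  by move=> + uz; rewrite uz bz => /mergedP; case; left.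
have bag2 u : b u = [set w; z]%SET -> u \notin V.
  by move=> bu; apply: (rd_edge rd); rewrite bu.
set b' := fun u => _.
have lift u v : u \in D -> v \in D -> u <> v -> b' u <> b' v -> b v \notin merged ->
    P (insert2 (G :\ [set w; z])%SET u (b' u) v (b' v)) -> P (insert2 G u (b u) v (b v)).
  rewrite /b' => uD vD uv bb vm; rewrite (negbTE vm) in bb *.
  have vz := zm v vm; have zv := nz v vD vm.
  case: ifP bb => [/mergedP[] bu|/negbT um] bb X; rewrite ?bu.
  - case: (rd_single rd uD bu) => [uV|uz]; last by subst u; exact: (leaf_lift_self hP wz G2).
    apply: (leaf_lift_pendant hP (V := V) wV zV) => // vw; apply: bb; by rewrite vw bw.
  - by apply: (leaf_lift_edge hP (V := V) zV) => //; exact: bag2.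
  - by apply: (leaf_lift_other hP wz) => //; [exact: zm | exact: nz].
split.
- by apply: fintype.subset_trans (rd_VD rd); exact: finset.subD1set.
- move=> e; rewrite in_setD1 => /andP[/eqP ewz eG]; have [e2 /fintype.subsetP eV] := G2 e eG.
  split => //; apply/fintype.subsetP => t te; rewrite in_setD1 (eV t te) andbT.
  by apply/eqP => tz; apply: ewz; apply: Gz => //; rewrite -tz.
- move=> v; rewrite in_setD1 => /andP[/eqP vz vV]; rewrite /b' (rd_vertex rd vV).
  case: ifP => // /mergedP[/finset.set1_inj //|E1].
  by have := G2 _ wzG; rewrite -E1 cards1 => -[].
- move=> u uD; rewrite /b'; case: ifP => [_|/negbT um].
    by left; exists w => //; rewrite in_setD1 wV andbT; apply/eqP.
  case: (rd_object rd uD) => [[t tV bu]|buG].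
    left; exists t => //; rewrite in_setD1 tV andbT; apply: contraNneq um => tz.
    by apply/mergedP; left; rewrite bu tz.
  right; rewrite in_setD1 buG andbT; apply: contraNneq um => ->.
  by apply/mergedP; right.
- by apply: fintype.subset_trans (rd_exc rd); exact: finset.subD1set.
- by apply: (pc_sub hP) (rd_planar rd); exact: finset.subD1set.
- move=> u v uD vD uv bb uvE X.
  have bb' : b u <> b v by move=> E1; apply: bb; rewrite /b' E1.
  apply: (rd_lift rd) => //; case: (boolP (b v \in merged)) => [vm|vm]; last exact: lift.
  rewrite insert2C; apply: lift => //; [exact/nesym | exact/nesym | | by rewrite insert2C].
  by apply/negP => um; apply: bb; rewrite /b' um vm.
- have PG := rd_planar rd.
  have H1 u v : u \in D -> v \in D -> b u = [set w]%SET -> b v = [set z]%SET -> good E u v.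
    move=> uD vD bu bv; apply: (good_lift rd) => //; first by rewrite bu bv => /finset.set1_inj.
    rewrite bu bv; apply: (leaf_merge_ends hP wV zV wz) => //; try exact: (rd_single rd).
    by move=> uv; rewrite uv bv in bu; move: bu => /finset.set1_inj /esym.
  have H2 u v : u \in D -> v \in D -> b u = [set w]%SET -> b v = [set w; z]%SET -> good E u v.
    move=> uD vD bu bv; have vV := bag2 v bv; apply: (good_lift rd) => //.
      by rewrite bu bv => E1; move: wm; rewrite E1 => /mergedP; case; right.
    rewrite bu bv; apply: (leaf_merge_edge_root hP wV zV wz) => //; try exact: (rd_single rd).
    by move=> uv; rewrite uv bv in bu; move: wm; rewrite -bu => /mergedP; case; right.
  have H3 u v : u \in D -> v \in D -> b u = [set z]%SET -> b v = [set w; z]%SET -> good E u v.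
    have zwz : [set z]%SET <> [set w; z]%SET.
      by move=> E1; have := G2 _ wzG; rewrite -E1 cards1 => -[].
    move=> uD vD bu bv; have vV := bag2 v bv; apply: (good_lift rd) => //; first by rewrite bu bv.
    rewrite bu bv; apply: (leaf_merge_edge_tip hP wV zV wz) => //; try exact: (rd_single rd).
    by move=> uv; rewrite uv bv in bu; exact/zwz/esym.
  move=> u v uD vD; rewrite /b'.
  case: ifP => [/mergedP[] bu|um]; case: ifP => [/mergedP[] bv|vm] bb.
  + by apply: (rd_same rd) => //; rewrite bu bv.
  + exact: H3.
  + by rewrite good_sym; exact: H1.
  + by rewrite good_sym; exact: H3.
  + by apply: (rd_same rd) => //; rewrite bu bv.
  + by rewrite good_sym; exact: H2.
  + exact: H1.
  + exact: H2.
  + exact: (rd_same rd).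
Qed.

End LeafStep.

(** [O] lists the objects given up, and the vertices absorbed into them leave [D]; [pairs_drop]
    bounds the loss. Isolated vertices and triangle components are both discarded this way. *)
Lemma drop_step V G b D E (O : {set {set 'I_n}}) V' G' : reduction V G b D E ->
  (V' \subset V)%SET -> {in V, forall v, v \notin V' -> [set v]%SET \in O} ->
  {in V', forall v, [set v]%SET \notin O} -> (G' \subset G)%SET ->
  {in G, forall e, e \notin G' -> e \in O} -> {in G', forall e, (e \subset V')%SET} ->
  (forall u v, u \in D -> v \in D -> b u \notin O -> b v \notin O ->
    P (insert2 G' u (b u) v (b v)) -> P (insert2 G u (b u) v (b v))) ->
  reduction V' G' b [set u in D | b u \notin O]%SET E.
Proof.
move=> rd V'V VO V'O G'G GO G'V lift.
have inD u : u \in [set u in D | b u \notin O]%SET -> u \in D /\ b u \notin O.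
  by rewrite inE => /andP.
split.
- apply/fintype.subsetP => v vV'; rewrite inE.
  have vV := fintype.subsetP V'V v vV'.
  by rewrite (fintype.subsetP (rd_VD rd) v vV) (rd_vertex rd vV) V'O.
- move=> e eG'; have [] := rd_edges rd (fintype.subsetP G'G e eG').
  by split => //; exact: G'V.
- by move=> v /(fintype.subsetP V'V); exact: (rd_vertex rd).
- move=> u /inD[uD uO]; case: (rd_object rd uD) => [[v vV bu]|buG].
    left; exists v => //; apply: contraNT uO => /(VO v vV); by rewrite bu.
  right; apply: contraNT uO; exact: GO.
- exact: fintype.subset_trans (rd_exc rd).
- exact: (pc_sub hP) (rd_planar rd).
- move=> u v /inD[uD uO] /inD[vD vO] uv buv uvE X; apply: (rd_lift rd) => //; exact: lift.
- by move=> u v /inD[uD _] /inD[vD _]; exact: (rd_same rd).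
Qed.

Lemma good_mono E E' u v : (E \subset E')%SET -> good E u v -> good E' u v.
Proof.
by move=> /fintype.subsetP EE; rewrite /good => /or3P[->|/EE ->|->]; rewrite ?orbT.
Qed.

Section SuppressStep.
Variables (V : {set 'I_n}) (G : graph n) (b : 'I_n -> {set 'I_n}) (D : {set 'I_n}) (E : graph n).
Variables (x y z : 'I_n).
Hypotheses (rd : reduction V G b D E) (zV : z \in V) (xy : x <> y)
  (xzG : [set x; z]%SET \in G) (zyG : [set z; y]%SET \in G) (xyG : [set x; y]%SET \notin G)
  (Gz : {in G, forall e, z \in e -> e = [set x; z]%SET \/ e = [set z; y]%SET}).
Let merged := ([set [set z]; [set x; z]; [set z; y]])%SET.

(** The objects [z], [xz] and [zy] become the edge [xy], which held no vertex before since it was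
    not in [G]. So the new bag consists of three old ones, any two of which are joined by a merge
    lemma. *)
Lemma suppress_step : reduction (V :\ z)%SET
  ([set x; y] |: (G :\ [set x; z] :\ [set z; y]))%SET
  (fun u => if b u \in merged then [set x; y]%SET else b u) D ([set x; y] |: E)%SET.
Proof.
set G' := (_ |: _)%SET.
have G2 := rd_edges rd; have PG := rd_planar rd.
have neq2 s t : [set s; t]%SET \in G -> s <> t.
  by move=> stG st; have [] := G2 _ stG; rewrite st finset.setUid cards1.
have xz := neq2 _ _ xzG; have zy := neq2 _ _ zyG; have yz := nesym zy.
have xV : x \in V by have [_ /fintype.subsetP] := G2 _ xzG; apply; rewrite !inE eqxx.
have yV : y \in V by have [_ /fintype.subsetP] := G2 _ zyG; apply; rewrite !inE eqxx orbT.
have zD : z \in D := fintype.subsetP (rd_VD rd) z zV.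
have bz := rd_vertex rd zV.
have mergedP B : reflect [\/ B = [set z]%SET, B = [set x; z]%SET | B = [set z; y]%SET] (B \in merged).
  rewrite !inE; apply: (iffP idP) => [/orP[/orP[]|] /eqP ->|[] ->]; rewrite ?eqxx ?orbT//;
    by [constructor 1 | constructor 2 | constructor 3].
have size1 t e : e \in G -> [set t]%SET <> e.
  by move=> eG E1; have [] := G2 _ eG; rewrite -E1 cards1.
have nxy u : u \in D -> b u <> [set x; y]%SET.
  move=> uD E1; case: (rd_object rd uD) => [[t tV]|buG]; last by move: xyG; rewrite -E1 buG.
  rewrite E1 => E2; have : #|[set x; y]%SET| = 2%N by rewrite cards2; case: eqP.
  by rewrite E2 cards1.
have nz u : u \in D -> b u \notin merged -> z \notin b u.
  move=> uD; apply: contraNN => zu; apply/mergedP.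
  case: (rd_object rd uD) => [[t tV bu]|/Gz/(_ zu)[]]; last 2 first.
  - by constructor 2.
  - by constructor 3.
  by move: zu; rewrite bu => /set1P ->; constructor 1.
have zm u : b u \notin merged -> u <> z.
  by move=> + uz; rewrite uz bz => /mergedP; case; constructor 1.
have bagV u e : e \in G -> b u = e -> u \notin V.
  by move=> eG bu; apply: (rd_edge rd); rewrite bu.
have PG' : P G' by exact: (suppress_planar hP).
have yxG : [set y; x]%SET \notin G by rewrite set2C.
have Gz' : {in G, forall e, z \in e -> e = [set y; z]%SET \/ e = [set z; x]%SET}.
  by move=> e eG /(Gz eG)[->|->]; [right | left]; rewrite set2C.
have G'E : ([set y; x] |: (G :\ [set y; z] :\ [set z; x]))%SET = G'.
  rewrite (set2C y x) (set2C y z) (set2C z x) /G'; congr (_ |: _)%SET.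
  by apply/setP => e; rewrite !in_setD1 andbCA.
set b' := fun u => _.
have lift u v : u \in D -> v \in D -> u <> v -> b' u <> b' v -> b v \notin merged ->
    [set u; v]%SET \notin ([set x; y] |: E)%SET ->
    P (insert2 G' u (b' u) v (b' v)) -> P (insert2 G u (b u) v (b v)).
  rewrite /b' => uD vD uv bb vm uvE; rewrite (negbTE vm) in bb *.
  have vz := zm v vm; have zv := nz v vD vm; have vC := rd_vertex rd (x := v).
  have ub : u \notin V -> u \notin b v.
    by apply: contraNN => /(fintype.subsetP (rd_bag_sub rd vD)).
  case: ifP bb => [/mergedP[] bu|/negbT um] bb X; rewrite ?bu.
  - case: (rd_single rd uD bu) => [uV|uz].
      by apply: (suppress_lift_pendant hP (V := V) (x := x) (y := y)) => //; exact: ub.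
    by subst u; exact: (suppress_lift_self hP xz yz xyG Gz zv vz X).
  - have uV := bagV u _ xzG bu.
    by apply: (suppress_lift_edge hP (V := V) (x := x) (y := y)) => //; exact: ub.
  - have uV := bagV u _ zyG bu; rewrite set2C.
    apply: (suppress_lift_edge hP (V := V) (x := y) (y := x)) => //; rewrite ?G'E//.
    + exact/nesym.
    + exact: ub.
    + by rewrite (set2C y x).
  - apply: (suppress_lift_other hP xV yV xz yz) => //; try exact: nxy.
    + exact: zm.
    + exact: nz.
    + by move=> E1; move: uvE; rewrite E1 finset.setU11.
    + exact: (rd_vertex rd).
split.
- by apply: fintype.subset_trans (rd_VD rd); exact: finset.subD1set.
- move=> e; rewrite in_setU1 => /orP[/eqP ->|].
    rewrite cards2; split; first by case: eqP.
    by apply/fintype.subsetP => t /set2P[] ->; rewrite in_setD1 ?xV ?yV andbT; apply/eqP.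
  rewrite !in_setD1 => /and3P[/eqP ezy /eqP exz eG]; have [e2 /fintype.subsetP eV] := G2 e eG.
  split => //; apply/fintype.subsetP => t te; rewrite in_setD1 (eV t te) andbT.
  by apply/eqP => tz; case: (Gz eG) => //; rewrite -tz.
- move=> v; rewrite in_setD1 => /andP[/eqP vz vV]; rewrite /b' (rd_vertex rd vV).
  by case: ifP => // /mergedP[/finset.set1_inj //|/(size1 _ _ xzG)|/(size1 _ _ zyG)].
- move=> u uD; rewrite /b'; case: ifP => [_|/negbT um]; first by right; exact: finset.setU11.
  case: (rd_object rd uD) => [[t tV bu]|buG].
    left; exists t => //; rewrite in_setD1 tV andbT; apply: contraNneq um => tz.
    by apply/mergedP; constructor 1; rewrite bu tz.
  right; apply: finset.setU1r; rewrite !in_setD1 buG andbT; apply/andP; split.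
    by apply: contraNneq um => ->; apply/mergedP; constructor 3.
  by apply: contraNneq um => ->; apply/mergedP; constructor 2.
- apply: finset.setUS; apply: fintype.subset_trans (rd_exc rd).
  by apply/fintype.subsetP => e; rewrite !in_setD1 => /and3P[].
- exact: PG'.
- move=> u v uD vD uv bb uvE X.
  have bb' : b u <> b v by move=> E1; apply: bb; rewrite /b' E1.
  apply: (rd_lift rd) => //; first by apply: contraNN uvE => uvE; exact: finset.setU1r.
  case: (boolP (b v \in merged)) => [vm|vm]; last exact: lift.
  rewrite insert2C; apply: lift => //; [exact/nesym | exact/nesym | | by rewrite set2C | by rewrite insert2C].
  by apply/negP => um; apply: bb; rewrite /b' um vm.
- have H1 u v : u \in D -> v \in D -> b u = [set z]%SET -> b v = [set x; z]%SET -> good E u v.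
    move=> uD vD bu bv; have vV := bagV v _ xzG bv; apply: (good_lift rd) => //.
      by rewrite bu bv; exact: size1.
    rewrite bu bv; apply: (suppress_merge_edge hP (V := V)) => //; first exact: (rd_single rd).
    by move=> uv; rewrite uv bv in bu; exact: (size1 _ _ xzG (esym bu)).
  have H2 u v : u \in D -> v \in D -> b u = [set z]%SET -> b v = [set z; y]%SET -> good E u v.
    move=> uD vD bu bv; have vV := bagV v _ zyG bv; apply: (good_lift rd) => //.
      by rewrite bu bv; exact: size1.
    rewrite bu bv [X in insert2 _ _ _ _ X]set2C; apply: (suppress_merge_edge hP (V := V)) => //.
    + by rewrite set2C.
    + exact: (rd_single rd).
    + by move=> uv; rewrite uv bv in bu; exact: (size1 _ _ zyG (esym bu)).
  have xzzy : [set x; z]%SET <> [set z; y]%SET by rewrite set2C => /set2_inj.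
  have H3 u v : u \in D -> v \in D -> b u = [set x; z]%SET -> b v = [set z; y]%SET -> good E u v.
    move=> uD vD bu bv; have vV := bagV v _ zyG bv; have uV := bagV u _ xzG bu.
    apply: (good_lift rd) => //; first by rewrite bu bv.
    rewrite bu bv; apply: (suppress_merge_edges hP (V := V) (y := y)) => //.
    by move=> uv; rewrite uv bv in bu; exact/xzzy/esym.
  move=> u v uD vD bb; apply: (good_mono (E := E)); first exact: finset.subsetUr.
  move: bb; rewrite /b'.
  case: ifP => [/mergedP[] bu|um]; case: ifP => [/mergedP[] bv|vm] bb; last exact: (rd_same rd).
  + by apply: (rd_same rd) => //; rewrite bu bv.
  + exact: H1.
  + exact: H2.
  + by case: (nxy v vD).
  + by rewrite good_sym; exact: H1.
  + by apply: (rd_same rd) => //; rewrite bu bv.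
  + exact: H3.
  + by case: (nxy v vD).
  + by rewrite good_sym; exact: H2.
  + by rewrite good_sym; exact: H3.
  + by apply: (rd_same rd) => //; rewrite bu bv.
  + by case: (nxy v vD).
  + by case: (nxy u uD).
  + by case: (nxy u uD).
  + by case: (nxy u uD).
Qed.

End SuppressStep.
End Reduction.

(** * Counting good pairs along the reduction *)

Section Arithmetic.
Implicit Types q L d v g s p o : nat.

(** The 18 pays for the 17 of the vertex that disappears and for one discarded object. *)
Lemma drop_arith1 q L d d' v g s p p' :
  (2 * L * d + p' <= p + q * 1 + 2 * L * d')%N ->
  (2 * L * d' + 17 * (q * v) <= p' + q * (17 * g + 18 * s))%N ->
  (2 * L * d + 17 * (q * v.+1) <= p + q * (17 * g + 18 * (true + s)))%N.
Proof. by rewrite add1n; lia. Qed.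

(** Three vertices and three edges disappear and cancel, so the 18 only has to cover the discarded
    objects of a triangle. *)
Lemma drop_arith3 q L d d' v g s p p' o : (o <= 6)%N ->
  (2 * L * d + p' <= p + q * o + 2 * L * d')%N ->
  (2 * L * d' + 17 * (q * v) <= p' + q * (17 * g + 18 * s))%N ->
  (2 * L * d + 17 * (q * (3 + v)) <= p + q * (17 * (3 + g) + 18 * (true + s)))%N.
Proof.
rewrite add1n => o6; have : (q * o <= q * 6)%N by rewrite leq_mul2l o6 orbT.
lia.
Qed.

Lemma remove_arith q a v g s p :
  (a + 17 * (q * v) <= p + q * (17 * g + 18 * s))%N ->
  (a + 17 * (q * v.+1) <= p + q * (17 * (true + g) + 18 * s))%N.
Proof. by rewrite add1n; lia. Qed.

(** The origin of the 17: [9 v <= 8 g] says exactly [v + g <= 17 (g - v)]. *)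
Lemma terminal_arith q L d v g p o : (o <= v + g)%N -> (9 * v <= 8 * g)%N ->
  (2 * L * d + 0 <= p + q * o + 2 * L * 0)%N ->
  (2 * L * d + 17 * (q * v) <= p + q * (17 * g + 18 * 0))%N.
Proof.
move=> og vg; have : (q * o <= q * (v + g))%N by rewrite leq_mul2l og orbT.
have : (q * (9 * v) <= q * (8 * g))%N by rewrite leq_mul2l vg orbT.
lia.
Qed.

Lemma add3_leq v k : (3 + v <= k.+1)%N -> (v <= k)%N.
Proof. lia. Qed.

End Arithmetic.

Section Counting.
Variables (n : nat) (P : graph n -> Prop) (hP : planar_class P) (G0 : graph n).
Implicit Types (V D S : {set 'I_n}) (G E F : graph n) (b : 'I_n -> {set 'I_n}).
Implicit Types (u v w x y z : 'I_n) (B C e f : {set 'I_n}).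

Definition incident G v : {set {set 'I_n}} := [set e in G | v \in e]%SET.

Lemma sum_incident G D : {in G, forall e, (e \subset D)%SET} ->
  (\sum_(v in D) #|incident G v| = \sum_(e in G) #|e|)%N.
Proof.
move=> GD; rewrite (eq_bigr (fun v => \sum_(e in G) (v \in e : nat))%N); last first.
  move=> v _; rewrite -sum1_card big_mkcond [RHS]big_mkcond /=; apply: eq_bigr => e _.
  by rewrite inE; case: (e \in G); case: (v \in e).
rewrite exchange_big /=; apply: eq_bigr => e eG; rewrite -sum1_card.
rewrite big_mkcond [RHS]big_mkcond /=; apply: eq_bigr => v _.
case: (boolP (v \in e)) => [/(fintype.subsetP (GD e eG)) ->//|_]; by case: ifP.
Qed.

Lemma card_neighbours G v : (#|[set u | [set u; v]%SET \in G]%SET| <= #|incident G v|)%N.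
Proof.
rewrite -(card_in_imset (f := fun u => [set u; v]%SET)); last first.
  by move=> u w _ _; rewrite set2C (set2C w) => /set2_inj.
apply: subset_leq_card; apply/fintype.subsetP => e /imsetP[u]; rewrite !inE => uG ->.
by rewrite uG !inE eqxx orbT.
Qed.

Lemma card2_end e z : #|e| = 2%N -> z \in e -> exists2 x, x <> z & e = [set x; z]%SET.
Proof.
move=> /eqP/cards2P[x [y [xy ->]]] /set2P[] ->; last by exists x => //; apply/eqP.
by exists y; [apply/eqP; rewrite eq_sym | rewrite set2C].
Qed.

Definition pairs E D := (\sum_(u in D) #|[set v in D | good P G0 E u v]%SET|)%N.

(** A bag of size [s] contains [s ^ 2] good pairs, and [2 L s <= s ^ 2 + L ^ 2]. So each discarded
    vertex earns [2 L] good pairs, up to a debt of [L ^ 2] for each discarded object. *)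
Lemma pairs_drop b D E L (O : {set {set 'I_n}}) :
  (forall u v, u \in D -> v \in D -> b u = b v -> good P G0 E u v) ->
  (2 * L * #|D| + pairs E [set u in D | b u \notin O]%SET <=
   pairs E D + L ^ 2 * #|O| + 2 * L * #|[set u in D | b u \notin O]%SET|)%N.
Proof.
move=> same; set D' := [set u in D | b u \notin O]%SET.
pose B o := [set u in D | b u == o]%SET.
have D'D : (D' \subset D)%SET by apply/fintype.subsetP => u; rewrite inE => /andP[].
have split_card : #|D| = (#|D'| + \sum_(o in O) #|B o|)%N.
  rewrite -(cardsID [set u | b u \notin O]%SET D); congr (_ + _)%N.
    by apply: eq_card => u; rewrite !inE andbC.
  rewrite -sum1_card (partition_big b (mem O)) /=.
    apply: eq_bigr => o oO; rewrite -sum1_card; apply: eq_bigl => u.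
    rewrite !inE negbK; case: eqP => [->|]; rewrite ?andbF//.
    by move: oO => /= ->; rewrite !andbT.
  by move=> u; rewrite !inE negbK => /andP[].
have split_pairs : (pairs E D' + \sum_(o in O) #|B o| ^ 2 <= pairs E D)%N.
  rewrite /pairs [X in (_ <= X)%N](bigID (fun u => b u \notin O)) /= leq_add//.
    rewrite [X in (_ <= X)%N](eq_bigl (mem D')); last by move=> u; rewrite !inE.
    apply: leq_sum => u uD'; apply: subset_leq_card; apply/fintype.subsetP => v.
    by rewrite !inE => /andP[/andP[-> _] ->].
  rewrite (partition_big b (mem O)) /=; last by move=> u; rewrite negbK => /andP[].
  apply: leq_sum => o oO; rewrite expnS expn1 -sum_nat_const.
  rewrite [X in (_ <= X)%N](eq_bigl (mem (B o))); last first.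
    move=> u; rewrite !inE negbK; case: eqP => [->|]; rewrite ?andbF//.
    by move: oO => /= ->; rewrite !andbT.
  apply: leq_sum => u; rewrite inE => /andP[uD /eqP bu].
  apply: subset_leq_card; apply/fintype.subsetP => v; rewrite !inE => /andP[vD /eqP bv].
  by rewrite vD same// bu bv.
have amgm : (2 * L * \sum_(o in O) #|B o| <= \sum_(o in O) #|B o| ^ 2 + L ^ 2 * #|O|)%N.
  rewrite big_distrr /= [X in (_ <= _ + X)%N]mulnC -sum_nat_const -big_split /=; apply: leq_sum => o _.
  by have [H _] := nat_Cauchy L #|B o|; rewrite -mulnA addnC.
by rewrite split_card; lia.
Qed.

(** Let [n2] and [n3] count the vertices of degree two and of larger degree, and let [s3] be the
    degree sum of the latter. Then [2 |G| = 2 n2 + s3] and [3 n3 <= s3]; mapping each vertex of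
    degree two to a neighbour of larger degree gives [n2 <= s3]. The bound combines these. *)
Lemma dense_count V G : {in G, forall e, #|e| = 2%N /\ (e \subset V)%SET} ->
  {in V, forall v, (2 <= #|incident G v|)%N} ->
  {in V, forall v, #|incident G v| = 2%N ->
    exists2 x, x \in V & [set v; x]%SET \in G /\ (2 < #|incident G x|)%N} ->
  (9 * #|V| <= 8 * #|G|)%N.
Proof.
move=> G2 deg2 nb; pose V3 := [set v in V | (2 < #|incident G v|)%N]%SET.
pose s3 := (\sum_(v in V3) #|incident G v|)%N.
have V3V v : v \in V3 -> v \in V by rewrite inE => /andP[].
have hand : (2 * #|G| = 2 * #|V :\: V3|%SET + s3)%N.
  have <- : (\sum_(e in G) #|e| = 2 * #|G|)%N.
    by rewrite mulnC -sum_nat_const; apply: eq_bigr => e /G2[].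
  rewrite -(sum_incident (D := V)); last by move=> e /G2[].
  rewrite (bigID (mem V3)) /= addnC; congr (_ + _)%N.
    rewrite mulnC -sum_nat_const; apply: eq_big => [v|v /andP[vV]]; first by rewrite !inE andbC.
    by rewrite inE vV /= -leqNgt => v2; apply/eqP; rewrite eqn_leq v2 deg2.
  by apply: eq_bigl => v; rewrite !inE; case: (v \in V).
have c3 : (3 * #|V3| <= s3)%N.
  by rewrite mulnC -sum_nat_const; apply: leq_sum => v; rewrite inE => /andP[].
have c2 : (#|V :\: V3|%SET <= s3)%N.
  have sub : (V :\: V3 \subset \bigcup_(x in V3) [set u | [set u; x]%SET \in G])%SET.
    apply/fintype.subsetP => v; rewrite inE => /andP[vV3 vV].
    have v2 : #|incident G v| = 2%N.
      by apply/eqP; rewrite eqn_leq deg2// andbT leqNgt; apply: contra vV3 => ?; rewrite inE vV.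
    have [x xV [vx x3]] := nb v vV v2; apply/bigcupP; exists x; first by rewrite inE xV.
    by rewrite inE.
  apply: leq_trans (subset_leq_card sub) _; rewrite /s3.
  elim/big_rec2: _ => [|x k U _ IH]; first by rewrite cards0.
  by apply: leq_trans (leq_card_setU _ _) _; rewrite leq_add ?card_neighbours.
have cV : #|V| = (#|V :\: V3|%SET + #|V3|)%N.
  rewrite addnC -(cardsID V3 V); congr (_ + _)%N.
  by apply: eq_card => v; rewrite !inE; case: (v \in V).
lia.
Qed.

Definition triangle_objects x y z : {set {set 'I_n}} :=
  [set o in [:: [set x]; [set y]; [set z]; [set x; y]; [set x; z]; [set y; z]]]%SET.

Lemma triangle_objects_card x y z : (#|triangle_objects x y z| <= 6)%N.
Proof. by rewrite /triangle_objects cardsE; apply: leq_trans (card_size _) _. Qed.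

Section TriangleStep.
Variables (V : {set 'I_n}) (G : graph n) (b : 'I_n -> {set 'I_n}) (D : {set 'I_n}) (E : graph n).
Variables (x y z : 'I_n).
Hypotheses (rd : reduction P G0 V G b D E) (xy : x <> y) (xz : x <> z) (yz : y <> z)
  (xyG : [set x; y]%SET \in G) (xzG : [set x; z]%SET \in G) (yzG : [set y; z]%SET \in G)
  (Gt : {in G, forall e, x \in e \/ y \in e \/ z \in e ->
    [\/ e = [set x; y]%SET, e = [set x; z]%SET | e = [set y; z]%SET]}).

Lemma triangle_edges_card :
  #|G| = (3 + #|(G :\ [set x; y] :\ [set x; z] :\ [set y; z])%SET|)%N.
Proof.
have n1 : [set x; z]%SET != [set x; y]%SET by apply/eqP => /set2_inj /esym.
have n2 : [set y; z]%SET != [set x; z]%SET.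
  by apply/eqP; rewrite set2C [RHS]set2C => /set2_inj /esym.
have n3 : [set y; z]%SET != [set x; y]%SET by apply/eqP; rewrite [RHS]set2C => /set2_inj /esym.
rewrite (cardsD1 [set x; y]%SET G) xyG (cardsD1 [set x; z]%SET (G :\ _)) in_setD1 n1 xzG.
by rewrite (cardsD1 [set y; z]%SET (_ :\ _ :\ _)) !in_setD1 n2 n3 yzG.
Qed.

Lemma triangle_step : reduction P G0 (V :\: (x |: (y |: [set z])))%SET
  (G :\ [set x; y] :\ [set x; z] :\ [set y; z])%SET b
  [set u in D | b u \notin triangle_objects x y z]%SET E.
Proof.
have G2 := rd_edges rd.
have inT t : (t \in x |: (y |: [set z]))%SET = (t \in [:: x; y; z]) by rewrite !inE.
have bagT u : u \in D -> b u \notin triangle_objects x y z ->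
    u \notin [:: x; y; z] /\ {in b u, forall t, t \notin [:: x; y; z]}.
  move=> uD; rewrite inE => uO; split.
    apply: contra uO => uT; suff -> : b u = [set u]%SET.
      by move: uT; rewrite !inE => /or3P[] /eqP ->; rewrite eqxx ?orbT.
    apply: (rd_vertex rd); move: uT; rewrite !inE => /or3P[] /eqP ->.
    - by have [_ /fintype.subsetP] := G2 _ xyG; apply; rewrite !inE eqxx.
    - by have [_ /fintype.subsetP] := G2 _ xyG; apply; rewrite !inE eqxx orbT.
    - by have [_ /fintype.subsetP] := G2 _ xzG; apply; rewrite !inE eqxx orbT.
  move=> t tb; apply: contra uO => tT.
  case: (rd_object rd uD) => [[s _ bu]|buG].
    move: tb; rewrite bu => /set1P ts; move: tT; rewrite ts !inE => /or3P[] /eqP ->;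
    by rewrite eqxx ?orbT.
  have : x \in b u \/ y \in b u \/ z \in b u.
    by move: tT; rewrite !inE => /or3P[] /eqP <-; tauto.
  by move=> /(Gt buG)[] ->; rewrite !inE eqxx ?orbT.
apply: (drop_step hP rd).
- exact: finset.subsetDl.
- move=> v vV; rewrite finset.in_setD vV andbT negbK inT !inE => /or3P[] /eqP ->; by rewrite eqxx ?orbT.
- move=> v; rewrite finset.in_setD inT => /andP[vT vV]; apply: contra vT; rewrite inE.
  have sz s t : [set s; t]%SET \in G -> [set v]%SET == [set s; t]%SET = false.
    by move=> /G2[st2 _]; apply/eqP => E1; rewrite -E1 cards1 in st2.
  rewrite !in_cons in_nil (sz _ _ xyG) (sz _ _ xzG) (sz _ _ yzG) !orbF => /or3P[] /eqP/finset.set1_inj ->;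
  by rewrite ?in_cons ?eqxx ?orbT.
- by apply/fintype.subsetP => e; rewrite !in_setD1 => /and4P[].
- move=> e eG; rewrite !in_setD1 eG andbT !negb_and !negbK !inE => /or3P[] /eqP ->;
  by rewrite eqxx ?orbT.
- move=> e; rewrite !in_setD1 => /and4P[/eqP eyz /eqP exz /eqP exy eG].
  have [_ /fintype.subsetP eV] := G2 e eG; apply/fintype.subsetP => t te.
  rewrite finset.in_setD inT eV// andbT; apply/negP => tT.
  have : x \in e \/ y \in e \/ z \in e.
    by move: tT; rewrite !inE => /or3P[] /eqP <-; tauto.
  by case/(Gt eG).
- move=> u v uD vD uO vO; have [uT bT] := bagT u uD uO; have [vT bT'] := bagT v vD vO.
  exact: (triangle_lift hP).
Qed.

End TriangleStep.

Variable L : nat.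

(** Every vertex earns [2 L] good pairs up to a debt of [L ^ 2] times [17 (|G| - |V|) + 18 |S|].
    Deleting a leaf or suppressing a vertex preserves [|G| - |V|]. [S] has one representative of
    each discarded component, and representatives of different components can be joined. Each
    suppression adds at most one exception to [E]. *)
Lemma reduction_count k V G b D E : (#|V| <= k)%N -> reduction P G0 V G b D E ->
  exists S E', [/\ (S \subset V)%SET, (E \subset E')%SET, (#|E'| <= #|E| + #|V|)%N,
    {in S &, forall u v, good P G0 E' u v} &
    (2 * L * #|D| + 17 * (L ^ 2 * #|V|) <= pairs E' D + L ^ 2 * (17 * #|G| + 18 * #|S|))%N].
Proof.
elim: k V G b D E => [|k IH] V G b D E Vk rd; set q := (L ^ 2)%N.
  have V0 : V = finset.set0 by apply/eqP; rewrite -cards_eq0 -leqn0.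
  have D0 : D = finset.set0.
    apply/setP => u; rewrite inE; apply/negP => uD; case: (rd_object rd uD) => [[v]|].
      by rewrite V0 inE.
    by case/(rd_edges rd); rewrite V0 finset.subset0 => + /eqP u0; rewrite u0 cards0.
  exists finset.set0, E; split => //; rewrite ?finset.sub0set ?leq_addr//.
    by move=> u v; rewrite inE.
  by rewrite V0 D0 !cards0 !muln0.
have G2 := rd_edges rd.
have incP z e : e \in incident G z -> e \in G /\ z \in e by rewrite inE => /andP.
have Vcard z : z \in V -> #|V| = (#|(V :\ z)%SET|).+1 by move=> zV; rewrite (cardsD1 z V) zV.
have inV e t : e \in G -> t \in e -> t \in V by move=> /G2[_ /fintype.subsetP eV] /eV.
have same E' : (E \subset E')%SET -> forall u v, u \in D -> v \in D -> b u = b v -> good P G0 E' u v.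
  by move=> EE u v uD vD /(rd_same rd uD vD); exact: good_mono.
(* An isolated vertex is discarded and represents itself in [S]. *)
case: (boolP [exists z in V, incident G z == finset.set0]) => [/exists_inP[z zV /eqP z0]|no0].
  have nz e : e \in G -> z \notin e.
    by move=> eG; apply/negP => ze; have : e \in incident G z by [rewrite inE eG]; rewrite z0 inE.
  have rd' : reduction P G0 (V :\ z)%SET G b [set u in D | b u \notin [set [set z]]]%SET E.
    apply: (drop_step hP rd) => //.
    - exact: finset.subD1set.
    - by move=> v vV; rewrite in_setD1 vV andbT negbK => /eqP ->; rewrite inE.
    - by move=> v; rewrite in_setD1 => /andP[vz _]; rewrite inE; apply: contra vz => /eqP/finset.set1_inj ->.
    - by move=> e ->.
    - move=> e eG; apply/fintype.subsetP => t te; rewrite in_setD1 (inV e t eG te) andbT.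
      by apply: contraNneq (nz e eG) => <-.
  have [|S [E' [SV EE E'c Sgood cnt]]] := IH _ _ _ _ _ _ rd'; first by rewrite -ltnS -Vcard.
  have zS : z \notin S by apply/negP => /(fintype.subsetP SV); rewrite !inE eqxx.
  have zgood v : v \in S -> good P G0 E' z v.
    move=> /(fintype.subsetP SV); rewrite in_setD1 => /andP[vz vV].
    apply: (good_mono EE); have subD := fintype.subsetP (rd_VD rd).
    have [bz bv] : b z = [set z]%SET /\ b v = [set v]%SET by split; exact: (rd_vertex rd).
    apply: (good_lift rd); rewrite ?subD// bz bv.
      by move=> /finset.set1_inj zv; rewrite zv eqxx in vz.
    have iz : isolated G z by apply/isolatedP.
    apply: (pc_sub hP) (pc_pendant hP vz iz (rd_planar rd)); apply/fintype.subsetP => e.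
    by case/insert2P => [->|[t [/set1P -> //]]|[t [/set1P -> //]]|[eG _ _]]; in_edges.
  exists (z |: S)%SET, E'; split => //.
  - by rewrite finset.subUset finset.sub1set zV (fintype.subset_trans SV)// finset.subD1set.
  - by apply: leq_trans E'c _; rewrite leq_add2l subset_leq_card// finset.subD1set.
  - move=> u v /setU1P[->|uS] /setU1P[->|vS]; [by rewrite /good eqxx | exact: zgood | | exact: Sgood].
    by rewrite good_sym; exact: zgood.
  - have := pairs_drop L [set [set z]]%SET (same E' EE).
    rewrite cards1 (Vcard z zV) cardsU1 zS => drop; exact: (drop_arith1 drop cnt).
case: (boolP [exists z in V, #|incident G z| == 1%N]) => [/exists_inP[z zV /cards1P[e ze]]|no1].
  have [eG zie] : e \in G /\ z \in e by apply: incP; rewrite ze inE.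
  have [w wz eE] := card2_end (G2 e eG).1 zie; rewrite eE in eG ze.
  have Gz : {in G, forall f, z \in f -> f = [set w; z]%SET}.
    by move=> f fG zf; have : f \in incident G z by [rewrite inE fG]; rewrite ze inE => /eqP.
  have rd' := leaf_step hP rd zV eG Gz.
  have [|S [E' [SV EE E'c Sgood cnt]]] := IH _ _ _ _ _ _ rd'; first by rewrite -ltnS -Vcard.
  exists S, E'; split => //; first by rewrite (fintype.subset_trans SV)// finset.subD1set.
  - by apply: leq_trans E'c _; rewrite leq_add2l subset_leq_card// finset.subD1set.
  - by rewrite (Vcard z zV) (cardsD1 [set w; z]%SET G) eG; exact: remove_arith cnt.
have deg2 v : v \in V -> (2 <= #|incident G v|)%N.
  move=> vV; rewrite ltn_neqAle eq_sym lt0n cards_eq0.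
  by rewrite (exists_inPn no1 v vV) (exists_inPn no0 v vV).
have two z : z \in V -> #|incident G z| = 2%N -> exists x y,
    [/\ x <> y, [set x; z]%SET \in G, [set z; y]%SET \in G &
      {in G, forall e, z \in e -> e = [set x; z]%SET \/ e = [set z; y]%SET}].
  move=> zV /eqP/cards2P[e [f [ef inc]]].
  have [eG ze] : e \in G /\ z \in e by apply: incP; rewrite inc !inE eqxx.
  have [fG zf] : f \in G /\ z \in f by apply: incP; rewrite inc !inE eqxx orbT.
  have [x xz eE] := card2_end (G2 e eG).1 ze; have [y yz fE] := card2_end (G2 f fG).1 zf.
  exists x, y; rewrite (set2C z y) -eE -fE; split => //.
    by move=> xy; move: ef; rewrite eE fE xy eqxx.
  by move=> g gG zg; have : g \in incident G z by [rewrite inE gG]; rewrite inc => /set2P.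
case: (boolP [exists z in V, exists x, exists y, [&& x != y, [set x; z]%SET \in G,
    [set z; y]%SET \in G, [set x; y]%SET \notin G & #|incident G z| == 2%N]]).
  move=> /exists_inP[z zV /existsP[x /existsP[y /and5P[xy xzG zyG xyG /eqP z2]]]].
  have xzzy : [set x; z]%SET <> [set z; y]%SET.
    by rewrite (set2C z) set2C [RHS]set2C => /set2_inj /eqP; exact/negP.
  have inc : incident G z = [set [set x; z]; [set z; y]]%SET.
    apply/esym/eqP; rewrite eqEcard z2 cards2; apply/andP; split; last by case: eqP.
    by apply/fintype.subsetP => e /set2P[] ->; rewrite !inE ?xzG ?zyG ?eqxx ?orbT.
  have Gz : {in G, forall e, z \in e -> e = [set x; z]%SET \/ e = [set z; y]%SET}.
    by move=> g gG zg; have : g \in incident G z by [rewrite inE gG]; rewrite inc => /set2P.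
  have rd' := suppress_step hP rd zV (elimN eqP xy) xzG zyG xyG Gz.
  have [|S [E' [SV EE E'c Sgood cnt]]] := IH _ _ _ _ _ _ rd'; first by rewrite -ltnS -Vcard.
  exists S, E'; split => //; first by rewrite (fintype.subset_trans SV)// finset.subD1set.
  - by apply: fintype.subset_trans EE; exact: finset.subsetUr.
  - by move: E'c; rewrite (Vcard z zV) cardsU1; case: (_ \notin _); lia.
  - rewrite (Vcard z zV) (cardsD1 [set x; z]%SET G) xzG.
    rewrite (cardsD1 [set z; y]%SET (G :\ _)) in_setD1 zyG.
    have -> : ([set z; y]%SET != [set x; z]%SET) by apply/eqP/nesym.
    by move: cnt; rewrite cardsU1 !in_setD1 (negbTE xyG) !andbF; exact: remove_arith.
move=> nosup.
have nosupP z x y : z \in V -> x <> y -> [set x; z]%SET \in G -> [set z; y]%SET \in G ->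
    #|incident G z| = 2%N -> [set x; y]%SET \in G.
  move=> zV /eqP xy xzG zyG z2; apply/negPn/negP => xyG; case/negP: nosup.
  apply/exists_inP; exists z => //; apply/existsP; exists x; apply/existsP; exists y.
  by rewrite xy xzG zyG xyG z2.
(* A triangle with all degrees equal to two is a component; it is discarded and [x] represents
   it. *)
case: (boolP [exists z in V, exists x, exists y, [&& x != y, [set x; z]%SET \in G,
    [set z; y]%SET \in G, [set x; y]%SET \in G &
    [&& #|incident G z| == 2%N, #|incident G x| == 2%N & #|incident G y| == 2%N]]]).
  move=> /exists_inP[z zV /existsP[x /existsP[y /and5P[xy xzG]]]].
  rewrite (set2C z y) => yzG xyG /and3P[/eqP z2 /eqP x2 /eqP y2].
  have neq2 s t : [set s; t]%SET \in G -> s != t.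
    by move=> /G2[+ _]; rewrite cards2; case: eqP.
  have [xz yz] := (neq2 _ _ xzG, neq2 _ _ yzG).
  have inc s t r : s != t -> s != r -> t != r -> #|incident G s| = 2%N ->
      [set s; t]%SET \in G -> [set s; r]%SET \in G -> {in G, forall e, s \in e -> e = [set s; t]%SET \/ e = [set s; r]%SET}.
    move=> st sr tr s2 stG srG e eG se.
    have ne : [set s; t]%SET != [set s; r]%SET by apply: contra tr => /eqP/set2_inj ->.
    have iE : incident G s = [set [set s; t]; [set s; r]]%SET.
      apply/esym/eqP; rewrite eqEcard s2 cards2 ne andbT.
      by apply/fintype.subsetP => f /set2P[] ->; rewrite inE ?stG ?srG !inE eqxx.
    by have : e \in incident G s by [rewrite inE eG]; rewrite iE => /set2P.
  have Gt : {in G, forall e, x \in e \/ y \in e \/ z \in e ->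
      [\/ e = [set x; y]%SET, e = [set x; z]%SET | e = [set y; z]%SET]}.
    move=> e eG [xe|[ye|ze]].
    - by case: (inc x y z xy xz yz x2 xyG xzG e eG xe); [constructor 1 | constructor 2].
    - have yxG : [set y; x]%SET \in G by rewrite set2C.
      case: (inc y x z _ yz xz y2 yxG yzG e eG ye); rewrite ?(set2C y x) 1?eq_sym//; by [constructor 1 | constructor 3].
    - have [zxG zyG] : [set z; x]%SET \in G /\ [set z; y]%SET \in G by rewrite !(set2C z).
      case: (inc z x y _ _ xy z2 zxG zyG e eG ze); rewrite ?(set2C z) 1?eq_sym//; by [constructor 2 | constructor 3].
  have [xV yV] : x \in V /\ y \in V by split; apply: (inV _ _ xyG); rewrite !inE eqxx ?orbT.
  have rd' := triangle_step rd (elimN eqP xy) (elimN eqP xz) (elimN eqP yz) xyG xzG yzG Gt.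
  have xyzV : (x |: (y |: [set z]) \subset V)%SET by rewrite !finset.subUset !finset.sub1set xV yV zV.
  have xyz3 : #|(x |: (y |: [set z]))%SET| = 3%N.
    by rewrite !cardsU1 cards1 !inE negb_or xy xz yz.
  have V3 : #|V| = (3 + #|V :\: (x |: (y |: [set z]))|%SET)%N.
    by rewrite -xyz3 -(cardsID (x |: (y |: [set z]))%SET V) (finset.setIidPr xyzV).
  have [|S [E' [SV EE E'c Sgood cnt]]] := IH _ _ _ _ _ _ rd'.
    by move: Vk; rewrite V3; exact: add3_leq.
  have SV' v : v \in S -> v \in V /\ v \notin [:: x; y; z].
    by move=> /(fintype.subsetP SV); rewrite !inE => /andP[? ->].
  have xS : x \notin S by apply/negP => /SV'[_]; rewrite !inE eqxx.
  have xgood v : v \in S -> good P G0 E' x v.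
    move=> /SV'[vV vT]; apply: (good_mono EE); have subD := fintype.subsetP (rd_VD rd).
    have [bx bv] : b x = [set x]%SET /\ b v = [set v]%SET by split; exact: (rd_vertex rd).
    apply: (good_lift rd); rewrite ?subD// bx bv.
      by move=> /finset.set1_inj xv; rewrite -xv !inE eqxx in vT.
    by apply: (triangle_root hP _ _ _ Gt) (rd_planar rd'); rewrite //; exact/eqP.
  exists (x |: S)%SET, E'; split => //.
  - by rewrite finset.subUset finset.sub1set xV (fintype.subset_trans SV)// finset.subsetDl.
  - by apply: leq_trans E'c _; rewrite leq_add2l subset_leq_card// finset.subsetDl.
  - move=> u v /setU1P[->|uS] /setU1P[->|vS]; [by rewrite /good eqxx | exact: xgood | | exact: Sgood].
    by rewrite good_sym; exact: xgood.
  - have drop := pairs_drop L (triangle_objects x y z) (same E' EE).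
    rewrite (triangle_edges_card (elimN eqP xy) (elimN eqP xz) (elimN eqP yz) xyG xzG yzG).
    rewrite V3 cardsU1 xS.
    exact: (drop_arith3 (triangle_objects_card x y z) drop cnt).
move=> notri.
(* A remaining vertex of degree two has adjacent neighbours, and not both have degree two, as the
   three would form a triangle component. *)
have nb : {in V, forall v, #|incident G v| = 2%N ->
    exists2 x, x \in V & [set v; x]%SET \in G /\ (2 < #|incident G x|)%N}.
  move=> z zV z2; have [x [y [xy xzG zyG _]]] := two z zV z2.
  have xyG := nosupP z x y zV xy xzG zyG z2.
  have [xV yV] : x \in V /\ y \in V by split; apply: (inV _ _ xyG); rewrite !inE eqxx ?orbT.
  have [x3|x2] := ltnP 2 #|incident G x|; first by exists x => //; rewrite set2C.
  have [y3|y2] := ltnP 2 #|incident G y|; first by exists y.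
  case/negP: notri; apply/exists_inP; exists z => //; apply/existsP; exists x; apply/existsP; exists y.
  have xy' : x != y by exact/eqP.
  by rewrite xy' xzG zyG xyG z2 eqxx !eqn_leq x2 y2 !deg2.
(* The reduction has stopped: all remaining objects are discarded at once, and [dense_count] pays
   for them. *)
pose O := ([set [set v] | v in V] :|: G)%SET.
have Oc : (#|O| <= #|V| + #|G|)%N.
  by apply: leq_trans (leq_card_setU _ _) _; rewrite leq_add2r leq_imset_card.
have D'0 : [set u in D | b u \notin O]%SET = finset.set0.
  apply/setP => u; rewrite inE [RHS]inE; apply/negP => /andP[uD]; rewrite inE negb_or => /andP[uV uG].
  case: (rd_object rd uD) => [[v vV bu]|buG]; last by rewrite buG in uG.
  by case/imsetP: uV; exists v.
have := pairs_drop L O (same E (fintype.subxx _)); rewrite D'0 [pairs E finset.set0]big_set0 cards0.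
have := dense_count G2 deg2 nb => dense cnt.
exists finset.set0, E; split => //; rewrite ?finset.sub0set ?leq_addr//.
  by move=> u v; rewrite inE.
by rewrite cards0; exact: terminal_arith Oc dense cnt.
Qed.

End Counting.

(** If [a < K n], then [g <= 2 n] bounds the pairs by [(2 K + 7) n], which is [L n / 2]. The excess
    term [17 L ^ 2 (g - n)] is at most [L n / 2] too, so [n <= 18 L s] remains; with
    [s ^ 2 <= L n / 2] this gives [n <= 162 L ^ 3]. *)
Lemma addable_arith K L n g a s : L = (4 * K + 14)%N -> (162 * L ^ 3 < n)%N ->
  (34 * L * g <= (34 * L).+1 * n)%N -> (s * s <= n + 2 * (g + n + a))%N ->
  (2 * L * n + 17 * (L ^ 2 * n) <= n + 2 * (g + n + a) + L ^ 2 * (17 * g + 18 * s))%N ->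
  (K * n <= a)%N.
Proof.
move=> LE nL gn ss cnt; rewrite leqNgt; apply/negP => aK.
have L0 : (0 < L)%N by lia.
have g2 : (g <= 2 * n)%N by rewrite -(leq_pmul2l (_ : 0 < 34 * L)%N); nia.
have b1 : (2 * (n + 2 * (g + n + a)) <= L * n)%N by rewrite LE; nia.
have q1 : (34 * (L ^ 2 * g) <= 34 * (L ^ 2 * n) + L * n)%N.
  have : (L * (34 * L * g) <= L * ((34 * L).+1 * n))%N by rewrite leq_mul2l gn orbT.
  by rewrite expnS expn1; lia.
have s1 : (n <= 18 * (L * s))%N.
  rewrite -(leq_pmul2l L0).
  have -> : (L * (18 * (L * s)) = 18 * (L ^ 2 * s))%N by rewrite expnS expn1; lia.
  lia.
have s2 : (n * n <= 324 * (L ^ 2 * (s * s)))%N.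
  have := leq_mul s1 s1; rewrite expnS expn1; lia.
have s3 : (2 * (s * s) <= L * n)%N by lia.
have s4 : (L ^ 2 * (2 * (s * s)) <= L ^ 2 * (L * n))%N by rewrite leq_mul2l s3 orbT.
have s5 : (n * n <= 162 * L ^ 3 * n)%N.
  have -> : (162 * L ^ 3 * n = 162 * (L ^ 2 * (L * n)))%N by rewrite 2!expnS expn1; lia.
  lia.
move: s5; rewrite leq_pmul2r; last by lia.
by rewrite leqNgt nL.
Qed.

Section AddableLower.
Variables (n : nat) (P : graph n -> Prop) (hP : planar_class P).
Implicit Types (u v : 'I_n) (e f : {set 'I_n}) (G E : graph n).

Definition addable_edges G : graph n :=
  [set e : {set 'I_n} | [&& #|e| == 2%N, e \notin G & `[< P (e |: G)%SET >]]]%SET.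

(** Good pairs are ordered: [n] lie on the diagonal, and an edge in [E] or addable accounts for two.
    A good pair outside [E] is outside [G], hence really addable. *)
Lemma pairs_le G E : (G \subset E)%SET ->
  (pairs P G E [set: 'I_n]%SET <= n + 2 * (#|E| + #|addable_edges G|))%N.
Proof.
move=> GE; pose F := [set e in E :|: addable_edges G | #|e| == 2%N]%SET.
have FE : (#|F| <= #|E| + #|addable_edges G|)%N.
  apply: leq_trans (leq_card_setU _ _); apply: subset_leq_card.
  by apply/fintype.subsetP => e; rewrite inE => /andP[].
have sumF : (\sum_(u in [set: 'I_n]%SET) #|incident F u| = 2 * #|F|)%N.
  rewrite (sum_incident (D := [set: 'I_n]%SET)); last by move=> e _; exact: finset.subsetT.
  by rewrite mulnC -sum_nat_const; apply: eq_bigr => e; rewrite inE => /andP[_ /eqP].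
apply: (@leq_trans (n + 2 * #|F|)); last by rewrite leq_add2l leq_mul2l FE orbT.
rewrite -sumF; apply: (@leq_trans (\sum_(u in [set: 'I_n]%SET) (1 + #|incident F u|))%N); last first.
  by rewrite big_split /= sum1_card cardsT card_ord.
apply: leq_sum => u _.
have sub : ([set v in [set: 'I_n]%SET | good P G E u v] \subset u |: [set v : 'I_n | [set v; u]%SET \in F])%SET.
  apply/fintype.subsetP => v; rewrite !inE /= => /or3P[/eqP ->|uvE|uvP]; first by rewrite eqxx.
    case: (eqVneq v u) => //= vu.
    by rewrite (set2C v u) uvE /= cards2 (eq_sym u v) vu.
  case: (eqVneq v u) => //= vu; rewrite (set2C v u) cards2 (eq_sym u v) vu eqxx andbT /=.
  case: (boolP ([set u; v]%SET \in E)) => //= uvE; rewrite uvP andbT.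
  by apply: contra uvE => /(fintype.subsetP GE).
apply: leq_trans (subset_leq_card sub) _; apply: leq_trans (leq_card_setU _ _) _.
by rewrite cards1 leq_add2l; exact: card_neighbours.
Qed.

Lemma addable_lower K G : {in G, forall e, #|e| = 2%N} -> P G ->
  (162 * (4 * K + 14) ^ 3 < n)%N ->
  (34 * (4 * K + 14) * #|G| <= (34 * (4 * K + 14)).+1 * n)%N ->
  (K * n <= #|addable_edges G|)%N.
Proof.
move=> G2 PG nL gn.
(* At the start every vertex is its own bag and the exceptions are the edges of [G]. *)
have rd : reduction P G [set: 'I_n]%SET G (fun u => [set u]%SET) [set: 'I_n]%SET G.
  split => //.
  - by move=> e /G2; split => //; exact: finset.subsetT.
  - by move=> u _; left; exists u; rewrite ?inE.
  - move=> u v _ _ uv _ _; apply: (pc_sub hP); apply/fintype.subsetP => e /setU1P[->|eG].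
      by apply/insert2P; constructor 1.
    by apply/insert2P; constructor 4; split => // E1; have := G2 e eG; rewrite E1 cards1.
  - by move=> u v _ _ /finset.set1_inj ->; rewrite /good eqxx.
have [S [E [_ GE Ec Sgood cnt]]] := reduction_count hP (4 * K + 14) (leqnn _) rd.
rewrite !cardsT !card_ord in Ec cnt.
have pl := pairs_le GE.
apply: (addable_arith (L := 4 * K + 14) (g := #|G|) (s := #|S|) erefl nL gn).
- have SS : (#|S| * #|S| <= pairs P G E [set: 'I_n]%SET)%N.
    rewrite -sum_nat_const /pairs big_mkcond [X in (_ <= X)%N]big_mkcond /=.
    apply: leq_sum => u _; rewrite inE; case: ifP => // uS; apply: subset_leq_card.
    by apply/fintype.subsetP => v vS; rewrite !inE Sgood.
  apply: leq_trans SS _; apply: leq_trans pl _; rewrite leq_add2l leq_mul2l /=.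
  by rewrite leq_add2r.
- apply: leq_trans cnt _; rewrite leq_add2r; apply: leq_trans pl _.
  by rewrite leq_add2l leq_mul2l /= leq_add2r.
Qed.

End AddableLower.

(** * Components and trees *)

Section Components.
Variable n : nat.
Implicit Types (G : graph n) (x y : 'I_n) (C W e : {set 'I_n}).

Lemma adj_sym G : symmetric (adj G).
Proof. by move=> x y; rewrite /adj set2C. Qed.

Lemma connect_adj_sym G : connect_sym (adj G).
Proof. exact: (sym_connect_sym (adj_sym G)). Qed.

Lemma componentP G C : reflect (exists x, C = [set y | connect (adj G) x y]%SET) (C \in components G).
Proof.
have eqR : {in [set: 'I_n]%SET & &, equivalence_rel (connect (adj G))}.
  move=> x y z _ _ _; split; first exact: connect0.
  by move=> xy; exact: (same_connect (connect_adj_sym G) xy).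
apply: (iffP imsetP) => [[x _ ->]|[x ->]]; exists x; rewrite ?inE//;
by apply/finset.setP => y; rewrite !inE.
Qed.

Lemma component_closed G C x y : C \in components G -> x \in C -> adj G x y -> y \in C.
Proof.
move=> /componentP[z ->]; rewrite !inE => zx xy; exact: connect_trans zx (connect1 xy).
Qed.

Lemma component_unique G C C' x : C \in components G -> C' \in components G ->
  x \in C -> x \in C' -> C = C'.
Proof.
move=> /componentP[y ->] /componentP[z ->]; rewrite !inE => yx zx.
apply/finset.setP => t; rewrite !inE (same_connect (connect_adj_sym G) yx).
by rewrite (same_connect (connect_adj_sym G) zx).
Qed.

Lemma connected_set_component G C : C != finset.set0 ->
  (forall x y, x \in C -> adj G x y -> y \in C) ->
  {in C &, forall x y, connect (adj G) x y} -> C \in components G.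
Proof.
move=> /set0Pn[x xC] closed conn; apply/componentP; exists x; apply/finset.setP => y.
rewrite inE; apply/idP/idP => [yC|/connectP[p]]; first exact: conn.
elim: p x xC => [x xC _ -> //|z p IH x xC /= /andP[xz zp] yE].
exact: IH (closed x z xC xz) zp yE.
Qed.

(** Edges in which the graphs differ lie within [W], so both have the same edges at the vertices of
    [C]. *)
Lemma component_transfer G G' C W : {in C, forall x, x \notin W} ->
  (forall e, (e \in G) != (e \in G') -> (e \subset W)%SET) ->
  C \in components G' -> C \in components G.
Proof.
move=> CW diff CG'; have agree x y : x \in C -> adj G x y = adj G' x y.
  move=> xC; rewrite /adj; apply/eqP; apply: contraT => /diff/fintype.subsetP/(_ x).
  by rewrite !inE eqxx (negbTE (CW x xC)) => /(_ isT).
have [x0 CE] := componentP _ _ CG'.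
apply: connected_set_component.
- by apply/set0Pn; exists x0; rewrite CE inE connect0.
- by move=> x y xC; rewrite agree//; exact: component_closed CG' xC.
- move=> x y xC yC; have : connect (adj G') x y.
    move: xC yC; rewrite CE !inE => x0x x0y; rewrite connect_adj_sym in x0x.
    exact: connect_trans x0x x0y.
  case/connectP => p + ->; elim: p x xC {yC} => [x xC _|z p IH x xC /= /andP[xz zp]]; first exact: connect0.
  have zC := component_closed CG' xC xz.
  by apply: connect_trans (connect1 _) (IH z zC zp); rewrite agree.
Qed.

Lemma op_isomorphic_transfer h (H : graph h) G G' C W : {in C, forall x, x \notin W} ->
  (forall e, (e \in G) != (e \in G') -> (e \subset W)%SET) ->
  op_isomorphic H G' C -> op_isomorphic H G C.
Proof.
move=> CW diff /andP[Ch /existsP[f /and3P[finc /eqP fC fH]]]; rewrite /op_isomorphic Ch /=.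
apply/existsP; exists f; rewrite finc fC eqxx /=; apply/forallP => i; apply/forallP => j.
have := forallP (forallP fH i) j => /eqP ->; apply/eqP; rewrite /adj; apply/eqP.
have fiC : f i \in C by rewrite -fC imset_f ?inE.
rewrite eq_sym; apply: contraT => /diff/fintype.subsetP/(_ (f i)).
by rewrite !inE eqxx (negbTE (CW _ fiC)) => /(_ isT).
Qed.

(* A component that avoids [W] is a component of both graphs. *)
Lemma num_op_components_change h (H : graph h) G G' W :
  (forall e, (e \in G) != (e \in G') -> (e \subset W)%SET) ->
  (num_op_components H G' <= num_op_components H G + #|W|)%N.
Proof.
move=> diff; rewrite /num_op_components.
set A' := [set C in components G' | _]%SET; set A := [set C in components G | _]%SET.
pose free := [set C : {set 'I_n} | [disjoint C & W]]%SET.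
rewrite -(cardsID free A') leq_add//.
  apply: subset_leq_card; apply/fintype.subsetP => C; rewrite !inE => /andP[/andP[CG' Cop] CW].
  have CW' : {in C, forall x, x \notin W} by move=> x xC; rewrite (disjointFr CW xC).
  by rewrite (component_transfer CW' diff CG') (op_isomorphic_transfer CW' diff Cop).
apply: leq_trans (leq_imset_card (fun w => [set y | connect (adj G') w y]%SET) (mem W)).
apply: subset_leq_card; apply/fintype.subsetP => C; rewrite !inE => /andP[/pred0Pn[w /andP[/= wC wW]] /andP[CG' _]].
apply/imsetP; exists w => //; apply: (component_unique CG' _ wC); last by rewrite inE connect0.
by apply/componentP; exists w.
Qed.

End Components.

(** * Building a tree leaf by leaf *)

Section TreeGrowth.
Variables (h : nat) (H : graph h).
Hypothesis treeH : is_tree H.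
Implicit Types (U : {set 'I_h}) (x y : 'I_h) (e : {set 'I_h}).

Definition edges_in U : graph h := [set e in H | (e \subset U)%SET]%SET.
Definition adj_in U : rel 'I_h := [rel x y | [&& adj H x y, x \in U & y \in U]].

Lemma adj_in_sym U : connect_sym (adj_in U).
Proof.
by apply: sym_connect_sym => x y; rewrite /adj_in /= adj_sym; congr (_ && _); exact: andbC.
Qed.

(** Two neighbours of [y] in [U] would close a cycle with a path inside [U]. *)
Lemma tree_unique_neighbour U y x x' : {in U &, forall a b, connect (adj_in U) a b} ->
  y \notin U -> x \in U -> x' \in U -> adj H x y -> adj H x' y -> x = x'.
Proof.
move=> conn yU xU x'U xy x'y; apply/eqP; apply: contraT => /eqP xx'.
have [_ _ acyc] := treeH; have /connectP[p0 pp0 lastp0] := conn x x' xU x'U.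
have [p [pp up lastp]] : exists p, [/\ path (adj_in U) x p, uniq (x :: p) & x' = last x p].
  by case: (shortenP pp0) lastp0 => p pp up _ lastp; exists p.
have pU : {subset x :: p <= U}.
  move: pp {up lastp}; elim: p x xU {xy xx' pp0 lastp0} => [|z p IH] x xU /=.
    by move=> _ t; rewrite inE => /eqP ->.
  move=> /andP[/and3P[_ _ zU] zp] t; rewrite inE => /orP[/eqP -> //|].
  exact: IH zU zp t.
(* Since [x <> x'], the path [p] is nonempty and the cycle has at least three vertices. *)
case: (acyc (y :: x :: p)) => /=.
  by case: p lastp {pp up pU} => [/= E|//]; case: xx'.
apply/andP; split; last first.
  by move: up => /= ->; rewrite andbT; apply: contra yU; exact: pU.
rewrite /= adj_sym xy /= rcons_path -lastp x'y andbT.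
by apply: sub_path pp => a b /= /and3P[].
Qed.

Lemma connect_leaves U x y : connect (adj H) x y -> x \in U -> y \notin U ->
  exists a b, [/\ a \in U, b \notin U & adj H a b].
Proof.
case/connectP => p; elim: p x => [x _ -> xU|z p IH x /= /andP[xz zp] lastp xU yU]; first by rewrite xU.
by case: (boolP (z \in U)) => [zU|zU]; [exact: IH zp lastp zU yU | exists x, z].
Qed.

(** Induction along connected sets that gain one vertex at a time, and with it, by
    [tree_unique_neighbour], exactly one edge. It serves both to count the edges and to plant the
    tree by pendant moves. *)
Lemma tree_growth (Q : {set 'I_h} -> Prop) : (forall x, Q [set x]%SET) ->
  (forall U x y, x \in U -> y \notin U -> edges_in (y |: U)%SET = ([set x; y] |: edges_in U)%SET ->
    Q U -> Q (y |: U)%SET) ->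
  Q [set: 'I_h]%SET.
Proof.
move=> Q1 Qstep; have [/forall_inP simpleH /andP[h0 /forallP conH] _] := treeH.
have grow k : (k < h)%N -> exists U, [/\ #|U| = k.+1,
    {in U &, forall a b, connect (adj_in U) a b} & Q U].
  elim: k => [_|k IH kh].
    exists [set Ordinal h0]%SET; split; [by rewrite cards1 | | exact: Q1].
    by move=> a b /set1P -> /set1P ->; exact: connect0.
  have [U [Uk conn QU]] := IH (ltnW kh).
  have [a aU] : exists a, a \in U by apply/set0Pn; rewrite -cards_eq0 Uk.
  have [b bU] : exists b, b \notin U.
    apply/existsP; rewrite -negb_forall; apply/negP => /forallP all_in.
    have : #|U| = h by rewrite -[RHS]card_ord; apply: eq_card => t; rewrite all_in.
    by rewrite Uk; lia.
  have [x [y [xU yU xy]]] := connect_leaves (forallP (conH a) b) aU bU.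
  exists (y |: U)%SET; split.
  - by rewrite cardsU1 yU Uk.
  - have sub u v : connect (adj_in U) u v -> connect (adj_in (y |: U)%SET) u v.
      apply: connect_sub => s t /and3P[st sU tU]; apply: connect1.
      by rewrite /adj_in /= st !in_setU1 sU tU !orbT.
    have fromx u : u \in (y |: U)%SET -> connect (adj_in (y |: U)%SET) x u.
      case/setU1P => [->|uU]; last by apply: sub; exact: conn.
      by apply: connect1; rewrite /adj_in /= xy !in_setU1 xU eqxx orbT.
    move=> u v uU vU; apply: connect_trans (fromx v vU).
    by rewrite adj_in_sym; exact: fromx.
  - apply: (Qstep U x y) => //; apply/finset.setP => e; rewrite in_setU1 !inE.
    apply/idP/idP => [/andP[eH /fintype.subsetP eU]|/orP[/eqP ->|/andP[-> eU]]]; last 2 first.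
    + apply/andP; split=> //; apply/fintype.subsetP => t /set2P[] ->; rewrite in_setU1 ?eqxx//.
      by rewrite xU orbT.
    + by rewrite (fintype.subset_trans eU)// finset.subsetUr.
    case: (boolP (y \in e)) => [ye|ye]; last first.
      apply/orP; right; rewrite eH; apply/fintype.subsetP => t te.
      by have /setU1P[ty|//] := eU t te; move: ye; rewrite -ty te.
    have [x' x'y eE] := card2_end (eqP (simpleH e eH)) ye.
    have x'U : x' \in U by have := eU x'; rewrite eE !inE eqxx => /(_ isT)/orP[/eqP|].
    have x'H : adj H x' y by rewrite /adj -eE.
    by rewrite eE (tree_unique_neighbour conn yU xU x'U xy x'H) eqxx.
have [|U [Uc _ QU]] := grow h.-1; first by rewrite prednK.
suff -> : [set: 'I_h]%SET = U by [].
by apply/esym/eqP; rewrite eqEcard finset.subsetT cardsT card_ord Uc prednK /=.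
Qed.

Lemma tree_card : #|H|.+1 = h.
Proof.
have [/forall_inP simpleH _ _] := treeH.
have := tree_growth (Q := fun U => #|edges_in U|.+1 = #|U|).
have -> : edges_in [set: 'I_h]%SET = H by apply/finset.setP => e; rewrite !inE finset.subsetT andbT.
rewrite cardsT card_ord; apply.
- move=> x; rewrite cards1; congr _.+1; apply/eqP; rewrite cards_eq0 -finset.subset0.
  apply/fintype.subsetP => e; rewrite inE => /andP[/simpleH/eqP e2 /subset_leq_card].
  by rewrite e2 cards1.
- move=> U x y xU yU -> QU; rewrite !cardsU1 yU -QU.
  suff -> : [set x; y]%SET \notin edges_in U by rewrite !add1n.
  rewrite inE negb_and; apply/orP; right; apply: contra yU => /fintype.subsetP; apply.
  by rewrite !inE eqxx orbT.
Qed.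

End TreeGrowth.

Section Placement.
Variables (h : nat) (H : graph h) (treeH : is_tree H) (n : nat).
Variables (P : graph n -> Prop) (hP : planar_class P).
Implicit Types (G F : graph n) (S e : {set 'I_n}).

Lemma order_embedding S : #|S| = h -> exists f : {ffun 'I_h -> 'I_n},
  [forall i : 'I_h, forall j : 'I_h, (i < j)%N ==> (f i < f j)%N] /\ (f @: [set: 'I_h])%SET = S.
Proof.
move=> Sh; case: (posnP h) => [h0|h0].
  have no (i : 'I_h) : False by case: i; rewrite h0.
  exists (finfun (fun i : 'I_h => match no i with end)); split.
    by apply/forallP => i; case: (no i).
  have -> : S = finset.set0 by apply/eqP; rewrite -cards_eq0 Sh h0.
  apply/finset.setP => x; rewrite [RHS]inE; apply/negP => /imsetP[i]; case: (no i).
have Sh' : size (enum S) = h by rewrite -cardE.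
have [x0 _] : exists x, x \in S by apply/set0Pn; rewrite -cards_eq0 Sh -lt0n.
pose f := [ffun i : 'I_h => nth x0 (enum S) i].
have sorted_enum : sorted ltn (map val (enum S)).
  rewrite /enum_mem -enumT; apply: (subseq_sorted ltn_trans) (iota_ltn_sorted 0 n).
  by rewrite -val_enum_ord; apply: map_subseq; exact: filter_subseq.
exists f; split.
  apply/forallP => i; apply/forallP => j; apply/implyP => ij; rewrite !ffunE.
  have := sorted_ltn_nth ltn_trans (x0 : nat) sorted_enum.
  move=> /(_ i j); rewrite !inE size_map Sh' !ltn_ord => /(_ isT isT ij).
  by rewrite !(nth_map x0)// Sh'.
apply/finset.setP => x; apply/imsetP/idP => [[i _ ->]|xS].
  by rewrite ffunE -mem_enum mem_nth// Sh'.
have xi : (index x (enum S) < h)%N by rewrite -Sh' index_mem mem_enum.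
by exists (Ordinal xi); rewrite ?inE// ffunE nth_index// mem_enum.
Qed.

(** [F] depends on [S] alone and is fixed before [G], so that planting the tree can be undone from
    the knowledge of [S]. *)
Lemma place_tree S : #|S| = h -> exists F, [/\ #|F|.+1 = h,
  {in F, forall e, #|e| = 2%N /\ (e \subset S)%SET},
  forall G, {in S, forall s, isolated G s} -> P G -> P (G :|: F)%SET &
  forall G, {in S, forall s, isolated G s} ->
    S \in components (G :|: F)%SET /\ op_isomorphic H (G :|: F)%SET S].
Proof.
move=> Sh; have [f [finc fS]] := order_embedding Sh.
have [/forall_inP simpleH /andP[h0 /forallP conH] _] := treeH.
have finj : injective f.
  move=> i j fij; have inc (a b : 'I_h) : (a < b)%N -> (f a < f b)%N.
    by have := forallP (forallP finc a) b => /implyP.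
  by apply/val_inj; case: (ltngtP i j) => // /inc; rewrite fij ltnn.
have inS i : f i \in S by rewrite -fS imset_f ?inE.
pose im (e : {set 'I_h}) := (f @: e)%SET.
have iminj : injective im by exact: imset_inj.
have im2 i j : im [set i; j]%SET = [set f i; f j]%SET by rewrite /im imsetU !imset_set1.
pose F := [set im e | e in H]%SET.
have adjF G i j : {in S, forall s, isolated G s} -> adj H i j = adj (G :|: F)%SET (f i) (f j).
  move=> GS; rewrite /adj finset.in_setU -im2 (mem_imset _ _ iminj).
  case: (boolP (im _ \in G)) => // /(elimT (isolatedP _ _) (GS (f i) (inS i))).
  by rewrite im2 !inE eqxx.
exists F; split.
- by rewrite card_imset//; exact: tree_card treeH.
- move=> e /imsetP[e0 e0H ->]; split; first by rewrite card_imset//; apply/eqP; exact: simpleH.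
  by apply/fintype.subsetP => x /imsetP[i _ ->].
- move=> G GS PG.
  have FE : edges_in H [set: 'I_h]%SET = H.
    by apply/finset.setP => e; rewrite !inE finset.subsetT andbT.
  suff : P (G :|: [set im e | e in edges_in H [set: 'I_h]])%SET by rewrite FE.
  apply: (tree_growth treeH (Q := fun U => P (G :|: [set im e | e in edges_in H U])%SET)).
  + move=> x; suff -> : edges_in H [set x]%SET = finset.set0 by rewrite imset0 finset.setU0.
    apply/eqP; rewrite -finset.subset0.
    apply/fintype.subsetP => e; rewrite inE => /andP[/simpleH/eqP e2 /subset_leq_card].
    by rewrite e2 cards1.
  + move=> U x y xU yU -> QU; rewrite imsetU imset_set1 im2 finset.setUCA.
    apply: (pc_pendant hP) QU.
      by apply: contraNneq yU => /finj <-.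
    apply/isolatedP => e; rewrite inE => /orP[|/imsetP[e0 + ->]].
      exact: (elimT (isolatedP _ _) (GS (f y) (inS y))).
    rewrite inE => /andP[_ /fintype.subsetP eU].
    by rewrite (mem_imset _ _ finj); apply: contra yU; exact: eU.
- move=> G GS; split.
    apply: connected_set_component.
    + by apply/set0Pn; exists (f (Ordinal h0)).
    + move=> x y xS; rewrite /adj finset.in_setU => /orP[/(elimT (isolatedP _ _) (GS x xS))|].
        by rewrite !inE eqxx.
      move=> /imsetP[e0 _ E]; have : y \in im e0 by rewrite -E !inE eqxx orbT.
      by case/imsetP => i _ ->.
    + move=> x y; rewrite -fS => /imsetP[i _ ->] /imsetP[j _ ->].
      have /connectP[p pp ->] := forallP (conH i) j.
      elim: p i pp => [i _|k p IH i /= /andP[ik kp]]; first exact: connect0.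
      by apply: connect_trans (IH k kp); apply: connect1; rewrite -adjF.
rewrite /op_isomorphic Sh eqxx /=; apply/existsP; exists f; rewrite finc fS eqxx /=.
by apply/forallP => i; apply/forallP => j; rewrite (adjF G).
Qed.

End Placement.

(** * Switchings *)

Lemma double_count (T1 T2 : finType) (A : {set T1}) (B : {set T2}) (r : T1 -> T2 -> bool) X Y :
  {in A, forall a, (X <= #|[set b in B | r a b]%SET|)%N} ->
  {in B, forall b, (#|[set a in A | r a b]%SET| <= Y)%N} -> (#|A| * X <= #|B| * Y)%N.
Proof.
move=> AX BY; apply: (@leq_trans (\sum_(a in A) #|[set b in B | r a b]%SET|)%N).
  by rewrite -sum_nat_const; exact: leq_sum.
apply: (@leq_trans (\sum_(b in B) #|[set a in A | r a b]%SET|)%N); last first.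
  by rewrite -sum_nat_const; exact: leq_sum.
have cardE (T T' : finType) (C : {set T}) (D : {set T'}) (s : T -> T' -> bool) :
    (\sum_(a in C) #|[set b in D | s a b]%SET| = \sum_(a in C) \sum_(b in D) s a b)%N.
  apply: eq_bigr => a _; rewrite -sum1_card big_mkcond [RHS]big_mkcond /=.
  by apply: eq_bigr => b _; rewrite inE; case: (b \in D); case: (s a b).
by rewrite cardE (cardE _ _ B A (fun b a => r a b)) exchange_big.
Qed.

Section Switching.
Variables (n : nat) (P : graph n -> Prop) (hP : planar_class P).
Implicit Types (G F : graph n) (x y z v : 'I_n) (e f : {set 'I_n}).

(** For [P := planar R] this is convertible to [planar_graphs]. *)
Definition class (m : nat) : {set graph n} :=
  [set G : graph n | [&& simple_graph G, `[< P G >] & #|G| == m]]%SET.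

Lemma classP m G : reflect [/\ {in G, forall e, #|e| = 2%N}, P G & #|G| = m] (G \in class m).
Proof.
rewrite inE; apply: (iffP and3P) => [[/forall_inP G2 /asboolP PG /eqP Gm]|[G2 PG Gm]].
  by split => // e eG; apply/eqP; exact: G2.
by split; [apply/forall_inP => e eG; apply/eqP; exact: G2 | exact/asboolP | exact/eqP].
Qed.

Definition star z e : graph n := [set [set x; z]%SET | x in e]%SET.

(** For a leaf this is a singleton, for degree two it is the edge that suppression creates; one
    formula then undoes both cases. *)
Definition outer_ends G z : {set 'I_n} := [set x | (x != z) && ([set x; z]%SET \in G)]%SET.

(* A vertex of degree one or two is detachable when its removal, with suppression in
   the case of degree two, loses exactly one edge. *)
Definition detachable G z : bool :=
  (#|incident G z| == 1%N) || (#|incident G z| == 2%N) && (outer_ends G z \notin G).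

(** The case that suppression cannot treat: removal loses two edges, and [triangular_moves] adds one
    back. *)
Definition triangular G z : bool := (#|incident G z| == 2%N) && (outer_ends G z \in G).

Definition remove_vertex G z : graph n := (G :\: incident G z)%SET.

Definition detach G z : graph n :=
  if #|incident G z| == 1%N then remove_vertex G z
  else (outer_ends G z |: remove_vertex G z)%SET.

Lemma remove_vertex_isolated G z : isolated (remove_vertex G z) z.
Proof.
by apply/isolatedP => e; rewrite !inE negb_and => /andP[/orP[/negbTE ->|-> //]].
Qed.

Lemma in_outer_ends G z t : (t \in outer_ends G z) = (t != z) && ([set t; z]%SET \in incident G z).
Proof. by rewrite !inE eqxx orbT andbT. Qed.

Lemma set2_eq_l (x y z : 'I_n) : ([set x; z]%SET == [set y; z]%SET) = (x == y).
Proof. by apply/eqP/eqP => [|-> //]; rewrite set2C (set2C y) => /set2_inj. Qed.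

Lemma incident1 G z : {in G, forall e, #|e| = 2%N} -> #|incident G z| = 1%N ->
  exists w, [/\ w != z, outer_ends G z = [set w]%SET & incident G z = [set [set w; z]]%SET].
Proof.
move=> G2 /eqP/cards1P[e inc]; have /andP[eG ze] : (e \in G) && (z \in e).
  by have := finset.set11 e; rewrite -inc inE.
have [w wz eE] := card2_end (G2 e eG) ze; exists w; split; [exact/eqP | | by rewrite inc eE].
apply/finset.setP => t; rewrite in_outer_ends inc eE finset.in_set1 set2_eq_l finset.in_set1.
by case: (eqVneq t w) => [->|]; rewrite ?andbF//= andbT; apply/eqP.
Qed.

Lemma incident2 G z : {in G, forall e, #|e| = 2%N} -> #|incident G z| = 2%N ->
  exists x y, [/\ x != y, x != z, y != z, outer_ends G z = [set x; y]%SET &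
    incident G z = [set [set x; z]; [set y; z]]%SET].
Proof.
move=> G2 /eqP/cards2P[e [f [ef inc]]].
have sub t : t \in incident G z -> (t \in G) && (z \in t) by rewrite inE.
have /andP[eG ze] : (e \in G) && (z \in e) by apply: sub; rewrite inc !inE eqxx.
have /andP[fG zf] : (f \in G) && (z \in f) by apply: sub; rewrite inc !inE eqxx orbT.
have [x xz eE] := card2_end (G2 e eG) ze; have [y yz fE] := card2_end (G2 f fG) zf.
exists x, y; rewrite inc eE fE; split=> //; try exact/eqP.
  by apply: contraNneq ef => xy; rewrite eE fE xy.
apply/finset.setP => t; rewrite in_outer_ends inc eE fE !finset.in_set2 !set2_eq_l.
case: (eqVneq t x) => [->|_] /=; first by rewrite andbT; apply/eqP.
by case: (eqVneq t y) => [->|_] /=; rewrite ?andbF// andbT; apply/eqP.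
Qed.

(** Besides [z], only the set [outer_ends G z] is needed to go back, and it is a singleton or an
    edge of the new graph; this bounds the number of preimages. *)
Lemma detach_undo G z : {in G, forall e, #|e| = 2%N} -> detachable G z ->
  G = ((detach G z :\ outer_ends G z) :|: star z (outer_ends G z))%SET.
Proof.
move=> G2; have split_inc : G = (remove_vertex G z :|: incident G z)%SET.
  by apply/finset.setP => e; rewrite !inE; case: (e \in G); case: (z \in e).
rewrite /detachable /detach; case: eqP => [/(incident1 G2)[w [wz oE iE]] _|_ /= /andP[/eqP]].
  rewrite oE /star imset_set1 -iE {1}split_inc; congr (_ :|: _)%SET.
  (* For a leaf the set taken out is a singleton, which is never an edge, so nothing is lost. *)
  apply/finset.setP => e; rewrite in_setD1; case: eqP => // ->; apply/negP.
  by rewrite !inE => /andP[_ /G2]; rewrite cards1.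
move=> /(incident2 G2)[x [y [_ _ _ oE iE]]] oG.
have -> : star z (outer_ends G z) = incident G z by rewrite oE iE /star imsetU !imset_set1.
rewrite {1}split_inc; congr (_ :|: _)%SET.
rewrite setU1K//; apply: contra oG; by rewrite !inE => /andP[].
Qed.

Lemma triangular_undo G z : {in G, forall e, #|e| = 2%N} -> triangular G z ->
  G = (remove_vertex G z :|: star z (outer_ends G z))%SET /\ outer_ends G z \in remove_vertex G z.
Proof.
move=> G2 /andP[/eqP/(incident2 G2)[x [y [_ xz yz oE iE]]] oG]; split.
  have -> : star z (outer_ends G z) = incident G z by rewrite oE iE /star imsetU !imset_set1.
  by apply/finset.setP => e; rewrite !inE; case: (e \in G); case: (z \in e).
by rewrite /remove_vertex finset.in_setD oG andbT inE oG /= inE eqxx.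
Qed.

Lemma remove_vertex_class m G z : G \in class m -> remove_vertex G z \in class (m - #|incident G z|)%N.
Proof.
move=> /classP[G2 PG <-]; apply/classP; split.
- by move=> e; rewrite inE => /andP[_]; exact: G2.
- by apply: (pc_sub hP) PG; exact: finset.subsetDl.
- rewrite cardsD; congr (_ - _)%N; apply: eq_card => e; rewrite !inE.
  by case: (e \in G).
Qed.

Lemma detach_class m G z : G \in class m -> detachable G z -> detach G z \in class m.-1.
Proof.
move=> Gm dz; have := Gm => /classP[G2 PG mE]; have := remove_vertex_class z Gm.
rewrite /detach; move: dz; rewrite /detachable; case: eqP => [-> _|_ /= /andP[/eqP d2 oG]].
  by rewrite subn1.
have [x [y [xy xz yz oE iE]]] := incident2 G2 d2; rewrite d2 => /classP[R2 PR Rm].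
have m2 : (2 <= m)%N.
  by rewrite -d2 -mE subset_leq_card//; apply/fintype.subsetP => e; rewrite inE => /andP[].
have oR : outer_ends G z \notin remove_vertex G z by apply: contra oG; rewrite inE => /andP[].
apply/classP; split.
- by move=> e /setU1P[->|/R2 //]; rewrite oE cards2 xy.
- have [xzG yzG] : [set x; z]%SET \in G /\ [set z; y]%SET \in G.
    have sub e : e \in incident G z -> e \in G by rewrite inE => /andP[].
    by split; apply: sub; rewrite iE !inE ?(set2C z) eqxx ?orbT.
  have onz : {in G, forall e, z \in e -> e = [set x; z]%SET \/ e = [set z; y]%SET}.
    move=> e eG ze; have : e \in incident G z by rewrite inE eG.
    by rewrite iE (set2C z) => /set2P.
  apply: (pc_sub hP) (pc_suppress hP xzG yzG xy onz PG).
  rewrite oE finset.setUS//; apply/fintype.subsetP => e; rewrite 2!inE negb_and !in_setD1.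
  move=> /andP[/orP[/negP //|ze] eG]; rewrite eG andbT; apply/andP.
  by split; apply: contraNneq ze => ->; rewrite !inE eqxx ?orbT.
- by rewrite cardsU1 oR Rm; lia.
Qed.

End Switching.

Lemma dependent_pairs_card (T1 T2 : finType) (A : {set T1}) (F : T1 -> {set T2}) X :
  {in A, forall a, (X <= #|F a|)%N} ->
  (#|A| * X <= #|[set p : T1 * T2 | (p.1 \in A) && (p.2 \in F p.1)]%SET|)%N.
Proof.
move=> AX; set B := [set p : T1 * T2 | _]%SET; rewrite -[X in (_ <= X)%N]muln1.
apply: (double_count (r := fun a (p : T1 * T2) => p.1 == a)) => [a aA|[a b] _].
  apply: leq_trans (AX a aA) _; rewrite -(card_imset (f := fun b => (a, b)) (F a)); last by move=> x y [].
  apply: subset_leq_card; apply/fintype.subsetP => p /imsetP[b bF ->].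
  by rewrite !inE /= aA bF eqxx.
rewrite -(cards1 a); apply: subset_leq_card; apply/fintype.subsetP => a'.
by rewrite !inE /= => /andP[_ /eqP ->].
Qed.

(** Each vertex to be avoided costs at most [n] edges. *)
Lemma avoid_card n (A : graph n) (s : seq 'I_n) : {in A, forall e : {set 'I_n}, #|e| = 2%N} ->
  (#|A| <= #|[set e : {set 'I_n} in A | all (fun v => v \notin e) s]%SET| + size s * n)%N.
Proof.
move=> A2; elim: s => [|v s IH] /=.
  by rewrite addn0 subset_leq_card//; apply/fintype.subsetP => e eA; rewrite inE eA.
apply: leq_trans IH _; rewrite mulSn addnA leq_add2r.
set B := [set e : {set 'I_n} in A | all _ s]%SET.
rewrite -(cardsID [set e : {set 'I_n} | v \notin e]%SET B) leq_add//.
  apply: subset_leq_card; apply/fintype.subsetP => e; rewrite !inE => /andP[/andP[-> ->] ->].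
  by [].
apply: (@leq_trans #|[set: 'I_n]%SET|); last by rewrite cardsT card_ord.
apply: leq_trans (leq_imset_card (fun x => [set x; v]%SET) (mem [set: 'I_n]%SET)).
apply: subset_leq_card; apply/fintype.subsetP => e; rewrite !inE negbK => /andP[ve /andP[eA _]].
have [x _ ->] := card2_end (A2 e eA) ve; by apply: imset_f; rewrite inE.
Qed.

(** * Detaching one vertex *)

Section Substep.
Variables (n : nat) (P : graph n -> Prop) (hP : planar_class P).
Variables (h : nat) (H : graph h).
Implicit Types (G F : graph n) (x y z v : 'I_n) (e f : {set 'I_n}).

(** The tuple holds the vertices detached so far, the latest at its head. They stay isolated until
    the copy of [H] is planted on them. *)
Definition states m i b : {set graph n * i.-tuple 'I_n} :=
  [set s : graph n * i.-tuple 'I_n | [&& s.1 \in class P m, uniq s.2, all (isolated s.1) s.2 &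
    (num_op_components H s.1 <= b)%N]]%SET.

Lemma statesP m i b G (l : i.-tuple 'I_n) : reflect
  [/\ G \in class P m, uniq l, {in l, forall s, isolated G s} & (num_op_components H G <= b)%N]
  ((G, l) \in states m i b).
Proof.
apply: (iffP idP) => [|[Gm ul iso Nb]].
  by rewrite finset.in_set => /and4P[Gm ul /allP iso Nb].
by rewrite finset.in_set; apply/and4P; split => //; exact/allP.
Qed.

Lemma outer_ends_nonisolated G z s : isolated G s -> s \notin outer_ends G z.
Proof.
move=> /isolatedP Gs; rewrite inE negb_and; apply/orP; right; apply/negP => /Gs.
by rewrite !inE eqxx.
Qed.

Lemma remove_vertex_keep G z s : isolated G s -> isolated (remove_vertex G z) s.
Proof. by apply: isolated_sub; exact: finset.subsetDl. Qed.

Lemma detach_keep G z s : isolated G s -> isolated (detach G z) s.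
Proof.
move=> Gs; rewrite /detach; case: ifP => _; first exact: remove_vertex_keep.
apply/isolatedP => e /setU1P[->|]; first exact: outer_ends_nonisolated.
exact: (elimT (isolatedP _ _) (remove_vertex_keep z Gs)).
Qed.

Lemma detach_isolated G z : isolated (detach G z) z.
Proof.
rewrite /detach; case: ifP => _; first exact: remove_vertex_isolated.
apply/isolatedP => e /setU1P[->|]; first by rewrite inE eqxx.
exact: (elimT (isolatedP _ _) (remove_vertex_isolated G z)).
Qed.

Lemma incident_ends G z e : {in G, forall e, #|e| = 2%N} -> e \in incident G z ->
  (e \subset z |: outer_ends G z)%SET.
Proof.
move=> G2; rewrite inE => /andP[eG ze]; have [x xz eE] := card2_end (G2 e eG) ze.
apply/fintype.subsetP => t; rewrite eE => /set2P[] ->; rewrite !inE ?eqxx//.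
by rewrite -eE eG andbT; case: eqP.
Qed.

Lemma outer_ends_card G z : {in G, forall e, #|e| = 2%N} -> (#|incident G z| <= 2)%N ->
  (#|z |: outer_ends G z|%SET <= 3)%N.
Proof.
move=> G2 d2; rewrite cardsU1; apply: (@leq_add _ _ 1 2); first by case: (_ \notin _).
apply: leq_trans d2; rewrite -(card_in_imset (f := fun x => [set x; z]%SET)); last first.
  by move=> x y _ _ /eqP; rewrite set2_eq_l => /eqP.
apply: subset_leq_card; apply/fintype.subsetP => e /imsetP[x]; rewrite in_outer_ends.
by move=> /andP[_ +] ->.
Qed.

Lemma cons_state m i b b' G G' (l : i.-tuple 'I_n) z (W : {set 'I_n}) :
  {in l, forall s, isolated G' s} -> uniq l -> (num_op_components H G <= b)%N ->
  G' \in class P m -> z \notin l -> isolated G' z ->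
  (forall e, (e \in G) != (e \in G') -> (e \subset W)%SET) -> (b + #|W| <= b')%N ->
  (G', [tuple of z :: l]) \in states m i.+1 b'.
Proof.
move=> iso ul Nb Gm' zl Gz diff bb; apply/statesP; split => //=; first by rewrite zl.
  by move=> s; rewrite inE => /orP[/eqP -> //|]; exact: iso.
apply: leq_trans (num_op_components_change H diff) _; apply: leq_trans bb.
by rewrite leq_add2r.
Qed.

Section Moves.
Variables (M i b k : nat).
Hypotheses (M2n : (M <= 2 * n)%N) (M2 : (2 <= M)%N).

(** A move touches at most five vertices: the detached one, its two neighbours and the ends of an
    added edge. *)
Let S' := states M.-1 i.+1 (b + 5).

(** An isolated vertex joins the list and an arbitrary edge is deleted as payment; backwards the
    ends of that edge have to be guessed. The summand [i] accounts for isolated vertices already in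
    the list. *)
Lemma isolated_moves (S : {set graph n * i.-tuple 'I_n}) : (S \subset states M i b)%SET ->
  {in S, forall s : graph n * i.-tuple 'I_n, (k + i <= #|[set z | isolated s.1 z]%SET|)%N} ->
  (#|S| * (k * M) <= #|S'| * (n * n))%N.
Proof.
move=> /fintype.subsetP Ss kS.
pose r (s : graph n * i.-tuple 'I_n) (s' : graph n * i.+1.-tuple 'I_n) :=
  [exists z, exists f : {set 'I_n}, [&& isolated s.1 z, z \notin s.2, f \in s.1 & s' == ((s.1 :\ f)%SET, [tuple of z :: s.2])]].
apply: (double_count (r := r)) => [[G l] Gl|[G' l'] _].
  have /statesP[Gm ul iso Nb] := Ss _ Gl; have /classP[G2 PG mE] := Gm.
  pose A := [set z | isolated G z && (z \notin l)]%SET.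
  have kA : (k <= #|A|)%N.
    rewrite -(leq_add2r i); apply: leq_trans (kS _ Gl) _ => /=.
    have sub : ([set z | isolated G z] \subset A :|: [set x in l])%SET.
      by apply/fintype.subsetP => z; rewrite !inE => ->; case: (z \in l); rewrite ?orbT.
    apply: leq_trans (subset_leq_card sub) _; apply: leq_trans (leq_card_setU _ _) _.
    by rewrite leq_add2l cardsE; apply: leq_trans (card_size _) _; rewrite size_tuple.
  apply: (@leq_trans (#|finset.setX A G|)); first by rewrite cardsX mE leq_mul2r kA orbT.
  rewrite -(card_in_imset (f := fun p : 'I_n * {set 'I_n} => ((G :\ p.2)%SET, [tuple of p.1 :: l]))); last first.
    move=> [z f] [z' f']; rewrite !inE /= => /andP[_ fG] /andP[_ f'G] [E ->]; congr pair.
    apply/eqP; apply: contraT => ff'; have : f \in (G :\ f')%SET by rewrite in_setD1 ff'.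
    by rewrite -E in_setD1 eqxx.
  apply: subset_leq_card; apply/fintype.subsetP => s' /imsetP[[z f] zfA ->].
  move: zfA; rewrite finset.in_setX /= finset.in_set => /andP[/andP[zi zl] fG].
  rewrite finset.in_set; apply/andP; split; last first.
    by apply/existsP; exists z; apply/existsP; exists f; rewrite /= zi zl fG eqxx.
  apply: (@cons_state M.-1 i b (b + 5) G (G :\ f)%SET l z f) => //.
  - by move=> s /iso; exact: isolatedD1.
  - apply/classP; split; first by move=> e; rewrite in_setD1 => /andP[_]; exact: G2.
      by apply: (pc_sub hP) PG; exact: finset.subD1set.
    by rewrite -mE (cardsD1 f G) fG.
  - exact: isolatedD1.
  - move=> e; rewrite in_setD1; case: (eqVneq e f) => [-> //|_]; by rewrite eqxx.
  - by rewrite (G2 f fG) leq_add2l.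
have nn : #|[set: 'I_n * 'I_n]%SET| = (n * n)%N by rewrite cardsT card_prod !card_ord.
rewrite -nn; apply: leq_trans (leq_imset_card (fun p : 'I_n * 'I_n => (([set p.1; p.2] |: G')%SET, [tuple of behead l'])) (mem [set: 'I_n * 'I_n]%SET)).
apply: subset_leq_card; apply/fintype.subsetP => -[G l]; rewrite inE => /andP[/Ss/statesP[Gm _ _ _]].
move=> /existsP[z /existsP[f /and4P[_ _ /= fG /eqP[-> ->]]]].
have /classP[G2 _ _] := Gm; have /eqP/cards2P[x [y [_ fE]]] := G2 f fG.
apply/imsetP; exists (x, y); rewrite ?inE//=; congr pair; last exact/val_inj.
by rewrite -fE finset.setD1K.
Qed.

(** Backwards the vertex is the head of the list, and its neighbourhood is one of at most [2 n]
    edges or [n] singletons. *)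
Lemma detach_moves (S : {set graph n * i.-tuple 'I_n}) : (S \subset states M i b)%SET ->
  {in S, forall s : graph n * i.-tuple 'I_n, (k <= #|[set z | detachable s.1 z]%SET|)%N} ->
  (#|S| * k <= #|S'| * (3 * n))%N.
Proof.
move=> /fintype.subsetP Ss kS.
pose r (s : graph n * i.-tuple 'I_n) (s' : graph n * i.+1.-tuple 'I_n) :=
  [exists z, detachable s.1 z && (s' == (detach s.1 z, [tuple of z :: s.2]))].
apply: (double_count (r := r)) => [[G l] Gl|[G' l'] /statesP[/classP[_ _ G'M] _ _ _]].
  have /statesP[Gm ul iso Nb] := Ss _ Gl; have /classP[G2 PG mE] := Gm.
  apply: leq_trans (kS _ Gl) _ => /=.
  rewrite -(card_in_imset (f := fun z => (detach G z, [tuple of z :: l]))); last first.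
    by move=> z z' _ _ [_ ->].
  apply: subset_leq_card; apply/fintype.subsetP => s' /imsetP[z]; rewrite inE => dz ->.
  rewrite inE; apply/andP; split; last by apply/existsP; exists z; rewrite /= dz eqxx.
  have d2 : (0 < #|incident G z| <= 2)%N by move: dz; rewrite /detachable => /orP[/eqP ->|/andP[/eqP ->]].
  apply: (@cons_state M.-1 i b (b + 5) G (detach G z) l z (z |: outer_ends G z)%SET) => //.
  - by move=> s /iso; exact: detach_keep.
  - exact: detach_class.
  - apply/negP => /iso /isolatedP Gz; case/andP: d2; rewrite card_gt0 => /set0Pn[e].
    by rewrite inE => /andP[/Gz/negbTE ->].
  - exact: detach_isolated.
  - move=> e diff; case: (boolP (e \in incident G z)) => [|eI]; first exact: incident_ends.
    move: diff; rewrite /detach; case: ifP => _; rewrite ?in_setU1 inE eI /= ?eqxx//.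
    case: (eqVneq e (outer_ends G z)) => [->|]; last by rewrite eqxx.
    by rewrite finset.subsetUr.
  - by rewrite leq_add2l; apply: leq_trans (outer_ends_card G2 _) _ => //; case/andP: d2.
pose F := (G' :|: [set [set w] | w in [set: 'I_n]%SET])%SET.
have Fc : (#|F| <= 3 * n)%N.
  apply: leq_trans (leq_card_setU _ _) _; rewrite G'M.
  apply: (@leq_trans (2 * n + n)); last by lia.
  apply: leq_add; first by lia.
  by apply: leq_trans (leq_imset_card _ _) _; rewrite cardsT card_ord.
apply: leq_trans Fc; pose z := thead l'.
apply: leq_trans (leq_imset_card (fun e => (((G' :\ e) :|: star z e)%SET, [tuple of behead l'])) (mem F)).
apply: subset_leq_card; apply/fintype.subsetP => -[G l]; rewrite inE => /andP[/Ss/statesP[Gm _ _ _]].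
move=> /existsP[t /andP[/= dt /eqP[G'E lE]]]; have /classP[G2 _ _] := Gm.
have tz : t = z by rewrite /z lE theadE.
apply/imsetP; exists (outer_ends G t); last first.
  by rewrite -tz G'E -(detach_undo G2 dt) lE; congr pair; exact/val_inj.
rewrite inE G'E /detach; move: dt; rewrite /detachable; case: eqP => [/(incident1 G2)[w [_ oE _]] _|_ _].
  by apply/orP; right; rewrite oE; apply: imset_f; rewrite inE.
by rewrite finset.setU11.
Qed.

Hypothesis many : {in class P (M - 2)%N, forall G : graph n, ((i + 2) * n <= #|addable_edges P G|)%N}.

(** Backwards both the added edge and the pair of neighbours of the deleted vertex are edges of the
    new graph, at most [2 n] choices each. *)
Lemma triangular_moves (S : {set graph n * i.-tuple 'I_n}) : (S \subset states M i b)%SET ->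
  {in S, forall s : graph n * i.-tuple 'I_n, (k <= #|[set z | triangular s.1 z]%SET|)%N} ->
  (#|S| * (k * n) <= #|S'| * ((2 * n) * (2 * n)))%N.
Proof.
move=> /fintype.subsetP Ss kS.
pose free (G : graph n) (l : i.-tuple 'I_n) z := [set f : {set 'I_n} in addable_edges P (remove_vertex G z) |
  all (fun v => v \notin f) (z :: l)]%SET.
pose r (s : graph n * i.-tuple 'I_n) (s' : graph n * i.+1.-tuple 'I_n) :=
  [exists z, exists f : {set 'I_n}, [&& triangular s.1 z, f \in free s.1 s.2 z &
    s' == ((f |: remove_vertex s.1 z)%SET, [tuple of z :: s.2])]].
have RM G z : G \in class P M -> triangular G z -> remove_vertex G z \in class P (M - 2)%N.
  by move=> /(remove_vertex_class hP z) + /andP[/eqP d2 _]; rewrite d2.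
apply: (double_count (r := r)) => [[G l] Gl|[G' l'] /statesP[/classP[_ _ G'M] _ _ _]].
  have /statesP[Gm ul iso Nb] := Ss _ Gl; have /classP[G2 PG mE] := Gm.
  have freen : {in [set z | triangular G z]%SET, forall z, (n <= #|free G l z|)%N}.
    move=> z; rewrite inE => tz; have := many (RM G z Gm tz).
    have A2 : {in addable_edges P (remove_vertex G z), forall e : {set 'I_n}, #|e| = 2%N}.
      by move=> e; rewrite inE => /and3P[/eqP].
    move=> /leq_trans /(_ (avoid_card (z :: l) A2)); rewrite /= size_tuple -/(free G l z).
    (* Avoiding [z] and the list costs [(i + 1) n] addable edges and leaves [n]. *)
    have -> : ((i + 2) * n = n + i.+1 * n)%N by lia.
    by rewrite leq_add2r.
  apply: (@leq_trans (#|[set z | triangular G z]%SET| * n)); first by rewrite leq_mul2r (kS _ Gl) orbT.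
  apply: leq_trans (dependent_pairs_card freen) _.
  rewrite -(card_in_imset (f := fun p : 'I_n * {set 'I_n} => ((p.2 |: remove_vertex G p.1)%SET, [tuple of p.1 :: l]))); last first.
    move=> [z f] [z' f']; rewrite !inE /= => /andP[_ /andP[/and3P[_ fG _] _]] /andP[_ /andP[/and3P[_ f'G _] _]] [E zz].
    rewrite -zz in E f'G *; congr pair; have : f \in (f' |: remove_vertex G z)%SET by rewrite -E finset.setU11.
    by case/setU1P => //; rewrite !inE => fR; move: fG; rewrite fR.
  apply: subset_leq_card; apply/fintype.subsetP => s' /imsetP[[z f]]; rewrite inE /= => /andP[tz' ff] ->.
  have tz : triangular G z by rewrite inE in tz'.
  rewrite inE; apply/andP; split; last first.
    by apply/existsP; exists z; apply/existsP; exists f; rewrite /= tz ff eqxx.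
  move: ff; rewrite inE => /andP[]; rewrite inE => /and3P[/eqP f2 fR /asboolP Pf] /= /andP[zf /allP lf].
  have /classP[R2 PR Rm] := RM G z Gm tz; have /andP[/eqP d2 _] := tz.
  apply: (@cons_state M.-1 i b (b + 5) G _ l z ((z |: outer_ends G z) :|: f)%SET) => //.
  - move=> s sl; apply/isolatedP => e /setU1P[->|]; first exact: lf.
    exact: (elimT (isolatedP _ _) (remove_vertex_keep z (iso s sl))).
  - apply/classP; split => //; first by move=> e /setU1P[->|/R2].
    by rewrite cardsU1 fR Rm; lia.
  - apply/negP => /iso /isolatedP Gz; have : (0 < #|incident G z|)%N by rewrite d2.
    by rewrite card_gt0 => /set0Pn[e]; rewrite inE => /andP[/Gz/negbTE ->].
  - apply/isolatedP => e /setU1P[-> //|].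
    exact: (elimT (isolatedP _ _) (remove_vertex_isolated G z)).
  - move=> e diff; case: (eqVneq e f) => [->|ef]; first exact: finset.subsetUr.
    case: (boolP (e \in incident G z)) => [eI|eI].
      by apply: fintype.subset_trans (incident_ends G2 eI) _; exact: finset.subsetUl.
    by move: diff; rewrite in_setU1 (negbTE ef) inE eI eqxx.
  - rewrite leq_add2l; apply: leq_trans (leq_card_setU _ _) _; rewrite f2.
    by apply: (@leq_add _ _ 3 2) => //; apply: outer_ends_card; rewrite // d2.
have G'c : (#|G'| <= 2 * n)%N by rewrite G'M; lia.
apply: (@leq_trans (#|finset.setX G' G'|)); last by rewrite cardsX leq_mul.
pose z := thead l'.
apply: leq_trans (leq_imset_card (fun p : {set 'I_n} * {set 'I_n} => (((G' :\ p.1) :|: star z p.2)%SET, [tuple of behead l'])) (mem (finset.setX G' G'))).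
apply: subset_leq_card; apply/fintype.subsetP => -[G l]; rewrite inE => /andP[/Ss/statesP[Gm _ _ _]].
move=> /existsP[t /existsP[f /and3P[/= tt ff /eqP[G'E lE]]]]; have /classP[G2 _ _] := Gm.
have tz : t = z by rewrite /z lE theadE.
have [GE oR] := triangular_undo G2 tt.
have fR : f \notin remove_vertex G t by move: ff; rewrite !inE => /andP[/and3P[]].
apply/imsetP; exists (f, outer_ends G t).
  by rewrite inE /= G'E finset.setU11 (finset.setU1r _ oR).
by rewrite /= -tz G'E finset.setU1K// -GE lE; congr pair; exact/val_inj.
Qed.

End Moves.
End Substep.

Section SwitchingArithmetic.
Implicit Types a s k n c M : nat.

Lemma cancel_isolated a s k n c M : (a * (k * M) <= s * (n * n))%N -> (n <= 20 * k)%N ->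
  (n <= 2 * c * M)%N -> (0 < n)%N -> (a <= 40 * c * s)%N.
Proof.
move=> H nk nM n0; rewrite -(leq_pmul2r (_ : 0 < n * n)%N); last by rewrite muln_gt0 n0.
have nn : (n * n <= 20 * k * (2 * c * M))%N := leq_mul nk nM.
apply: (@leq_trans (a * (20 * k * (2 * c * M)))); first by rewrite leq_mul2l nn orbT.
have -> : (a * (20 * k * (2 * c * M)) = 40 * c * (a * (k * M)))%N by lia.
by apply: (@leq_trans (40 * c * (s * (n * n)))); [rewrite leq_mul2l H orbT | lia].
Qed.

Lemma cancel_detach a s k n : (a * k <= s * (3 * n))%N -> (n <= 20 * k)%N -> (0 < k)%N ->
  (a <= 60 * s)%N.
Proof.
move=> H nk k0; rewrite -(leq_pmul2r k0); apply: leq_trans H _.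
apply: (@leq_trans (s * (3 * (20 * k)))); last by lia.
by rewrite leq_mul2l leq_mul2l nk !orbT.
Qed.

Lemma cancel_triangular a s k n : (a * (k * n) <= s * ((2 * n) * (2 * n)))%N -> (n <= 20 * k)%N ->
  (0 < n)%N -> (0 < k)%N -> (a <= 80 * s)%N.
Proof.
move=> H nk n0 k0; rewrite -(leq_pmul2r (_ : 0 < k * n)%N); last by rewrite muln_gt0 k0.
apply: leq_trans H _.
apply: (@leq_trans (s * (4 * ((20 * k) * n)))); last by lia.
have -> : (2 * n * (2 * n) = 4 * (n * n))%N by lia.
by rewrite !leq_mul2l leq_mul2r nk !orbT.
Qed.

End SwitchingArithmetic.

(** * One round of the switching, and its iteration *)

Section Rounds.
Variables (n : nat) (P : graph n -> Prop) (hP : planar_class P).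
Variables (h : nat) (H : graph h) (treeH : is_tree H).
Implicit Types (G F : graph n) (x y z v : 'I_n) (e f S : {set 'I_n}).

(** The degree sum is at most [2.1 n], so at most [0.7 n] vertices have degree above two, and the
    remaining [0.3 n] fall into three classes. *)
Lemma degree_split G : {in G, forall e, #|e| = 2%N} -> (20 * #|G| <= 21 * n)%N ->
  [\/ (n <= 10 * #|[set z | isolated G z]%SET|)%N,
      (n <= 10 * #|[set z | detachable G z]%SET|)%N |
      (n <= 10 * #|[set z | triangular G z]%SET|)%N].
Proof.
move=> G2 Gn; pose V3 := [set z | (2 < #|incident G z|)%N]%SET.
have V3c : (3 * #|V3| <= 2 * #|G|)%N.
  have <- : (\sum_(v in [set: 'I_n]%SET) #|incident G v| = 2 * #|G|)%N.
    rewrite (sum_incident (D := [set: 'I_n]%SET)); last by move=> e _; exact: finset.subsetT.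
    by rewrite mulnC -sum_nat_const; apply: eq_bigr => e /G2.
  rewrite mulnC -sum_nat_const big_mkcond [X in (_ <= X)%N]big_mkcond /=.
  by apply: leq_sum => v _; rewrite !inE; case: ifP => // /ltnW /ltnW.
set I := [set z | isolated G z]%SET; set D := [set z | detachable G z]%SET.
set T := [set z | triangular G z]%SET.
have nsum : (n <= #|I| + #|D| + #|T| + #|V3|)%N.
  have cover_all : ([set: 'I_n] \subset ((I :|: D) :|: T) :|: V3)%SET.
    apply/fintype.subsetP => z _; rewrite !inE /detachable /triangular.
    case: (ltngtP #|incident G z| 2%N) => [|_|_]; rewrite ?orbT//=; last by rewrite orbF; case: (_ \in G); rewrite ?orbT.
    case: (posnP #|incident G z|) => [z0|]; last by case: (#|_|) => [|[|]] //; rewrite eqxx ?orbT.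
    suff -> : isolated G z by [].
    apply/isolatedP => e eG; apply/negP => ze.
    by move/eqP: z0; rewrite cards_eq0 => /eqP/finset.setP/(_ e); rewrite !inE eG ze.
  have := subset_leq_card cover_all; rewrite cardsT card_ord => /leq_trans; apply.
  apply: leq_trans (leq_card_setU _ _) _; rewrite leq_add2r.
  apply: leq_trans (leq_card_setU _ _) _; rewrite leq_add2r.
  exact: leq_card_setU.
case: (leqP n (10 * #|I|)) => [|nI]; first by constructor 1.
case: (leqP n (10 * #|D|)) => [|nD]; first by constructor 2.
constructor 3; lia.
Qed.

Lemma substep M i b c0 : (20 * M <= 21 * n)%N -> (n <= 2 * c0 * M)%N -> (20 * i <= n)%N ->
  (2 <= M)%N -> (0 < n)%N ->
  {in class P (M - 2)%N, forall G : graph n, ((i + 2) * n <= #|addable_edges P G|)%N} ->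
  (#|states P H M i b| <= (40 * c0 + 140) * #|states P H M.-1 i.+1 (b + 5)|)%N.
Proof.
move=> Mn nM ni M2 n0 many; set A := states P H M i b; set B := states _ _ _ _ _.
have M2n : (M <= 2 * n)%N by lia.
(* [k] is [n / 20] rounded up, half of what [degree_split] offers; for isolated vertices the other
   half covers the [i] listed ones. *)
have [k [kn nk k0]] : exists k, [/\ (20 * k <= n + 19)%N, (n <= 20 * k)%N & (0 < k)%N].
  by exists ((n + 19) %/ 20)%N; split; lia.
pose SI := [set s in A | (k + i <= #|[set z | isolated s.1 z]%SET|)%N]%SET.
pose SD := [set s in A | (k <= #|[set z | detachable s.1 z]%SET|)%N]%SET.
pose ST := [set s in A | (k <= #|[set z | triangular s.1 z]%SET|)%N]%SET.
have cover_all : (A \subset (SI :|: SD) :|: ST)%SET.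
  apply/fintype.subsetP => -[G l] GA; have /statesP[Gm _ _ _] := GA.
  have /classP[G2 _ GM] := Gm; rewrite 2!finset.in_setU.
  case: (degree_split G2); rewrite ?GM// => big.
  - have c : (k + i <= #|[set z | isolated G z]%SET|)%N by lia.
    by have -> // : (G, l) \in SI by rewrite finset.in_set GA.
  - have c : (k <= #|[set z | detachable G z]%SET|)%N by lia.
    have -> : (G, l) \in SD by rewrite finset.in_set GA.
    by rewrite orbT.
  - have c : (k <= #|[set z | triangular G z]%SET|)%N by lia.
    have -> : (G, l) \in ST by rewrite finset.in_set GA.
    by rewrite orbT.
have SIA : (SI \subset A)%SET by apply/fintype.subsetP => s; rewrite finset.in_set => /andP[].
have SDA : (SD \subset A)%SET by apply/fintype.subsetP => s; rewrite finset.in_set => /andP[].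
have STA : (ST \subset A)%SET by apply/fintype.subsetP => s; rewrite finset.in_set => /andP[].
have cI : (#|SI| <= 40 * c0 * #|B|)%N.
  apply: (cancel_isolated (isolated_moves hP SIA (k := k) _)) nk nM n0.
  by move=> s; rewrite finset.in_set => /andP[].
have cD : (#|SD| <= 60 * #|B|)%N.
  apply: (cancel_detach _ nk k0); apply: (detach_moves hP) => //.
  by move=> s; rewrite finset.in_set => /andP[].
have cT : (#|ST| <= 80 * #|B|)%N.
  apply: (cancel_triangular _ nk n0 k0); apply: (triangular_moves hP) => //.
  by move=> s; rewrite finset.in_set => /andP[].
apply: leq_trans (subset_leq_card cover_all) _.
apply: leq_trans (leq_card_setU _ _) _; apply: leq_trans (leq_add (leq_card_setU _ _) (leqnn _)) _.
apply: leq_trans (leq_add (leq_add cI cD) cT) _; lia.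
Qed.

Definition marked m b : {set graph n * h.-tuple 'I_n} :=
  [set s : graph n * h.-tuple 'I_n | [&& s.1 \in class P m,
    [set x in s.2]%SET \in components s.1, op_isomorphic H s.1 [set x in s.2]%SET &
    (num_op_components H s.1 <= b)%N]]%SET.

Lemma markedP m b G (l : h.-tuple 'I_n) : reflect
  [/\ G \in class P m, [set x in l]%SET \in components G, op_isomorphic H G [set x in l]%SET &
    (num_op_components H G <= b)%N]
  ((G, l) \in marked m b).
Proof.
apply: (iffP idP) => [|H4]; first by rewrite finset.in_set => /and4P.
by rewrite finset.in_set; apply/and4P.
Qed.

(** Planting is injective. The [h - 1] edges of the tree bring [M - h] up to [M - 1], which leaves
    room for the edge inserted next. *)
Lemma placement_count M b : (h <= M)%N ->
  (#|states P H (M - h)%N h b| <= #|marked M.-1 (b + h)|)%N.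
Proof.
move=> hM; have h0 : (0 < h)%N by have [_ /andP[]] := treeH.
have /choice[Fof FofP] : forall S, exists F, #|S| = h -> [/\ #|F|.+1 = h,
    {in F, forall e, #|e| = 2%N /\ (e \subset S)%SET},
    forall G, {in S, forall s, isolated G s} -> P G -> P (G :|: F)%SET &
    forall G, {in S, forall s, isolated G s} ->
      S \in components (G :|: F)%SET /\ op_isomorphic H (G :|: F)%SET S].
  move=> S; case: (eqVneq #|S| h) => [Sh|/eqP Sh]; last by exists finset.set0.
  by have [F FP] := place_tree treeH hP Sh; exists F.
pose set_of (l : h.-tuple 'I_n) := [set x in l]%SET.
have set_card (l : h.-tuple 'I_n) : uniq l -> #|set_of l| = h.
  by move=> /card_uniqP ul; rewrite cardsE ul size_tuple.
have iso_set G (l : h.-tuple 'I_n) : {in l, forall s, isolated G s} -> {in set_of l, forall s, isolated G s}.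
  by move=> iso s; rewrite inE; exact: iso.
(* The old edges avoid the list and the planted ones lie inside it, so [G] is read off by
   disjointness. *)
have recover G (l : h.-tuple 'I_n) : uniq l -> {in l, forall s, isolated G s} ->
    G = [set e in (G :|: Fof (set_of l))%SET | [disjoint e & set_of l]]%SET.
  move=> ul iso; have [_ F2 _ _] := FofP _ (set_card l ul).
  apply/finset.setP => e; rewrite finset.in_set finset.in_setU.
  case: (boolP (e \in G)) => [eG|_] /=.
    apply/esym/pred0P => s /=; apply/negP => /andP[se]; rewrite inE => sl.
    by have := elimT (isolatedP _ _) (iso s sl) e eG; rewrite se.
  apply/esym/negP => /andP[/F2[e2 eS]]; rewrite -setI_eq0 (finset.setIidPl eS) => /eqP e0.
  by move: e2; rewrite e0 cards0.
rewrite -(card_in_imset (f := fun s : graph n * h.-tuple 'I_n => ((s.1 :|: Fof (set_of s.2))%SET, s.2))); last first.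
  move=> [G l] [G' l'] /statesP[_ ul iso _] /statesP[_ _ iso' _] /= [E ll].
  rewrite -ll in iso' E *; congr pair.
  by rewrite (recover G l ul iso) E -(recover G' l ul iso').
apply: subset_leq_card; apply/fintype.subsetP => s /imsetP[[G l] /statesP[Gm ul iso Nb] ->].
have [Fc F2 FP Fcomp] := FofP _ (set_card l ul); have /classP[G2 PG GM] := Gm.
have disj : (G :&: Fof (set_of l) = finset.set0)%SET.
  apply/eqP; rewrite -finset.subset0; apply/fintype.subsetP => e; rewrite finset.in_setI => /andP[eG /F2[e2 eS]].
  have [t te] : exists t, t \in e by apply/set0Pn; rewrite -cards_eq0 e2.
  have := fintype.subsetP eS t te; rewrite inE => tl.
  by have := elimT (isolatedP _ _) (iso t tl) e eG; rewrite te.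
have [Scomp Sop] := Fcomp G (iso_set G l iso).
apply/markedP; split => //=.
- apply/classP; split; first by move=> e; rewrite finset.in_setU => /orP[/G2 //|/F2[]].
    exact: FP (iso_set G l iso) PG.
  by rewrite cardsU disj cards0 GM; lia.
- rewrite -{2}(set_card l ul); apply: leq_trans (leq_add Nb (leqnn _)).
  apply: num_op_components_change => e; rewrite finset.in_setU.
  case: (e \in G) => //=; case: (boolP (e \in Fof _)) => // /F2[] //.
Qed.

Definition few m b : {set graph n} := [set G in class P m | (num_op_components H G <= b)%N]%SET.

(** A tuple is determined by its underlying set and the position of each entry in the enumeration of
    that set. *)
Lemma tuples_over_card (A : {set {set 'I_n}}) : (0 < n)%N -> {in A, forall S, #|S| = h} ->
  (#|[set l : h.-tuple 'I_n | [set x in l]%SET \in A]%SET| <= #|A| * h ^ h)%N.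
Proof.
move=> n0 Ah; pose x0 := Ordinal n0.
pose tup (p : {set 'I_n} * {ffun 'I_h -> 'I_h}) := [tuple nth x0 (enum p.1) (p.2 i) | i < h].
have <- : #|finset.setX A [set: {ffun 'I_h -> 'I_h}]%SET| = (#|A| * h ^ h)%N.
  by rewrite cardsX cardsT card_ffun card_ord.
apply: leq_trans (leq_imset_card tup (mem (finset.setX A [set: {ffun 'I_h -> 'I_h}]%SET))).
apply: subset_leq_card; apply/fintype.subsetP => l; rewrite finset.in_set => lA.
have idx i : (index (tnth l i) (enum [set x in l]%SET) < h)%N.
  have : (index (tnth l i) (enum [set x in l]%SET) < #|[set x in l]%SET|)%N.
    by rewrite cardE index_mem mem_enum inE mem_tnth.
  by rewrite (Ah _ lA).
apply/imsetP; exists ([set x in l]%SET, [ffun i => Ordinal (idx i)]); first by rewrite finset.in_setX lA inE.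
apply: eq_from_tnth => i; rewrite tnth_mktuple ffunE /= nth_index//.
by rewrite mem_enum inE mem_tnth.
Qed.

(** Forwards only edges avoiding the planted copy are used, so it is still a component afterwards.
    Backwards one guesses the inserted edge, then which of the at most [b + 2] copies of [H] was
    planted, and the order of its vertices. *)
Lemma insertion_count M b X : (0 < n)%N -> (0 < M)%N ->
  {in class P M.-1, forall G : graph n, (X + h * n <= #|addable_edges P G|)%N} ->
  (#|marked M.-1 b| * X <= #|few M (b + 2)| * (M * ((b + 2) * h ^ h)))%N.
Proof.
move=> n0 M0 many.
pose r (s : graph n * h.-tuple 'I_n) (G' : graph n) := [exists f : {set 'I_n},
  [&& f \in addable_edges P s.1, all (fun v => v \notin f) s.2 & G' == (f |: s.1)%SET]].
have diffE G f e : (e \in G) != (e \in (f |: G)%SET) -> (e \subset f)%SET.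
  by rewrite in_setU1; case: (eqVneq e f) => [-> //|_]; rewrite eqxx.
apply: (double_count (r := r)) => [[G l] /markedP[Gm Sc Sop Nb]|G'].
  have /classP[G2 PG GM] := Gm.
  have A2 : {in addable_edges P G, forall e : {set 'I_n}, #|e| = 2%N}.
    by move=> e; rewrite inE => /and3P[/eqP].
  have := leq_trans (many G Gm) (avoid_card l A2); rewrite size_tuple leq_add2r => /leq_trans; apply.
  set A := [set e : {set 'I_n} in _ | _]%SET.
  have AP f : f \in A -> f \in addable_edges P G /\ all (fun v => v \notin f) l.
    by rewrite finset.in_set => /andP.
  rewrite -(card_in_imset (f := fun f : {set 'I_n} => (f |: G)%SET) (D := A)); last first.
    move=> f f' /AP[]; rewrite inE => /and3P[_ fG _] _ _ E.
    have : f \in (f' |: G)%SET by rewrite -E finset.setU11.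
    by case/setU1P => // fG'; rewrite fG' in fG.
  apply: subset_leq_card; apply/fintype.subsetP => _ /imsetP[f /AP[fa lf] ->].
  rewrite finset.in_set; apply/andP; split; last first.
    by apply/existsP; exists f; rewrite /= fa lf eqxx.
  move: (fa); rewrite inE => /and3P[/eqP f2 fG /asboolP Pf]; rewrite finset.in_set; apply/andP; split.
    by apply/classP; split => //; [move=> e /setU1P[->|/G2] | rewrite cardsU1 fG GM; lia].
  apply: leq_trans (num_op_components_change H (diffE G f)) _.
  by rewrite f2 leq_add2r.
rewrite finset.in_set => /andP[/classP[G2 PG GM] Nb].
pose ops := [set C in components G' | op_isomorphic H G' C]%SET.
pose L := [set l : h.-tuple 'I_n | [set x in l]%SET \in ops]%SET.
have opsh : {in ops, forall S, #|S| = h}.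
  by move=> S; rewrite finset.in_set => /andP[_ /andP[/eqP]].
apply: (@leq_trans #|finset.setX G' L|); last first.
  rewrite cardsX GM leq_mul2l; apply/orP; right.
  by apply: leq_trans (tuples_over_card n0 opsh) _; rewrite leq_mul2r Nb orbT.
apply: leq_trans (leq_imset_card (fun p : {set 'I_n} * h.-tuple 'I_n => ((G' :\ p.1)%SET, p.2)) (mem (finset.setX G' L))).
apply: subset_leq_card; apply/fintype.subsetP => -[G l]; rewrite finset.in_set => /andP[/markedP[Gm Sc Sop _]].
move=> /existsP[f /and3P[/= fa lf /eqP G'E]].
have fG : f \notin G by move: fa; rewrite inE => /and3P[].
apply/imsetP; exists (f, l); last by rewrite /= G'E finset.setU1K.
rewrite finset.in_setX /= G'E finset.setU11 /= finset.in_set finset.in_set.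
have avoid : {in [set x in l]%SET, forall x, x \notin f} by move=> x; rewrite inE; exact: (allP lf).
have diff' e : (e \in (f |: G)%SET) != (e \in G) -> (e \subset f)%SET.
  by rewrite eq_sym; exact: diffE.
by rewrite G'E (component_transfer avoid diff' Sc) (op_isomorphic_transfer avoid diff' Sop).
Qed.

Section Iterate.
Variables (M c0 X : nat).
Hypotheses (Mn : (20 * M <= 21 * n)%N) (nM : (n <= 2 * c0 * (M - h))%N) (hn : (20 * h <= n)%N)
  (hM : (h + 2 <= M)%N) (n0 : (0 < n)%N)
  (many : forall m, (m <= M)%N -> {in class P m, forall G : graph n, ((h + 2) * n <= #|addable_edges P G|)%N})
  (manyX : {in class P M.-1, forall G : graph n, (X + h * n <= #|addable_edges P G|)%N}).
Let C := (40 * c0 + 140)%N.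

Lemma substeps b i : (i <= h)%N ->
  (#|states P H M 0 b| <= C ^ i * #|states P H (M - i)%N i (b + 5 * i)|)%N.
Proof.
elim: i => [_|i IH ih]; first by rewrite expn0 mul1n subn0 muln0 addn0.
apply: leq_trans (IH (ltnW ih)) _; rewrite expnSr -mulnA leq_mul2l; apply/orP; right.
have -> : (M - i.+1 = (M - i).-1)%N by lia.
have -> : (b + 5 * i.+1 = b + 5 * i + 5)%N by lia.
apply: substep => //; try by lia.
- apply: leq_trans nM _; rewrite leq_mul2l; apply/orP; right; lia.
- move=> G /(many (_ : M - i - 2 <= M)%N) big; apply: leq_trans (big _); last by lia.
  by rewrite leq_mul2r; apply/orP; right; lia.
Qed.

(** The [6 h + 2] collects 5 for each of the [h] detachments, [h] for planting and 2 for the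
    inserted edge. *)
Lemma round b : (#|few M b| * X <= C ^ h * h ^ h * M * (b + (6 * h + 2)) * #|few M (b + (6 * h + 2))|)%N.
Proof.
have s1 : (#|few M b| <= #|states P H M 0 b|)%N.
  rewrite -(card_imset (f := fun G : graph n => (G, [tuple]) : graph n * 0.-tuple 'I_n)); last by move=> G G' [].
  apply: subset_leq_card; apply/fintype.subsetP => s /imsetP[G]; rewrite finset.in_set => /andP[Gm Nb] ->.
  by apply/statesP.
have s2 := substeps b (leqnn h).
have s3 : (#|states P H (M - h)%N h (b + 5 * h)| <= #|marked M.-1 (b + 5 * h + h)|)%N.
  by apply: placement_count; lia.
have M0 : (0 < M)%N by lia.
have s4 := insertion_count (b + 5 * h + h) n0 M0 manyX.
have E : (b + 5 * h + h + 2 = b + (6 * h + 2))%N by lia.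
rewrite E in s4.
apply: (@leq_trans (C ^ h * #|marked M.-1 (b + 5 * h + h)| * X)).
  rewrite leq_mul2r; apply/orP; right; apply: leq_trans s1 _; apply: leq_trans s2 _.
  by rewrite leq_mul2l s3 orbT.
rewrite -mulnA; apply: (@leq_trans (C ^ h * (#|few M (b + (6 * h + 2))| * (M * ((b + (6 * h + 2)) * h ^ h))))).
  by rewrite leq_mul2l s4 orbT.
by rewrite leq_eqVlt; apply/orP; left; apply/eqP; ring.
Qed.

Lemma switching_bound b t :
  (#|few M b| * X ^ t <= (C ^ h * h ^ h * M * (b + (6 * h + 2) * t)) ^ t * #|class P M|)%N.
Proof.
elim: t b => [|t IH] b.
  rewrite !expn0 muln1 mul1n; apply: subset_leq_card; apply/fintype.subsetP => G.
  by rewrite finset.in_set => /andP[].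
have := IH (b + (6 * h + 2))%N.
have -> : (b + (6 * h + 2) + (6 * h + 2) * t = b + (6 * h + 2) * t.+1)%N by rewrite mulnS [RHS]addnA.
set Y := (b + (6 * h + 2) * t.+1)%N => {}IH; rewrite !expnS.
have bY : (b + (6 * h + 2) <= Y)%N by rewrite /Y mulnS [X in (_ <= X)%N]addnA leq_addr.
rewrite mulnA; apply: (@leq_trans (C ^ h * h ^ h * M * Y * #|few M (b + (6 * h + 2))| * X ^ t)).
  rewrite leq_mul2r; apply/orP; right; apply: leq_trans (round b) _.
  by rewrite leq_mul2r leq_mul2l bY !orbT.
by rewrite -[X in (X <= _)%N]mulnA -[X in (_ <= X)%N]mulnA leq_mul2l IH orbT.
Qed.

End Iterate.
End Rounds.

(** * Bounds on [add] and the final estimate *)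

Lemma bigminn_le (I : eqType) (r : seq I) (Q : pred I) (F : I -> nat) d j :
  j \in r -> Q j -> (\big[minn/d]_(i <- r | Q i) F i <= F j)%N.
Proof.
elim: r => [//|i r IH]; rewrite inE => /orP[/eqP <-|jr] Qj; rewrite big_cons.
  by rewrite Qj geq_minl.
by case: ifP => _; [apply: leq_trans (geq_minr _ _) (IH jr Qj) | exact: IH].
Qed.

Section AddBounds.
Variables (R : realType) (n : nat).
Implicit Types G : graph n.

Lemma add_le m G : G \in planar_graphs R n m -> (Defs.add R n m <= #|addable R G|)%N.
Proof. by move=> Gm; rewrite /Defs.add; apply: bigminn_le => //; exact: mem_index_enum. Qed.

(** The first hypothesis takes care of the default value of the minimum. *)
Lemma add_ge m k : (k <= 'C(n, 2))%N ->
  {in planar_graphs R n m, forall G, (k <= #|addable R G|)%N} -> (k <= Defs.add R n m)%N.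
Proof.
move=> kn kG; rewrite /Defs.add; elim/big_ind: _ => // a b ka kb.
by rewrite leq_min ka.
Qed.

(** The last edge is inserted into a graph with [m - 1] edges. Adding one addable edge gives a graph
    with [m] edges, and everything addable there was already addable in [G]. *)
Lemma add_le_pred m G : (0 < m)%N -> G \in planar_graphs R n m.-1 ->
  (0 < #|addable R G|)%N -> (Defs.add R n m <= #|addable R G|)%N.
Proof.
move=> m0 Gm; rewrite card_gt0 => /set0Pn[e eA].
have /classP[G2 PG GM] : G \in class (@planar R n) m.-1 by exact: Gm.
move: (eA); rewrite inE => /and3P[/eqP e2 eG /asboolP Pe].
have em : (e |: G)%SET \in planar_graphs R n m.
  have : (e |: G)%SET \in class (@planar R n) m.
    apply/classP; split => //; first by move=> f /setU1P[->|/G2].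
    by rewrite cardsU1 eG GM add1n prednK.
  by [].
apply: leq_trans (add_le em) _; apply: subset_leq_card; apply/fintype.subsetP => f.
rewrite !inE negb_or => /and3P[-> /andP[fe ->] /asboolP Pf] /=; apply/asboolP.
apply: (pc_sub (planar_planar_class R n)) Pf; apply: finset.setUS; exact: finset.subsetUr.
Qed.

End AddBounds.

Section FinalArithmetic.
Implicit Types n m t : nat.

Lemma bin2_ge K n : (2 * K < n)%N -> (K * n <= 'C(n, 2))%N.
Proof.
move=> Kn; rewrite bin2 -[X in (X <= _)%N]doubleK; apply: half_leq.
by case: n Kn => // n Kn /=; rewrite -muln2; nia.
Qed.

Lemma power_cancel f X Z s t : (0 < X)%N -> (f * X ^ t <= Z ^ t * s)%N -> (5 * Z <= X)%N ->
  (f * 5 ^ t <= s)%N.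
Proof.
move=> X0 H ZX; rewrite -(leq_pmul2r (_ : 0 < X ^ t)%N); last by rewrite expn_gt0 X0.
have ZXt : ((5 * Z) ^ t <= X ^ t)%N by elim: t {H} => // t IH; rewrite !expnS leq_mul.
apply: (@leq_trans (5 ^ t * (Z ^ t * s))).
  by rewrite [(f * _)%N]mulnC -mulnA leq_mul2l H orbT.
by rewrite mulnA -expnMn mulnC leq_mul2l ZXt orbT.
Qed.

Lemma edge_bound L n m : (20 <= 34 * L)%N -> (34 * L * m <= (34 * L).+1 * n)%N ->
  (20 * m <= 21 * n)%N.
Proof.
move=> L20 H; rewrite -(leq_pmul2l (_ : 0 < 34 * L)%N); last by lia.
apply: (@leq_trans (20 * ((34 * L).+1 * n))); first by rewrite mulnCA leq_mul2l H orbT.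
have : (20 * n <= 34 * L * n)%N by rewrite leq_mul2r L20 orbT.
lia.
Qed.

Lemma size_conditions c h n m : (n <= c * m)%N -> (2 * c * (h + 2) < n)%N ->
  (n <= 2 * c * (m - h))%N /\ (h + 2 <= m)%N.
Proof.
move=> nm cn; have hm : (h + 2 <= m)%N.
  rewrite leqNgt; apply/negP => mh; have : (c * m <= c * (h + 2))%N by rewrite leq_mul2l (ltnW mh) orbT.
  lia.
split => //; have -> : m = (h + (m - h))%N by lia.
move: nm; have {1}-> : m = (h + (m - h))%N by lia.
have -> : (h + (m - h) - h = m - h)%N by lia.
by move: (m - h)%N => d; lia.
Qed.

(** The 4 is a factor 2 from [m <= 2 n] and a factor 2 from [a - h n >= a / 2]. *)
Lemma ratio_bound D h n m t a : (m <= 2 * n)%N -> (2 * h * n <= a)%N ->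
  (5 * (4 * D * (6 * h + 3)) * (n * t) <= a)%N ->
  (5 * (D * m * (t + (6 * h + 2) * t)) <= a - h * n)%N.
Proof.
move=> mn ha Ea; have : (5 * (D * m * (t + (6 * h + 2) * t)) * 2 <= a)%N.
  apply: leq_trans Ea.
  have -> : (5 * (D * m * (t + (6 * h + 2) * t)) * 2 = 10 * (D * (6 * h + 3) * t) * m)%N by ring.
  have -> : (5 * (4 * D * (6 * h + 3)) * (n * t) = 10 * (D * (6 * h + 3) * t) * (2 * n))%N by ring.
  by rewrite leq_mul2l mn orbT.
lia.
Qed.

(** From [exp (- 1/2) >= 1/2] follows [exp (1/2) <= 2], hence [e <= 4]. *)
Lemma expR1_lt5 (R : realType) : expR 1 < 5 :> R.
Proof.
have half : (1 / 2 : R) <= expR (- (1 / 2)) by apply: le_trans (expR_ge1Dx _); lra.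
have e0 : 0 < expR (1 / 2 : R) by exact: expR_gt0.
have prod1 : expR (1 / 2 : R) * expR (- (1 / 2)) = 1 by rewrite -expRD subrr expR0.
have e2 : expR (1 / 2 : R) <= 2 by nra.
have -> : expR (1 : R) = expR (1 / 2) * expR (1 / 2) by rewrite -expRD; congr expR; lra.
nra.
Qed.

Lemma expR_nat (R : realType) t : expR (t%:R : R) = expR 1 ^+ t.
Proof.
elim: t => [|t IH]; first by rewrite expR0 expr0.
by rewrite -natr1 expRD IH exprSr.
Qed.

Lemma pow5_lt_expR (R : realType) t : (0 < t)%N -> (5 ^ t)%:R^-1 < expR (- t%:R) :> R.
Proof.
move=> t0; rewrite expRN expR_nat ltf_pV2 ?posrE ?exprn_gt0 ?expR_gt0 ?ltr0n ?expn_gt0//.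
by rewrite natrX ltr_pXn2r ?expR1_lt5 ?nnegrE ?expR_ge0// -lt0n.
Qed.

Lemma threshold_bounds (R : realType) (lambda : R) n m : 0 < lambda -> (0 < n)%N ->
  (0 < Defs.add R n m)%N -> let t := threshold lambda n m in
  (0 < t)%N /\ (t%:R - 1) * n%:R <= lambda * (Defs.add R n m)%:R.
Proof.
move=> l0 n0 a0; rewrite /threshold; set x := lambda * _ / _.
have nr : 0 < n%:R :> R by rewrite ltr0n.
have x0 : 0 < x by rewrite /x divr_gt0// mulr_gt0// ltr0n.
have cx : 0 < Num.ceil x by rewrite ceil_gt0.
split; first by rewrite absz_gt0 gt_eqF.
have -> : (`|Num.ceil x|%N%:R : R) = (Num.ceil x)%:~R by rewrite natr_absz gtr0_norm.
rewrite -ler_pdivlMr// -/x.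
by have /ltW := ceilB1_lt x; rewrite intrB.
Qed.

End FinalArithmetic.

Theorem theorem6p4 (R : realType) (h : nat) (H : graph h) (c : R)
  (treeH : is_tree H) (c_gt0 : 0 < c) :
  exists2 lambda : R, 0 < lambda &
  forall (m : nat -> nat) (eps : nat -> R),
    eps @ \oo --> (0 : R) ->
    (\forall n \near \oo,
       c * n%:R <= (m n)%:R /\ (m n)%:R <= (1 + eps n) * n%:R) ->
    \forall n \near \oo,
      let t := threshold lambda n (m n) in
      prob_planar R (m n)
        (fun G : graph n => (num_op_components H G < t)%N)
      < expR (- t%:R).
Proof.
have [_ /andP[h0 _] _] := treeH.
pose c0 := Num.bound c^-1.
have c0P : 1 <= c * c0%:R.
  have := archi_boundP (x := c^-1); rewrite invr_ge0 (ltW c_gt0) => /(_ isT) lt.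
  by rewrite mulrC -ler_pdivrMr// div1r ltW.
(* [D] is the constant of one round; [6 h + 3] is the factor in [t + (6 h + 2) t], the tolerance
   after [t] rounds. *)
pose D := ((40 * c0 + 140) ^ h * h ^ h)%N; pose E := (4 * D * (6 * h + 3))%N.
(* In [K] the [10 E] absorbs the rounding in [t], and [2 h] makes [h n] at most half of [add]. [L]
   is the parameter of [addable_lower]. *)
pose K := (10 * E + 2 * h + 2)%N; pose L := (4 * K + 14)%N.
have E0 : (0 < E)%N by rewrite /E /D !muln_gt0 !expn_gt0 h0 !addn_gt0 !orbT.
have L0 : (20 <= 34 * L)%N by rewrite /L; lia.
have q0 : 0 < (34 * L)%:R :> R by rewrite ltr0n; lia.
have E10 : 0 < (10 * E)%:R :> R by rewrite ltr0n muln_gt0 E0.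
have l0 : 0 < (10 * E)%:R^-1 :> R by rewrite invr_gt0.
exists (10 * E)%:R^-1 => // m eps eps0 hm.
(* The precision in [m <= (1 + o(1)) n] that [addable_lower] requires. *)
have epsn : \forall n \near \oo, eps n < (34 * L)%:R^-1.
  by apply: (cvgr_lt (0 : R)) => //; rewrite invr_gt0.
pose N0 := (162 * L ^ 3 + 20 * h + 2 * c0 * (h + 2) + 2 * K)%N.
have bign : \forall n \near \oo, (N0 < n)%N by exact: nbhs_infty_gt.
apply: filterS3 epsn bign hm => n en Nn [cm mle] /=.
have [n162 n20 nc nK] : [/\ (162 * L ^ 3 < n)%N, (20 * h <= n)%N, (2 * c0 * (h + 2) < n)%N & (2 * K < n)%N].
  by move: Nn; rewrite /N0; split; lia.
have n0 : (0 < n)%N by lia.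
have nr : 0 < n%:R :> R by rewrite ltr0n.
have cM : (n <= c0 * m n)%N.
  rewrite -(ler_nat R) natrM; apply: (@le_trans _ _ (c0%:R * (c * n%:R))).
    by rewrite mulrA [c0%:R * c]mulrC ler_peMl// ltW.
  by rewrite ler_wpM2l.
have mL : (34 * L * m n <= (34 * L).+1 * n)%N.
  rewrite -(ler_nat R) natrM [X in _ <= X]natrM -natr1.
  have qe : (34 * L)%:R * eps n <= 1 by rewrite -ler_pdivlMl// mulr1 ltW.
  apply: (@le_trans _ _ ((34 * L)%:R * ((1 + eps n) * n%:R))); first by rewrite ler_wpM2l// ltW.
  rewrite mulrA; apply: ler_wpM2r; first exact: ltW.
  by move: qe; set q := (34 * L)%:R => qe; rewrite mulrDr mulr1; lra.
have m21 := edge_bound L0 mL.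
have m2n : (m n <= 2 * n)%N by lia.
have [nM hM] := size_conditions cM nc.
have hP := planar_planar_class R n.
have manyK k : (k <= m n)%N -> {in class (@planar R n) k, forall G : graph n, (K * n <= #|addable R G|)%N}.
  move=> km G /classP[G2 PG GM]; apply: (addable_lower hP G2 PG n162).
  by apply: leq_trans mL; rewrite leq_mul2l GM km orbT.
have many k : (k <= m n)%N ->
    {in class (@planar R n) k, forall G : graph n, ((h + 2) * n <= #|addable_edges (@planar R n) G|)%N}.
  move=> km G Gk; apply: leq_trans (manyK k km G Gk); rewrite leq_mul2r /K; lia.
have aK : (K * n <= Defs.add R n (m n))%N.
  by apply: add_ge; [exact: bin2_ge | exact: manyK].
set a := Defs.add R n (m n) in aK *.
have a0 : (0 < a)%N by apply: leq_trans aK; rewrite muln_gt0 n0 andbT /K; lia.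
have ha : (2 * h * n <= a)%N by apply: leq_trans aK; rewrite leq_mul2r /K; lia.
have manyX : {in class (@planar R n) (m n).-1, forall G : graph n,
    ((a - h * n) + h * n <= #|addable_edges (@planar R n) G|)%N}.
  move=> G Gm; rewrite subnK; last by lia.
  apply: add_le_pred => //; first by lia.
  by apply: leq_trans (manyK _ (leq_pred _) G Gm); rewrite muln_gt0 n0 andbT /K; lia.
have [t0 tle] := threshold_bounds l0 n0 a0.
set t := threshold _ _ _ in t0 tle *.
(* The ceiling gives [10 E n (t - 1) <= a], and [K] gives [10 E n <= a]; their sum is twice the
   claim. *)
have Et : (5 * E * (n * t) <= a)%N.
  have : (t%:R - 1) * n%:R * (10 * E)%:R <= a%:R :> R.
    by rewrite -ler_pdivlMr// [X in _ <= X]mulrC.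
  have : (10 * E * n)%:R <= a%:R :> R.
    by rewrite ler_nat; apply: leq_trans aK; rewrite leq_mul2r /K; lia.
  rewrite -(ler_nat R) !natrM; lra.
have ratio := ratio_bound m2n ha Et.
have X0 : (0 < a - h * n)%N.
  rewrite subn_gt0; apply: leq_trans aK; rewrite ltn_pmul2r// /K; lia.
(* The event of fewer than [t] copies is relaxed to at most [t], and [t] rounds are played from
   there. *)
have bound := switching_bound hP treeH m21 nM n20 hM n0 many manyX t t.
have few5 := power_cancel X0 bound ratio.
(* If there is no such planar graph, the probability is 0 through division by zero. *)
rewrite /prob_planar; have [p0|p0] := posnP #|planar_graphs R n (m n)|.
  by rewrite p0 invr0 mulr0 expR_gt0.
apply: le_lt_trans (pow5_lt_expR R t0).
rewrite ler_pdivrMr ?ltr0n// ler_pdivlMl ?ltr0n ?expn_gt0// -natrM ler_nat mulnC.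
apply: leq_trans few5; rewrite leq_mul2r; apply/orP; right; apply: subset_leq_card.
by apply/fintype.subsetP => G; rewrite !finset.in_set => /andP[-> /ltnW].
Qed.
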